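(* Let $0<p<\infty$ and let $f=p^+f^++p^-f^-\in H^p(D,\mathbb{B})$ be such that $f^+\in H^p_w(D)$ for some $w\in L^q(D)$, where either $q>2$, or $1<q\le 2$ and $p<\frac{q}{2-q}$. Then $f$ has a nontangential limit $f_{nt}\in L^p(\partial D,\mathbb{B})$ (at almost every point of $\partial D$), and $$\lim_{r\nearrow1}\int_0^{2\pi}\|f_{nt}(e^{i\theta})-f(re^{i\theta})\|_{\mathbb{B}}^p\,d\theta=0.$$
   Context: $D=\{z\in\mathbb{C}:|z|<1\}$, $z=x+iy$; $z^*$ denotes complex conjugation. $L^q(D)$ is the complex-valued Lebesgue space. The quantity $\frac{q}{2-q}$ is read as $+\infty$ when $q=2$. The bicomplex numbers $\mathbb{B}$ are the elements $z_1+jz_2$ with $z_1,z_2\in\mathbb{C}$, $j^2=-1$, forming a commutative $\mathbb{C}$-algebra. Put $p^\pm=\frac12(1\pm ij)$; these are idempotents with $p^+p^-=0$ and $p^++p^-=1$. Every $w\in\mathbb{B}$ is uniquely $w=p^+w^++p^-w^-$ with $w^\pm\in\mathbb{C}$; for $\mathbb{B}$-valued functions $w^\pm$ are the component functions. The norm is $\|w\|_{\mathbb{B}}=\sqrt{(|w^+|^2+|w^-|^2)/2}$. $L^p(\partial D,\mathbb{B})$ is the set of measurable $g:\partial D\to\mathbb{B}$ with $\int_{\partial D}\|g\|_{\mathbb{B}}^p\,d\sigma<\infty$. $\bar\partial=\frac12\left(\frac{\partial}{\partial x}+j\frac{\partial}{\partial y}\right)$, equivalently $\bar\partial w=p^+\frac{\partial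 w^+}{\partial z}+p^-\frac{\partial w^-}{\partial z^*}$. $H^p(D,\mathbb{B})$ is the set of $f:D\to\mathbb{B}$ with $\bar\partial f=0$ and $\sup_{0<r<1}\int_0^{2\pi}\|f(re^{i\theta})\|_{\mathbb{B}}^p\,d\theta<\infty$. For $w:D\to\mathbb{C}$, $H^p_w(D)$ is the set of $g:D\to\mathbb{C}$ with $\frac{\partial g}{\partial z^*}=w$ and $\sup_{0<r<1}\int_0^{2\pi}|g(re^{i\theta})|^p\,d\theta<\infty$. *)

(* Defs.v *)
From HB Require Import structures.
From mathcomp Require Import all_boot all_order all_algebra.
From mathcomp Require Import all_classical all_reals all_analysis.
From mathcomp Require Import complex ring.

Set Implicit Arguments.
Unset Strict Implicit.
Unset Printing Implicit Defensive.

Import Order.TTheory GRing.Theory Num.Theory.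
Import numFieldNormedType.Exports.
Import Normc.

Local Open Scope classical_set_scope.
Local Open Scope ring_scope.

(* [Bicomplex z1 z2] is z1 + j z2. *)
Record bicomplex (R : realType) : Type := Bicomplex { bc1 : R[i]; bc2 : R[i] }.

Section bicomplex_algebra.
Context {R : realType}.
Local Notation C := R[i].
Local Notation B := (bicomplex R).

Definition bc_pair (w : B) : C * C := (bc1 w, bc2 w).
Definition pair_bc (u : C * C) : B := Bicomplex u.1 u.2.

Fact bc_pairK : cancel bc_pair pair_bc.
Proof. by case. Qed.

HB.instance Definition _ := Choice.copy B (can_type bc_pairK).

Definition bc_zero : B := Bicomplex 0 0.
Definition bc_opp (v : B) : B := Bicomplex (- bc1 v) (- bc2 v).
Definition bc_add (v w : B) : B := Bicomplex (bc1 v + bc1 w) (bc2 v + bc2 w).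
Definition bc_one : B := Bicomplex 1 0.
Definition bc_mul (v w : B) : B :=
  Bicomplex (bc1 v * bc1 w - bc2 v * bc2 w) (bc1 v * bc2 w + bc2 v * bc1 w).
Definition bc_scale (a : C) (v : B) : B := Bicomplex (a * bc1 v) (a * bc2 v).

Fact bc_addA : associative bc_add.
Proof. by move=> u v w; congr Bicomplex; rewrite /=; ring. Qed.

Fact bc_addC : commutative bc_add.
Proof. by move=> u v; congr Bicomplex; rewrite /=; ring. Qed.

Fact bc_add0 : left_id bc_zero bc_add.
Proof. by case=> a b; congr Bicomplex; rewrite /=; ring. Qed.

Fact bc_addN : left_inverse bc_zero bc_opp bc_add.
Proof. by move=> u; congr Bicomplex; rewrite /=; ring. Qed.

HB.instance Definition _ :=
  GRing.isZmodule.Build B bc_addA bc_addC bc_add0 bc_addN.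

Fact bc_mulA : associative bc_mul.
Proof. by move=> u v w; congr Bicomplex; rewrite /=; ring. Qed.

Fact bc_mulC : commutative bc_mul.
Proof. by move=> u v; congr Bicomplex; rewrite /=; ring. Qed.

Fact bc_mul1 : left_id bc_one bc_mul.
Proof. by case=> a b; congr Bicomplex; rewrite /=; ring. Qed.

Fact bc_mulDl : left_distributive bc_mul bc_add.
Proof. by move=> u v w; congr Bicomplex; rewrite /=; ring. Qed.

Fact bc_oner_neq0 : bc_one != bc_zero.
Proof. by apply/eqP => -[/eqP]; rewrite oner_eq0. Qed.

HB.instance Definition _ := GRing.Zmodule_isComNzRing.Build B
  bc_mulA bc_mulC bc_mul1 bc_mulDl bc_oner_neq0.

Fact bc_scaleA (a b : C) (v : B) : bc_scale a (bc_scale b v) = bc_scale (a * b) v.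
Proof. by congr Bicomplex; rewrite /=; ring. Qed.

Fact bc_scale1 : left_id 1 bc_scale.
Proof. by case=> a b; congr Bicomplex; rewrite /=; ring. Qed.

Fact bc_scaleDr : right_distributive bc_scale +%R.
Proof. by move=> a u v; congr Bicomplex; rewrite /=; ring. Qed.

Fact bc_scaleDl (v : B) : {morph bc_scale^~ v : a b / a + b}.
Proof. by move=> a b; congr Bicomplex; rewrite /=; ring. Qed.

HB.instance Definition _ := GRing.Zmodule_isLmodule.Build C B
  bc_scaleA bc_scale1 bc_scaleDr bc_scaleDl.

Fact bc_scaleAl (a : C) (v w : B) : a *: (v * w) = a *: v * w.
Proof. by congr Bicomplex; rewrite /=; ring. Qed.

HB.instance Definition _ := GRing.Lmodule_isLalgebra.Build C B bc_scaleAl.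

Definition bc_j : B := Bicomplex 0 1.
Definition bc_pplus : B := 2^-1 *: (1 + 'i%C *: bc_j).
Definition bc_pminus : B := 2^-1 *: (1 - 'i%C *: bc_j).

(* Since p^+ j = - i p^+ and p^- j = i p^-, the coordinates of z1 + j z2 with
   respect to p^+ and p^- are z1 - i z2 and z1 + i z2; see [bc_decomp]. *)
Definition bc_plus (w : B) : C := bc1 w - 'i%C * bc2 w.
Definition bc_minus (w : B) : C := bc1 w + 'i%C * bc2 w.

Definition bc_norm (w : B) : R :=
  Num.sqrt ((normc (bc_plus w) ^+ 2 + normc (bc_minus w) ^+ 2) / 2).

Let ii : 'i%C ^+ 2 = -1 :> C.
Proof. by rewrite expr2; simpc. Qed.

Lemma bc_j_sqr : bc_j ^+ 2 = -1.
Proof. by rewrite expr2; congr Bicomplex; rewrite /=; ring. Qed.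

Lemma bc_pplus_idem : bc_pplus * bc_pplus = bc_pplus.
Proof. by congr Bicomplex; rewrite /=; field: ii. Qed.

Lemma bc_pminus_idem : bc_pminus * bc_pminus = bc_pminus.
Proof. by congr Bicomplex; rewrite /=; field: ii. Qed.

Lemma bc_pplus_pminus : bc_pplus * bc_pminus = 0.
Proof. by congr Bicomplex; rewrite /=; field: ii. Qed.

Lemma bc_pplusD : bc_pplus + bc_pminus = 1.
Proof. by congr Bicomplex; rewrite /=; field: ii. Qed.

Lemma bc_decomp (w : B) :
  w = bc_plus w *: bc_pplus + bc_minus w *: bc_pminus.
Proof.
by case: w => a b; congr Bicomplex; rewrite /bc_plus /bc_minus /=; field: ii.
Qed.

Lemma bc_decomp_unique (a b : C) :
  bc_plus (a *: bc_pplus + b *: bc_pminus) = a /\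
  bc_minus (a *: bc_pplus + b *: bc_pminus) = b.
Proof. by split; rewrite /bc_plus /bc_minus /=; field: ii. Qed.

End bicomplex_algebra.

Section disc.
Context {R : realType}.
Local Notation C := R[i].
Local Notation B := (bicomplex R).
Local Notation re := (@complex.Re R).
Local Notation im := (@complex.Im R).
Local Notation leb := (@lebesgue_measure R).
Local Notation leb2 := (leb \x leb)%E.

Definition unit_disc : set C := [set z | normc z < 1].

(* Plane integrals, real differentiability and neighborhoods are expressed on R * R. *)
Definition of_plane (a : R * R) : C := (a.1 +i* a.2)%C.
Definition to_plane (z : C) : R * R := (re z, im z).
Definition plane_disc : set (R * R) := of_plane @^-1` unit_disc.

Definition eitheta (t : R) : C := (cos t +i* sin t)%C.
Definition on_circle (r t : R) : C := (r%:C)%C * eitheta t.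
Definition angles : set R := `[0, 2 * pi].

Definition real_differentiable (g : C -> C) (z : C) : Prop :=
  differentiable (re \o g \o of_plane) (to_plane z) /\
  differentiable (im \o g \o of_plane) (to_plane z).

Definition dir_derive (v : R * R) (g : C -> C) (z : C) : C :=
  ('D_v (re \o g \o of_plane) (to_plane z) +i*
   'D_v (im \o g \o of_plane) (to_plane z))%C.

Definition dx : (C -> C) -> C -> C := dir_derive (1, 0).
Definition dy : (C -> C) -> C -> C := dir_derive (0, 1).
Definition d_z (g : C -> C) (z : C) : C := 2^-1 * (dx g z - 'i%C * dy g z).
Definition d_zbar (g : C -> C) (z : C) : C := 2^-1 * (dx g z + 'i%C * dy g z).

Definition bc_dx (f : C -> B) (z : C) : B :=
  Bicomplex (dx (@bc1 R \o f) z) (dx (@bc2 R \o f) z).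
Definition bc_dy (f : C -> B) (z : C) : B :=
  Bicomplex (dy (@bc1 R \o f) z) (dy (@bc2 R \o f) z).
Definition bc_dbar (f : C -> B) (z : C) : B :=
  2^-1 *: (bc_dx f z + bc_j * bc_dy f z).

Let dir_derive_comb (v : R * R) (s : R) (g h : C -> C) (z : C) :
  real_differentiable g z -> real_differentiable h z ->
  dir_derive v (fun x => g x + s%:C%C * 'i%C * h x) z =
  dir_derive v g z + s%:C%C * 'i%C * dir_derive v h z.
Proof.
move=> [g1 g2] [h1 h2]; rewrite /dir_derive.
set k := fun x => _.
have -> : re \o k \o of_plane =
    (re \o g \o of_plane) + (- s) *: (im \o h \o of_plane).
  apply/funext => b; rewrite /k /GRing.add /GRing.scale /=.
  by case: (g _) (h _) => [a1 a2] [b1 b2] /=; rewrite /GRing.scale /=; ring.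
have -> : im \o k \o of_plane =
    (im \o g \o of_plane) + s *: (re \o h \o of_plane).
  apply/funext => b; rewrite /k /GRing.add /GRing.scale /=.
  by case: (g _) (h _) => [a1 a2] [b1 b2] /=; rewrite /GRing.scale /=; ring.
rewrite !deriveD ?deriveZ; do ?[exact: diff_derivable |
  apply: derivableZ; exact: diff_derivable].
by apply/eqP; rewrite eq_complex /= /GRing.scale /=; apply/andP; split;
  apply/eqP; ring.
Qed.

Lemma bc_dbarE (f : C -> B) (z : C) :
  real_differentiable (@bc1 R \o f) z -> real_differentiable (@bc2 R \o f) z ->
  bc_dbar f z =
  d_z (@bc_plus R \o f) z *: bc_pplus + d_zbar (@bc_minus R \o f) z *: bc_pminus.
Proof.
move=> f1 f2; rewrite [LHS]bc_decomp; congr (_ *: _ + _ *: _).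
- have -> : @bc_plus R \o f =
      fun x => bc1 (f x) + (-1)%:C%C * 'i%C * bc2 (f x).
    by apply/funext => x; rewrite /bc_plus /= rmorphN1; ring.
  rewrite /d_z /dx /dy !dir_derive_comb// /bc_plus /= rmorphN1.
  have ii : 'i%C ^+ 2 = -1 :> C by rewrite expr2; simpc.
  by rewrite /dx /dy; field: ii.
- have -> : @bc_minus R \o f =
      fun x => bc1 (f x) + 1%:C%C * 'i%C * bc2 (f x).
    by apply/funext => x; rewrite /bc_minus /= rmorph1; ring.
  rewrite /d_zbar /dx /dy !dir_derive_comb// /bc_minus /= rmorph1.
  have ii : 'i%C ^+ 2 = -1 :> C by rewrite expr2; simpc.
  by rewrite /dx /dy; field: ii.
Qed.

(* Solutions of dbar f = 0 are taken in the classical sense: f is real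
   differentiable at each point of D. *)
Definition bc_holomorphic (f : C -> B) : Prop :=
  forall z, unit_disc z ->
    [/\ real_differentiable (@bc1 R \o f) z,
        real_differentiable (@bc2 R \o f) z & bc_dbar f z = 0].

Definition cmeasurable d (T : measurableType d) (A : set T) (g : T -> C) :=
  measurable_fun A (re \o g) /\ measurable_fun A (im \o g).

Definition cintegral d (T : measurableType d) (mu : {measure set T -> \bar R})
    (A : set T) (g : T -> C) : C :=
  (Rintegral mu A (re \o g) +i* Rintegral mu A (im \o g))%C.

Definition Lq_disc (q : R) (w : C -> C) : Prop :=
  cmeasurable plane_disc (w \o of_plane) /\
  (\int[leb2]_(a in plane_disc) (normc (w (of_plane a)) `^ q)%:E < +oo)%E.

Definition loc_integrable_disc (w : C -> C) : Prop :=
  cmeasurable plane_disc (w \o of_plane) /\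
  forall r : R, r < 1 ->
    (\int[leb2]_(a in [set a | (normc (of_plane a) <= r)%R])
       (normc (w (of_plane a)))%:E < +oo)%E.

Fixpoint k_smooth (k : nat) (phi : C -> C) : Prop :=
  if k is k'.+1 then
    [/\ forall z, real_differentiable phi z,
        k_smooth k' (dx phi) & k_smooth k' (dy phi)]
  else continuous (re \o phi \o of_plane) /\
       continuous (im \o phi \o of_plane).

Definition test_function (phi : C -> C) : Prop :=
  (forall k, k_smooth k phi) /\
  exists2 r : R, r < 1 & forall z, r <= normc z -> phi z = 0.

(* dg/dz^* = w on D in the sense of distributions, as is appropriate for a
   datum w in L^q(D), which is only determined almost everywhere. *)
Definition weak_d_zbar (g w : C -> C) : Prop :=
  [/\ loc_integrable_disc g, loc_integrable_disc w &
      forall phi, test_function phi ->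
        cintegral leb2 plane_disc
          (fun a => g (of_plane a) * d_zbar phi (of_plane a)) =
        - cintegral leb2 plane_disc
            (fun a => w (of_plane a) * phi (of_plane a))].

Definition circle_mean (p : R) (N : C -> R) (r : R) : \bar R :=
  (\int[leb]_(t in angles) (N (on_circle r t) `^ p)%:E)%E.

Definition bounded_means (p : R) (N : C -> R) : Prop :=
  (ereal_sup [set circle_mean p N r | r in `]0%R, 1%R[] < +oo)%E.

Definition Hp_bicomplex (p : R) (f : C -> B) : Prop :=
  bc_holomorphic f /\ bounded_means p (fun z => bc_norm (f z)).

Definition Hp_w (p : R) (w g : C -> C) : Prop :=
  weak_d_zbar g w /\ bounded_means p (fun z => normc (g z)).

(* q / (2 - q), only used for 1 < q <= 2. *)
Definition crit_exponent (q : R) : \bar R :=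
  if q == 2 then +oo%E else (q / (2 - q))%:E.

(* A function on the unit circle is represented by any extension of it to C;
   only its values at the points [eitheta t] matter. *)
Definition Lp_circle (p : R) (g : C -> B) : Prop :=
  [/\ cmeasurable angles (@bc1 R \o g \o eitheta),
      cmeasurable angles (@bc2 R \o g \o eitheta) &
      (\int[leb]_(t in angles) (bc_norm (g (eitheta t)) `^ p)%:E < +oo)%E].

(* The nontangential approach regions at zeta are the sets [stolz a zeta],
   for all apertures a > 1. *)
Definition stolz (a : R) (zeta : C) : set C :=
  [set z | unit_disc z /\ normc (z - zeta) < a * (1 - normc z)].

Definition nontangential_limit_at (f : C -> B) (zeta : C) (l : B) : Prop :=
  forall a : R, 1 < a ->
    bc_norm (f (of_plane b) - l)
      @[b --> within (of_plane @^-1` stolz a zeta) (nbhs (to_plane zeta))] --> 0.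

Definition nontangential_limit (f g : C -> B) : Prop :=
  {ae leb, forall t, angles t ->
    nontangential_limit_at f (eitheta t) (g (eitheta t))}.

End disc.

(* Main.v *)
Require Import Defs.
From HB Require Import structures.
From mathcomp Require Import all_boot all_order all_algebra.
From mathcomp Require Import all_classical all_reals all_analysis.
From mathcomp Require Import measurable_realfun.
From mathcomp Require Import complex ring lra.

Set Implicit Arguments.
Unset Strict Implicit.
Unset Printing Implicit Defensive.

Import Order.TTheory GRing.Theory Num.Theory.
Import numFieldNormedType.Exports.
Import Normc.

Local Open Scope classical_set_scope.
Local Open Scope ring_scope.

(** The equation dbar f = 0 splits in the idempotent basis: f^- is holomorphic
    and f^+ is antiholomorphic, so that the conjugate of f^+ and f^- are two
    holomorphic functions on D with bounded p-means ([hardy_components]).  The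
    theorem is therefore the boundary theory of the Hardy space H^p, for every
    p > 0, applied to both components.

    Let F be holomorphic with bounded p-means.  The function |F|^(p/2) is
    subharmonic ([subharmonic_norm_powR]) and its square means are bounded, so
    a weak limit phi in L^2 of its restrictions to circles satisfies
    |F|^(p/2) <= u, where u is the Poisson integral of phi
    ([L2_poisson_majorant], [hardy_majorant]).

    Nontangential limits.  Poisson integrals have nontangential limits at
    Lebesgue points ([ae_nontangential_poisson]), and the real and imaginary
    parts of a bounded holomorphic function are Poisson integrals
    ([ae_nt_limit_bounded]).  If G = exp (- h) with h holomorphic and Re h = u,
    then |G| = e^(-u) <= 1, and F G is bounded since |F| <= u^(2/p).  Thus F G
    and G have nontangential limits, and so does their quotient F, because the
    limit of |G| is e^(-phi), which is not 0 ([ae_nt_limit_hardy]).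

    Convergence in L^p.  The p-th power of the distance from F (r e^(it)) to the
    boundary value is at most 2^p (u (r e^(it))^2 + phi (t)^2).  The right-hand
    side converges almost everywhere, and the mean of u^2 on the circle of
    radius r is at most that of phi^2 by Jensen's inequality, so Fatou's lemma
    gives the convergence of the means to 0 ([mean_cvg_pratt],
    [mean_boundary_value_cvg]).

    The Poisson formula is obtained from Goursat's lemma: in the logarithmic
    coordinate, circles become vertical segments, and Goursat's lemma on
    rectangles shows that the mean of a holomorphic function over concentric
    circles is constant. *)

(** * The complex plane as a normed space *)

(** With [R[i]] as a normed module over itself, derivability along the vector 1
    is complex differentiability. *)
Section complex_normed.
Variable R : realType.
#[export, non_forgetful_inheritance]
HB.instance Definition _ := GRing.ComAlgebra.copy R[i] R[i]^o.
#[export, non_forgetful_inheritance]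
HB.instance Definition _ := Vector.copy R[i] R[i]^o.
#[export, non_forgetful_inheritance]
HB.instance Definition _ := NormedModule.copy R[i] R[i]^o.
End complex_normed.

Section complex_basics.
Context {R : realType}.
Local Notation C := R[i].
Local Notation re := (@complex.Re R).
Local Notation im := (@complex.Im R).
Implicit Types (z w y : C) (x : R).

Lemma normc_ge0 z : 0 <= normc z.
Proof. by case: z => a b; exact: sqrtr_ge0. Qed.

Lemma normcD z w : normc (z + w) <= normc z + normc w.
Proof. exact: le_normcD. Qed.

Lemma normcBC z w : normc (z - w) = normc (w - z).
Proof. by rewrite -normcN opprB. Qed.

Lemma normcB z w : normc (z - w) <= normc z + normc w.
Proof. by rewrite (le_trans (normcD _ _))// normcN. Qed.

Lemma normcBl z w : normc z - normc w <= normc (z - w).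
Proof. by rewrite lerBlDr -{1}(subrK w z) normcD. Qed.

Lemma ler_normcB z w : `|normc z - normc w| <= normc (z - w).
Proof.
rewrite ler_norml lerNl opprB normcBl andbT normcBC; exact: normcBl.
Qed.

Lemma normc_real x : normc (x%:C)%C = `|x|.
Proof. by rewrite /= expr0n /= addr0 sqrtr_sqr. Qed.

Lemma normc_sqr z : normc z ^+ 2 = re z ^+ 2 + im z ^+ 2.
Proof. by case: z => a b /=; rewrite sqr_sqrtr// addr_ge0 ?sqr_ge0. Qed.

Lemma Re_le_normc z : `|re z| <= normc z.
Proof.
by case: z => a b /=; rewrite -sqrtr_sqr ler_sqrt ?lerDl ?addr_ge0 ?sqr_ge0.
Qed.

Lemma Im_le_normc z : `|im z| <= normc z.
Proof.
by case: z => a b /=; rewrite -sqrtr_sqr ler_sqrt ?lerDr ?addr_ge0 ?sqr_ge0.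
Qed.

Lemma normc_leD z : normc z <= `|re z| + `|im z|.
Proof.
rewrite -(@ler_pXn2r _ 2) ?nnegrE ?normc_ge0 ?addr_ge0//.
rewrite normc_sqr sqrrD !real_normK ?num_real// lerD2r lerDl.
by rewrite mulrn_wge0// mulr_ge0.
Qed.

Lemma normc_eq0 z : (normc z == 0) = (z == 0).
Proof. by apply/eqP/eqP => [|->]; [exact: eq0_normc|exact: normc0]. Qed.

Lemma normc_gt0 z : (0 < normc z) = (z != 0).
Proof. by rewrite lt_neqAle normc_ge0 andbT eq_sym normc_eq0. Qed.

Lemma normc_conj z : normc (z^*)%C = normc z.
Proof. by case: z => a b /=; rewrite sqrrN. Qed.

Lemma complexE z : z = (re z +i* im z)%C. Proof. by case: z. Qed.

Lemma ReB z w : re (z - w) = re z - re w. Proof. by case: z w => [a b] [c d]. Qed.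
Lemma ImB z w : im (z - w) = im z - im w. Proof. by case: z w => [a b] [c d]. Qed.
Lemma ReD z w : re (z + w) = re z + re w. Proof. by case: z w => [a b] [c d]. Qed.
Lemma ImD z w : im (z + w) = im z + im w. Proof. by case: z w => [a b] [c d]. Qed.
Lemma ReM z w : re (z * w) = re z * re w - im z * im w.
Proof. by case: z w => [a b] [c d]. Qed.
Lemma ImM z w : im (z * w) = re z * im w + im z * re w.
Proof. by case: z w => [a b] [c d]. Qed.

(** The library norm of a complex number is itself a complex number; from here
    on, topological notions are expressed with the real-valued [normc]. *)
Lemma nbhs_C z (A : set C) :
  nbhs z A <-> exists2 e : R, 0 < e & forall y, normc (y - z) < e -> A y.
Proof.
split.
  case/nbhs_ballP => e /= e0 zA.
  have eE : e = (re e)%:C%C.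
    by move: e0; case: e {zA} => a b; rewrite ltcE /= => /andP[/eqP -> _].
  exists (re e); first by move: e0; rewrite ltcE /= => /andP[].
  by move=> y yz; apply: zA; rewrite /ball /= distrC eE ltcR.
case=> e e0 zA; apply/nbhs_ballP; exists e%:C%C; first by rewrite /= ltcR.
by move=> y; rewrite /ball /= distrC ltcR; exact: zA.
Qed.

Lemma cvg_CP (T : Type) (F : set_system T) {FF : Filter F} (f : T -> C) (l : C) :
  f @ F --> l <-> forall e : R, 0 < e -> \forall t \near F, normc (f t - l) < e.
Proof.
split=> [fl e e0|fl A /nbhs_C[e e0 lA]].
  by apply: (fl [set y | normc (y - l) < e]); apply/nbhs_C; exists e.
by near=> t; apply: lA; near: t; exact: fl.
Unshelve. all: by end_near. Qed.

Lemma cvg_Re (T : Type) (F : set_system T) {FF : Filter F} (f : T -> C) (l : C) :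
  f @ F --> l -> re (f t) @[t --> F] --> re l.
Proof.
move/(cvg_CP) => fl; apply/cvgrPdist_lt => e e0.
near=> t; have : normc (f t - l) < e by near: t; exact: fl.
by apply: le_lt_trans; rewrite normcBC -ReB Re_le_normc.
Unshelve. all: by end_near. Qed.

Lemma cvg_Im (T : Type) (F : set_system T) {FF : Filter F} (f : T -> C) (l : C) :
  f @ F --> l -> im (f t) @[t --> F] --> im l.
Proof.
move/(cvg_CP) => fl; apply/cvgrPdist_lt => e e0.
near=> t; have : normc (f t - l) < e by near: t; exact: fl.
by apply: le_lt_trans; rewrite normcBC -ImB Im_le_normc.
Unshelve. all: by end_near. Qed.

Lemma cvg_complex (T : Type) (F : set_system T) {FF : Filter F} (f g : T -> R)
    (a b : R) :
  f @ F --> a -> g @ F --> b -> (f t +i* g t)%C @[t --> F] --> (a +i* b)%C.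
Proof.
move=> /cvgrPdist_lt fa /cvgrPdist_lt gb; apply/cvg_CP => e e0.
near=> t; apply: le_lt_trans (normc_leD _) _ => /=.
rewrite (splitr e) ltrD// distrC; near: t; [apply: fa|apply: gb];
  by rewrite divr_gt0.
Unshelve. all: by end_near. Qed.

Lemma cvg_normc (T : Type) (F : set_system T) {FF : Filter F} (f : T -> C) (l : C) :
  f @ F --> l -> normc (f t) @[t --> F] --> normc l.
Proof.
move/(cvg_CP) => fl; apply/cvgrPdist_lt => e e0.
near=> t; have : normc (f t - l) < e by near: t; exact: fl.
by apply: le_lt_trans; rewrite normcBC ler_normcB.
Unshelve. all: by end_near. Qed.

Lemma continuous_Re : continuous (re : C -> R).
Proof. by move=> z; exact: (@cvg_Re _ (nbhs z) _ (fun x : C => x) z (@cvg_id _ _)). Qed.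

Lemma continuous_Im : continuous (im : C -> R).
Proof. by move=> z; exact: (@cvg_Im _ (nbhs z) _ (fun x : C => x) z (@cvg_id _ _)). Qed.

Lemma continuous_normc : continuous (@normc R : C -> R).
Proof. by move=> z; exact: (@cvg_normc _ (nbhs z) _ (fun x : C => x) z (@cvg_id _ _)). Qed.

Lemma continuous_of_plane : continuous (@of_plane R).
Proof. by move=> p; apply: cvg_complex; [exact: cvg_fst|exact: cvg_snd]. Qed.

Lemma continuous_eitheta : continuous (@eitheta R).
Proof. by move=> p; apply: cvg_complex; [exact: continuous_cos|exact: continuous_sin]. Qed.

Lemma normc_eitheta (t : R) : normc (eitheta t) = 1.
Proof. by rewrite /= cos2Dsin2 sqrtr1. Qed.

Lemma normc_on_circle (r t : R) : 0 <= r -> normc (on_circle r t) = r.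
Proof. by move=> r0; rewrite normcM normc_eitheta mulr1 normc_real ger0_norm. Qed.

Lemma nbhs_to_plane (z : C) (A : set (R * R)) :
  nbhs (to_plane z) A <-> nbhs z (A \o @to_plane R).
Proof.
split=> [|zA].
  have h : continuous (@to_plane R).
    move=> y; apply: (@cvg_pair _ _ _ (nbhs y) (nbhs (re y)) (nbhs (im y)));
      [exact: continuous_Re|exact: continuous_Im].
  exact: h.
have := @continuous_of_plane (to_plane z) (A \o @to_plane R).
rewrite {1}/of_plane /= -complexE => /(_ zA).
by apply: (@filterS _ (nbhs (to_plane z))) => -[a b].
Qed.

Definition holo_at (g : C -> C) (z : C) : Prop := derivable g z 1.

Lemma holo_atP (g : C -> C) z :
  holo_at g z <-> exists d : C, forall e : R, 0 < e ->
    exists2 de : R, 0 < de & forall h, normc h < de ->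
      normc (g (z + h) - g z - d * h) <= e * normc h.
Proof.
split.
  move=> dg; exists ('D_1 g z) => e e0.
  have /(cvg_CP) /(_ e e0) : h^-1 *: (g (h *: 1 + z) - g z) @[h --> 0^'] --> 'D_1 g z.
    exact: dg.
  rewrite near_withinE => /nbhs_C[de de0 H]; exists de => // h hde.
  have [->|h0] := eqVneq h 0; first by rewrite addr0 subrr mulr0 subr0 normc0 mulr0.
  have := H h; rewrite subr0 => /(_ hde h0) /ltW.
  rewrite /GRing.scale /= mulr1 (addrC h).
  set q := g (z + h) - g z => qd.
  have -> : q - 'D_1 g z * h = (h^-1 * q - 'D_1 g z) * h.
    by rewrite mulrBl mulrAC mulVf// mul1r.
  by rewrite normcM ler_wpM2r// normc_ge0.
move=> [d H]; apply/cvg_ex; exists d; apply/cvg_CP => e e0.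
have [de de0 H'] := H (e / 2) ltac:(by rewrite divr_gt0).
rewrite near_withinE; apply/nbhs_C; exists de => // h; rewrite subr0 => hde h0.
rewrite /GRing.scale /= mulr1 (addrC h).
have := H' h hde; set q := g (z + h) - g z.
have -> : q - d * h = (h^-1 * q - d) * h.
  by rewrite mulrBl mulrAC mulVf// mul1r.
rewrite normcM ler_pM2r ?normc_gt0// => /le_lt_trans; apply.
by rewrite ltr_pdivrMr// ltr_pMr// ltr1n.
Qed.

End complex_basics.

(** * Complex differentiability, exponential and logarithm *)

Section complex_derivability.
Context {R : realType}.
Local Notation C := R[i].
Local Notation re := (@complex.Re R).
Local Notation im := (@complex.Im R).

Lemma to_planeK : cancel (@to_plane R) (@of_plane R). Proof. by case. Qed.

Lemma to_planeD z w : to_plane (z + w) = to_plane z + to_plane w :> R * R.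
Proof. by case: z w => [a b] [c d]. Qed.

Lemma differentiable_eps (U : R * R -> R) (p : R * R) : differentiable U p ->
  forall e : R, 0 < e -> exists2 de : R, 0 < de & forall h : C, normc h < de ->
    `|U (p + to_plane h) - U p - 'd U p (to_plane h)| <= e * normc h.
Proof.
move=> dU e e0; have /eqaddoP /(_ e e0) := diff_locally dU.
move/(@nbhs_to_plane R 0) => /nbhs_C[de de0 H].
exists de => // h hde; have := H h; rewrite subr0 => /(_ hde).
rewrite [p + _]addrC -addrA -opprD => /le_trans; apply.
rewrite ler_wpM2l ?(ltW e0)// -[leLHS]/(Num.max `|re h| `|im h|).
by rewrite ge_max Re_le_normc Im_le_normc.
Qed.

(** Cauchy-Riemann equations: a real linear map of the plane with matrix
    [u1, -u2; u2, u1] is multiplication by the complex number u1 + i u2. *)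
Lemma cauchy_riemann_holo (g : C -> C) (z : C) (u1 u2 : R) :
  is_diff (to_plane z) (re \o g \o of_plane) (fun h => h.1 * u1 - h.2 * u2) ->
  is_diff (to_plane z) (im \o g \o of_plane) (fun h => h.1 * u2 + h.2 * u1) ->
  holo_at g z.
Proof.
move=> dU dV; apply/holo_atP; exists (u1 +i* u2)%C => e e0.
have e20 : 0 < e / 2 by rewrite divr_gt0.
have [d1 d10 H1] := differentiable_eps (@ex_diff _ _ _ _ _ _ _ dU) e20.
have [d2 d20 H2] := differentiable_eps (@ex_diff _ _ _ _ _ _ _ dV) e20.
exists (Num.min d1 d2); first by rewrite lt_min d10.
move=> h; rewrite lt_min => /andP[/H1 {}H1 /H2 {}H2].
rewrite (le_trans (normc_leD _))// (splitr e) mulrDl lerD//.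
  apply: le_trans H1; rewrite (@diff_val _ _ _ _ _ _ _ dU) /= !(ReB, ReM) /=.
  by rewrite -to_planeD !to_planeK mulrC (mulrC u2).
apply: le_trans H2; rewrite (@diff_val _ _ _ _ _ _ _ dV) /= !(ImB, ImM) /=.
by rewrite -to_planeD !to_planeK mulrC (mulrC u2) (addrC (im h * _)).
Qed.

Lemma is_diff_derive1 (f : R -> R) (x d : R) :
  is_derive x 1 f d -> is_diff x f (fun h => h * d).
Proof.
move=> df; have dfx : derivable f x 1 by exact: ex_derive.
apply: DiffDef; first exact/derivable1_diffP.
by rewrite deriv1E// derive1E (@derive_val _ _ _ _ _ _ _ df).
Qed.

Lemma is_diff_fst (p : R * R) : is_diff p (@fst R R) (@fst R R).
Proof.
have c : continuous (@fst R R) by move=> q; exact: cvg_fst.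
apply: DiffDef; first exact: (@linear_differentiable _ _ _ (@fst R R : {linear _ -> _})).
exact: (@diff_lin _ _ _ (@fst R R : {linear _ -> _})).
Qed.

Lemma is_diff_snd (p : R * R) : is_diff p (@snd R R) (@snd R R).
Proof.
have c : continuous (@snd R R) by move=> q; exact: cvg_snd.
apply: DiffDef; first exact: (@linear_differentiable _ _ _ (@snd R R : {linear _ -> _})).
exact: (@diff_lin _ _ _ (@snd R R : {linear _ -> _})).
Qed.

Definition cexp (z : C) : C := (expR (re z))%:C%C * eitheta (im z).

Lemma normc_cexp z : normc (cexp z) = expR (re z).
Proof. by rewrite normcM normc_eitheta mulr1 normc_real ger0_norm// expR_ge0. Qed.

Lemma cexp_neq0 z : cexp z != 0.
Proof. by rewrite -normc_gt0 normc_cexp expR_gt0. Qed.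

Lemma holo_cexp (z : C) : holo_at cexp z.
Proof.
set a := expR (re z) * cos (im z); set b := expR (re z) * sin (im z).
pose p := to_plane z; have fp := is_diff_fst p; have sp := is_diff_snd p.
have e1 : is_diff p (expR \o fst) ((fun h => h * expR (re z)) \o fst).
  have := @is_diff_derive1 (@expR R) (fst p) _ (is_derive_expR _) => ?.
  exact: is_diff_comp.
have c1 : is_diff p (cos \o snd) ((fun h => h * - sin (im z)) \o snd).
  have := @is_diff_derive1 (@cos R) (snd p) _ (is_derive_cos _) => ?.
  exact: is_diff_comp.
have s1 : is_diff p (sin \o snd) ((fun h => h * cos (im z)) \o snd).
  have := @is_diff_derive1 (@sin R) (snd p) _ (is_derive_sin _) => ?.
  exact: is_diff_comp.
apply: (@cauchy_riemann_holo _ _ a b).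
  have -> : re \o cexp \o of_plane = (expR \o fst) * (cos \o snd).
    by apply/funext => q; rewrite /= mul0r subr0.
  apply: is_diff_eq; apply/funext => h /=.
  rewrite -[LHS]/(expR (re z) * (h.2 * - sin (im z)) + cos (im z) * (h.1 * expR (re z))).
  by rewrite /a /b; ring.
have -> : im \o cexp \o of_plane = (expR \o fst) * (sin \o snd).
  by apply/funext => q; rewrite /= mul0r addr0.
apply: is_diff_eq; apply/funext => h /=.
rewrite -[LHS]/(expR (re z) * (h.2 * cos (im z)) + sin (im z) * (h.1 * expR (re z))).
by rewrite /a /b; ring.
Qed.

(** The principal logarithm on the right half plane. *)
Definition clog (z : C) : C := (ln (normc z) +i* atan (im z / re z))%C.

Lemma holo_clog (z : C) : 0 < re z -> holo_at clog z.
Proof.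
move=> z0; set x := re z in z0; set y := im z; set n2 := x ^+ 2 + y ^+ 2.
have n20 : 0 < n2 by rewrite ltr_wpDr ?sqr_ge0// exprn_gt0.
pose p := to_plane z; have fp := is_diff_fst p; have sp := is_diff_snd p.
apply: (@cauchy_riemann_holo _ _ (x / n2) (- y / n2)).
  have -> : re \o clog \o of_plane =
      2^-1 *: (@ln R \o ((@fst R R) ^+ 2 + (@snd R R) ^+ 2)).
    apply/funext => q; transitivity (2^-1 * ln (normc (of_plane q) ^+ 2)).
      rewrite -[LHS]/(ln (normc (of_plane q))).
      have [h0|q0] := eqVneq (normc (of_plane q)) 0.
        by rewrite h0 expr2 mul0r ln0// mulr0.
      have q1 : 0 < normc (of_plane q) by rewrite lt_neqAle eq_sym q0 normc_ge0.
      by rewrite (lnXn 2 q1); move: (ln _) => l; rewrite -(mulr_natl l 2) mulKf.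
    by rewrite normc_sqr.
  have l1 : is_derive (((@fst R R) ^+ 2 + (@snd R R) ^+ 2) p) 1 (@ln R) n2^-1.
    exact: is_derive1_ln.
  have l2 := is_diff_derive1 l1.
  have l3 := is_diffZ 2^-1 (is_diff_comp (is_diffD (is_diffX 1 fp) (is_diffX 1 sp)) l2).
  apply: (is_diff_eq l3); apply/funext => h.
  rewrite -[LHS]/(2^-1 * ((2 * x ^+ 1 * h.1 + 2 * y ^+ 1 * h.2) * n2^-1)).
  by field; rewrite gt_eqF.
have -> : im \o clog \o of_plane = @atan R \o ((@snd R R) * (GRing.inv \o (@fst R R))).
  by [].
have i1 : is_diff (p.1 : R) (fun u : R => u^-1) (fun h => - (x ^- 2) *: h).
  by apply: DiffDef; [apply: differentiable_Rinv; rewrite gt_eqF|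
                      rewrite diff_Rinv ?gt_eqF].
have a1 := @is_diff_derive1 _ _ _ (is_derive1_atan (((@snd R R) * (GRing.inv \o (@fst R R))) p)).
have a2 := is_diff_comp (is_diffM sp (is_diff_comp fp i1)) a1.
apply: (is_diff_eq a2); apply/funext => h /=.
rewrite -[LHS]/((y * (- (x ^- 2) * h.1) + x^-1 * h.2) * (1 + (y * x^-1) ^+ 2)^-1).
rewrite /n2; field.
by rewrite !gt_eqF.
Qed.

Lemma holo_differentiable (f : C -> C) (z : C) : holo_at f z -> differentiable f z.
Proof. by rewrite /holo_at => /derivable1_diffP. Qed.

Lemma holo_continuous (g : C -> C) (z : C) : holo_at g z -> {for z, continuous g}.
Proof. by move/holo_differentiable => dg; exact: (@differentiable_continuous C C C z g dg). Qed.

Lemma differentiable_holo (f : C -> C) (z : C) : differentiable f z -> holo_at f z.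
Proof. exact: diff_derivable. Qed.

Lemma holo_comp (f g : C -> C) (z : C) :
  holo_at f z -> holo_at g (f z) -> holo_at (g \o f) z.
Proof.
move=> /holo_differentiable df /holo_differentiable dg.
apply: differentiable_holo.
exact: (@differentiable_comp C C C C f g z df dg).
Qed.

End complex_derivability.

(** * Goursat's lemma on rectangles *)

Section interval_integral.
Context {R : realType}.
Local Notation mu := (@lebesgue_measure R).
Implicit Types (a b c : R) (f g : R -> R).

Definition itv_int a b f := (\int[mu]_(t in `[a, b]) f t)%R.
Definition itv_integrable a b f := mu.-integrable `[a, b] (EFin \o f).

Lemma cont_itv_integrable a b f :
  (forall t, a <= t <= b -> {for t, continuous f}) -> itv_integrable a b f.
Proof.
move=> cf; apply: continuous_compact_integrable; first exact: segment_compact.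
apply: continuous_in_subspaceT => t; rewrite inE /= in_itv /=; exact: cf.
Qed.

Lemma lebesgue_measure_cc a b : a <= b ->
  lebesgue_measure (`[a, b]%classic : set R) = (b - a)%:E.
Proof.
move=> ab; rewrite lebesgue_measure_itv /= lte_fin.
by case: ltgtP ab => // -> _; rewrite subrr.
Qed.

Lemma itv_int_cst a b (k : R) : a <= b -> itv_int a b (fun=> k) = k * (b - a).
Proof.
move=> ab; rewrite /itv_int Rintegral_cst//; congr (_ * _).
by transitivity (fine (b - a)%:E) => //; congr fine; exact: lebesgue_measure_cc.
Qed.

Lemma itv_integrable_cst a b (k : R) : itv_integrable a b (fun=> k).
Proof. by apply: cont_itv_integrable => t _; exact: cvg_cst. Qed.

Lemma itv_intB a b f g : itv_integrable a b f -> itv_integrable a b g ->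
  itv_int a b (fun t => f t - g t) = itv_int a b f - itv_int a b g.
Proof. by move=> ? ?; exact: RintegralB. Qed.

Lemma itv_integrableB a b f g : itv_integrable a b f -> itv_integrable a b g ->
  itv_integrable a b (fun t => f t - g t).
Proof. move=> fi gi; have mi : measurable (`[a, b]%classic : set (measurableTypeR R)) by [].
have := integrableB mi fi gi. by apply: eq_integrable. Qed.

Lemma le_itv_int a b f g : itv_integrable a b f -> itv_integrable a b g ->
  (forall t, a <= t <= b -> f t <= g t) -> itv_int a b f <= itv_int a b g.
Proof.
move=> fi gi fg; apply: le_Rintegral => // t; rewrite /= in_itv /=; exact: fg.
Qed.

Lemma norm_itv_int_le a b f (k : R) : a <= b -> itv_integrable a b f ->
  (forall t, a <= t <= b -> `|f t| <= k) -> `|itv_int a b f| <= k * (b - a).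
Proof.
move=> ab fi fk; rewrite ler_norml -mulNr -!itv_int_cst//.
by apply/andP; split; apply: le_itv_int => //; do ?exact: itv_integrable_cst;
  move=> t /fk; rewrite ler_norml => /andP[].
Qed.

Lemma itv_intD a b c f : a <= b -> b <= c -> itv_integrable a c f ->
  itv_int a c f = itv_int a b f + itv_int b c f.
Proof.
move=> ab bc fi; rewrite /itv_int.
have := @Rintegral_itvB R f (BLeft a) (BRight c) b fi.
rewrite !bnd_simp => /(_ ab bc) E.
have E2 := @Rintegral_itv_obnd_cbnd R b (BRight c) f.
rewrite -E2; last first.
  by apply: integrableS fi => // t /=; rewrite !in_itv /= => /andP[bt ->];
    rewrite (le_trans ab (ltW bt)).
by rewrite -E addrC subrK.
Qed.

End interval_integral.

Section goursat.
Context {R : realType}.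

Section bisection.
Variables (D : R -> R -> R -> R -> R) (a0 b0 c0 d0 : R).
Hypothesis ab0 : a0 < b0.
Hypothesis cd0 : c0 < d0.
Hypothesis D_splitx : forall a e b c d, a0 <= a -> a <= e -> e <= b -> b <= b0 ->
  c0 <= c -> c <= d -> d <= d0 -> D a b c d = D a e c d + D e b c d.
Hypothesis D_splity : forall a b c e d, a0 <= a -> a <= b -> b <= b0 ->
  c0 <= c -> c <= e -> e <= d -> d <= d0 -> D a b c d = D a b c e + D a b e d.
Hypothesis D_small : forall x y, a0 <= x <= b0 -> c0 <= y <= d0 ->
  forall e : R, 0 < e -> exists2 de : R, 0 < de & forall a b c d,
    a0 <= a -> a <= x -> x <= b -> b <= b0 ->
    c0 <= c -> c <= y -> y <= d -> d <= d0 -> b - a < de -> d - c < de ->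
    `|D a b c d| <= e * ((b - a) + (d - c)) ^+ 2.

Let W := b0 - a0.
Let H := d0 - c0.
Let w n : R := W / 2 ^+ n.
Let h n : R := H / 2 ^+ n.

Let w_ge0 n : 0 <= w n.
Proof. by rewrite divr_ge0 ?exprn_ge0// subr_ge0 ltW. Qed.
Let h_ge0 n : 0 <= h n.
Proof. by rewrite divr_ge0 ?exprn_ge0// subr_ge0 ltW. Qed.
Let wS n : w n = w n.+1 + w n.+1.
Proof. by rewrite /w exprS; field; rewrite expf_neq0. Qed.
Let hS n : h n = h n.+1 + h n.+1.
Proof. by rewrite /h exprS; field; rewrite expf_neq0. Qed.

Let inv (n : nat) (s : R * R) : Prop :=
  [/\ a0 <= s.1, s.1 + w n <= b0, c0 <= s.2, s.2 + h n <= d0 &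
      `|D a0 b0 c0 d0| / 4 ^+ n <= `|D s.1 (s.1 + w n) s.2 (s.2 + h n)|].

Let halve (x y k : R) : k <= `|x + y| -> k / 2 <= `|x| \/ k / 2 <= `|y|.
Proof.
move=> kxy; have [?|xk] := leP (k / 2) `|x|; first by left.
by right; have := ler_normD x y; lra.
Qed.

Let step n s : exists s', inv n s -> inv n.+1 s' /\
  [/\ s.1 <= s'.1, s'.1 + w n.+1 <= s.1 + w n, s.2 <= s'.2 &
      s'.2 + h n.+1 <= s.2 + h n].
Proof.
have [[A B C E F]|] := pselect (inv n s); last by exists s.
have w1 := w_ge0 n.+1; have h1 := h_ge0 n.+1.
move: B E F; set k := `|D a0 b0 c0 d0|; rewrite wS hS => B E F.
set a := s.1 in A B F *; set c := s.2 in C E F *.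
have k4 : k / 4 ^+ n.+1 = k / 4 ^+ n / 2 / 2.
  by rewrite exprS; field; rewrite expf_neq0.
have [a' [A1 A2 A3]] : exists a', [/\ a <= a', a' + w n.+1 <= a + (w n.+1 + w n.+1) &
    k / 4 ^+ n / 2 <= `|D a' (a' + w n.+1) c (c + (h n.+1 + h n.+1))|].
  move: F; rewrite (@D_splitx _ (a + w n.+1)); do ?lra.
  by move/halve => [] ?; [exists a|exists (a + w n.+1)]; split => //;
    rewrite -?addrA//; lra.
have [c' [C1 C2 C3]] : exists c', [/\ c <= c', c' + h n.+1 <= c + (h n.+1 + h n.+1) &
    k / 4 ^+ n.+1 <= `|D a' (a' + w n.+1) c' (c' + h n.+1)|].
  rewrite k4; move: A3; rewrite (@D_splity _ _ _ (c + h n.+1)); do ?lra.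
  by move/halve => [] ?; [exists c|exists (c + h n.+1)]; split => //;
    rewrite -?addrA//; lra.
by exists (a', c') => _; split; split => //=; lra.
Qed.

(** Bisection: if D did not vanish, nested rectangles with |D| at least
    |D a0 b0 c0 d0| / 4^n would shrink to a point, contradicting the o(diam^2)
    behaviour of D there. *)
Lemma additive_rectangle_eq0 : D a0 b0 c0 d0 = 0.
Proof.
apply/eqP; rewrite -normr_le0 leNgt; apply/negP => D0.
have [f fP] := choice (fun ns : nat * (R * R) => step ns.1 ns.2).
pose u := fix u n := if n is m.+1 then f (m, u m) else (a0, c0).
have uP n : inv n (u n).
  elim: n => [|n /(fP (n, _)) []//].
  have aw : a0 + w 0 = b0 by rewrite /w expr0 divr1 /W addrC subrK.
  have ch : c0 + h 0 = d0 by rewrite /h expr0 divr1 /H addrC subrK.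
  by rewrite /inv /= aw ch expr0 divr1; split.
have uS n : [/\ (u n).1 <= (u n.+1).1, (u n.+1).1 + w n.+1 <= (u n).1 + w n,
    (u n).2 <= (u n.+1).2 & (u n.+1).2 + h n.+1 <= (u n).2 + h n].
  by case: (fP (n, u n) (uP n)).
have mono (g : nat -> R) (v : nat -> R) : (forall n, 0 <= v n) ->
   (forall n, g n <= g n.+1) ->
   (forall n, g n.+1 + v n.+1 <= g n + v n) -> exists x, forall n, g n <= x <= g n + v n.
  move=> v0 gi gd.
  have gi' n m : (n <= m)%N -> g n <= g m.
    by elim: m => [|m IH]; [rewrite leqn0 => /eqP->|
      rewrite leq_eqVlt => /predU1P[->//|/IH/le_trans]; apply].
  have gd' n m : (n <= m)%N -> g m + v m <= g n + v n.
    by elim: m => [|m IH]; [rewrite leqn0 => /eqP->|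
      rewrite leq_eqVlt => /predU1P[->//|/IH]; exact: le_trans].
  have gle n m : g n <= g m + v m.
    have [nm|/ltnW mn] := leqP n m.
      by rewrite (le_trans (gi' _ _ nm))// lerDl.
    by rewrite (le_trans _ (gd' _ _ mn))// lerDl.
  exists (sup (range g)) => n; apply/andP; split.
    by apply: ub_le_sup; [exists (g 0%N + v 0%N) => _ [m _ <-]|exists n].
  by apply: ge_sup; [exists (g 0%N); exists 0%N|move=> _ [m _ <-]].
have [x xP] := mono (fun n => (u n).1) w w_ge0
  ltac:(by move=> n; case: (uS n)) ltac:(by move=> n; case: (uS n)).
have [y yP] := mono (fun n => (u n).2) h h_ge0
  ltac:(by move=> n; case: (uS n)) ltac:(by move=> n; case: (uS n)).
have W0 : 0 < W by rewrite subr_gt0.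
have H0 : 0 < H by rewrite subr_gt0.
pose e := `|D a0 b0 c0 d0| / (2 * (W + H) ^+ 2).
have e0 : 0 < e by rewrite divr_gt0// mulr_gt0// exprn_gt0// addr_gt0.
have x0 : a0 <= x <= b0.
  by have := xP 0%N; rewrite /= /w expr0 divr1 /W (addrC a0) subrK.
have y0 : c0 <= y <= d0.
  by have := yP 0%N; rewrite /= /h expr0 divr1 /H (addrC c0) subrK.
have [de de0 HD] := D_small x0 y0 e0.
have [n [wn hn]] : exists n, w n < de /\ h n < de.
  have [n nP] : exists n : nat, (W + H) / de < n%:R.
    have := archi_boundP (ltW (divr_gt0 (addr_gt0 W0 H0) de0)).
    by exists (Num.bound ((W + H) / de)).
  have n2 : n%:R < 2 ^+ n :> R by rewrite -natrX ltr_nat ltn_expl.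
  have : (W + H) < de * 2 ^+ n.
    by rewrite mulrC -ltr_pdivrMr// (lt_trans nP n2).
  exists n; rewrite /w /h !ltr_pdivrMr ?exprn_gt0//; split; lra.
have [A B C E F] := uP n; have /andP[xa xb] := xP n; have /andP[yc yd] := yP n.
have := HD _ _ _ _ A xa xb B C yc yd E.
rewrite !(addrC _ (w n)) !(addrC _ (h n)) !addrK => /(_ wn hn).
rewrite (addrC (w n)) (addrC (h n)); apply/negP; rewrite -ltNge.
apply: lt_le_trans F.
have -> : e * (w n + h n) ^+ 2 = `|D a0 b0 c0 d0| / 4 ^+ n / 2.
  rewrite /e /w /h; have -> : (4 : R) = 2 ^+ 2 by rewrite expr2; ring.
  by rewrite -exprM mulnC exprM; field; rewrite expf_neq0//= gt_eqF// addr_gt0.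
have : 0 < `|D a0 b0 c0 d0| / 4 ^+ n by rewrite divr_gt0// exprn_gt0.
lra.
Qed.

End bisection.

(** The increments in the two variables are kept apart because the expansion is
    integrated along horizontal and vertical sides. *)
Definition lin_approx (F : R -> R -> R) (x y p q : R) :=
  forall e : R, 0 < e -> exists2 de : R, 0 < de & forall x' y' : R,
    `|x' - x| < de -> `|y' - y| < de ->
    `|F x' y' - F x y - (p * (x' - x) + q * (y' - y))| <= e * (`|x' - x| + `|y' - y|).

Lemma lin_approx_continuousl F x y p q : lin_approx F x y p q ->
  {for x, continuous (F ^~ y)}.
Proof.
move=> H; apply/cvgrPdist_le => e e0.
have [de de0 {}H] := H 1 ltr01.
near=> t; have td : `|t - x| < Num.min de (e / (1 + `|p|)).
  rewrite distrC; near: t; apply: cvgr_dist_lt; first exact: cvg_id.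
  by rewrite lt_min de0 divr_gt0// ltr_pwDl.
move: td; rewrite lt_min => /andP[td te].
have := H t y td; rewrite subrr normr0 => /(_ de0); rewrite mulr0 !addr0 mul1r => h.
rewrite distrC -(subrK (p * (t - x)) (F t y - F x y)) (le_trans (ler_normD _ _))//.
rewrite normrM (le_trans (lerD h (lexx _)))//.
rewrite -[X in X + _]mul1r -mulrDl mulrC -ler_pdivlMr ?ltW//.
Unshelve. all: by end_near. Qed.

Lemma lin_approx_swap F x y p q : lin_approx F x y p q ->
  lin_approx (fun b a => F a b) y x q p.
Proof.
move=> H e /H[de de0 {}H]; exists de => // y' x' yd xd.
by rewrite (addrC (q * _)) (addrC `|y' - y|); exact: H.
Qed.

Lemma itv_int_near (a b k e : R) (f : R -> R) : a <= b -> itv_integrable a b f ->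
  (forall t, a <= t <= b -> `|f t - k| <= e) ->
  `|itv_int a b f - k * (b - a)| <= e * (b - a).
Proof.
move=> ab fi fe; rewrite -itv_int_cst// -itv_intB//; last exact: itv_integrable_cst.
apply: norm_itv_int_le => //; apply: itv_integrableB => //.
exact: itv_integrable_cst.
Qed.

(** Goursat: the circulation of P dx + Q dy around a rectangle is an additive
    function of the rectangle, and it is o(diam ^ 2) at each point where
    P and Q are differentiable with dP/dy = dQ/dx. *)
Lemma goursat_rectangle (P Q : R -> R -> R) (a b c d : R) : a < b -> c < d ->
  (forall x y, a <= x <= b -> c <= y <= d -> exists p1 m q2,
    lin_approx P x y p1 m /\ lin_approx Q x y m q2) ->
  itv_int a b (P ^~ c) - itv_int a b (P ^~ d) + (itv_int c d (Q b) - itv_int c d (Q a)) = 0.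
Proof.
move=> ab cd H.
have Pi a' b' y : a <= a' -> b' <= b -> c <= y <= d -> itv_integrable a' b' (P ^~ y).
  move=> aa bb yd; apply: cont_itv_integrable => t /andP[at_ tb].
  have /H/(_ yd)[p1 [m [q2 [HP _]]]] : a <= t <= b by rewrite (le_trans aa)// (le_trans tb).
  exact: lin_approx_continuousl HP.
have Qi c' d' x : c <= c' -> d' <= d -> a <= x <= b -> itv_integrable c' d' (Q x).
  move=> cc dd xb; apply: cont_itv_integrable => t /andP[ct td].
  have /(H x t xb)[p1 [m [q2 [_ HQ]]]] : c <= t <= d by rewrite (le_trans cc)// (le_trans td).
  exact: lin_approx_continuousl (lin_approx_swap HQ).
pose D a' b' c' d' := itv_int a' b' (P ^~ c') - itv_int a' b' (P ^~ d') +
  (itv_int c' d' (Q b') - itv_int c' d' (Q a')).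
apply: (@additive_rectangle_eq0 D) => //.
- move=> a' e b' c' d' aa ae eb bb cc c'd' dd; rewrite /D.
  rewrite (@itv_intD _ a' e b' (P ^~ c'))//; last by apply: Pi => //; lra.
  rewrite (@itv_intD _ a' e b' (P ^~ d'))//; last by apply: Pi => //; lra.
  by lra.
- move=> a' b' c' e d' aa a'b' bb cc ce ed dd; rewrite /D.
  rewrite (@itv_intD _ c' e d' (Q b'))//; last by apply: Qi => //; lra.
  rewrite (@itv_intD _ c' e d' (Q a'))//; last by apply: Qi => //; lra.
  by lra.
- move=> x y xab ycd e e0; have [p1 [m [q2 [HP HQ]]]] := H x y xab ycd.
  have e4 : 0 < e / 2 / 2 by rewrite !divr_gt0.
  have [d1 d10 {}HP] := HP _ e4; have [d2 d20 {}HQ] := HQ _ e4.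
  exists (Num.min d1 d2); first by rewrite lt_min d10.
  move=> a' b' c' d' aa ax xb bb cc cy yd dd; rewrite !lt_min => /andP[w1 w2] /andP[h1 h2].
  set S := b' - a' + (d' - c').
  have S0 : 0 <= S by rewrite /S; lra.
  have HPt t : a' <= t <= b' -> `|P t c' - P t d' - - (m * (d' - c'))| <= e / 2 * S.
    move=> /andP[at_ tb].
    have xt : `|t - x| <= b' - a' by rewrite ler_norml; lra.
    have cy1 : `|c' - y| <= d' - c' by rewrite ler_norml; lra.
    have dy1 : `|d' - y| <= d' - c' by rewrite ler_norml; lra.
    have A := HP t c' (le_lt_trans xt w1) (le_lt_trans cy1 h1).
    have B := HP t d' (le_lt_trans xt w1) (le_lt_trans dy1 h1).
    have A' := le_trans A (ler_wpM2l (ltW e4) (lerD xt cy1)).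
    have B' := le_trans B (ler_wpM2l (ltW e4) (lerD xt dy1)).
    have -> : P t c' - P t d' - - (m * (d' - c')) =
      (P t c' - P x y - (p1 * (t - x) + m * (c' - y))) -
      (P t d' - P x y - (p1 * (t - x) + m * (d' - y))) by ring.
    by rewrite (le_trans (ler_normB _ _))// (le_trans (lerD A' B'))// /S; lra.
  have HQt t : c' <= t <= d' -> `|Q b' t - Q a' t - m * (b' - a')| <= e / 2 * S.
    move=> /andP[ct td].
    have yt : `|t - y| <= d' - c' by rewrite ler_norml; lra.
    have ax1 : `|a' - x| <= b' - a' by rewrite ler_norml; lra.
    have bx1 : `|b' - x| <= b' - a' by rewrite ler_norml; lra.
    have A := HQ b' t (le_lt_trans bx1 w2) (le_lt_trans yt h2).
    have B := HQ a' t (le_lt_trans ax1 w2) (le_lt_trans yt h2).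
    have A' := le_trans A (ler_wpM2l (ltW e4) (lerD bx1 yt)).
    have B' := le_trans B (ler_wpM2l (ltW e4) (lerD ax1 yt)).
    have -> : Q b' t - Q a' t - m * (b' - a') =
      (Q b' t - Q x y - (m * (b' - x) + q2 * (t - y))) -
      (Q a' t - Q x y - (m * (a' - x) + q2 * (t - y))) by ring.
    by rewrite (le_trans (ler_normB _ _))// (le_trans (lerD A' B'))// /S; lra.
  have ab' : a' <= b' by lra.
  have cd' : c' <= d' by lra.
  have P1 : itv_integrable a' b' (P ^~ c') by apply: Pi => //; lra.
  have P2 : itv_integrable a' b' (P ^~ d') by apply: Pi => //; lra.
  have Q1 : itv_integrable c' d' (Q b') by apply: Qi => //; lra.
  have Q2 : itv_integrable c' d' (Q a') by apply: Qi => //; lra.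
  have I1 := itv_int_near ab' (itv_integrableB P1 P2) HPt.
  have I2 := itv_int_near cd' (itv_integrableB Q1 Q2) HQt.
  move: I1 I2; rewrite !itv_intB// => I1 I2; rewrite /D.
  have eS : e / 2 * S * (b' - a') + e / 2 * S * (d' - c') <= e * S ^+ 2.
    have -> : e / 2 * S * (b' - a') + e / 2 * S * (d' - c') = e * S ^+ 2 / 2.
      by rewrite /S; field.
    by have := mulr_ge0 (ltW e0) (sqr_ge0 S); lra.
  apply: le_trans eS; apply: le_trans (lerD I1 I2); apply: le_trans (ler_normD _ _).
  by rewrite le_eqVlt; apply/orP; left; apply/eqP; congr `|_|; ring.
Qed.

End goursat.

(** * The mean value property *)

Section complex_limits.
Context {R : realType}.
Local Notation C := R[i].
(** The rules for limits and derivatives, at [R[i]] over itself. *)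
Lemma ccvgM (T : Type) (F : set_system T) {FF : Filter F} (f g : T -> C) (a b : C) :
  f @ F --> a -> g @ F --> b -> (fun t => f t * g t) @ F --> a * b.
Proof. move=> fa gb. exact: (@cvgM C T F FF f g a b fa gb). Qed.
Lemma ccvgD (T : Type) (F : set_system T) {FF : Filter F} (f g : T -> C) (a b : C) :
  f @ F --> a -> g @ F --> b -> (fun t => f t + g t) @ F --> a + b.
Proof. move=> fa gb. exact: (@cvgD C C T F FF f g a b fa gb). Qed.
Lemma ccvgV (T : Type) (F : set_system T) {FF : Filter F} (f : T -> C) (a : C) :
  a != 0 -> f @ F --> a -> (fun t => (f t)^-1) @ F --> a^-1.
Proof. move=> a0 fa. exact: (@cvgV C T F FF f a a0 fa). Qed.

Lemma holoM (f g : C -> C) (z : C) : holo_at f z -> holo_at g z ->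
  holo_at (fun w => f w * g w) z.
Proof. by move=> df dg; exact: (@derivableM C C f g z 1 df dg). Qed.

Lemma holoD (f g : C -> C) (z : C) : holo_at f z -> holo_at g z ->
  holo_at (fun w => f w + g w) z.
Proof. by move=> df dg; exact: (@derivableD C C C f g z 1 df dg). Qed.

Lemma holoV (f : C -> C) (z : C) : f z != 0 -> holo_at f z ->
  holo_at (fun w => (f w)^-1) z.
Proof. by move=> f0 df; exact: (@derivableV C C f z 1 f0 df). Qed.

Lemma holo_cst (k z : C) : holo_at (fun _ : C => k) z.
Proof. exact: (@derivable_cst C C C k z 1). Qed.

Lemma holo_id (z : C) : holo_at (fun w : C => w) z.
Proof. exact: (@derivable_id C C z 1). Qed.

End complex_limits.

Section mean_value.
Context {R : realType}.
Local Notation C := R[i].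
Local Notation re := (@complex.Re R).
Local Notation im := (@complex.Im R).

Definition mean (g : R -> R) : R := (2 * pi)^-1 * itv_int 0 (2 * pi) g.

Lemma twopi_gt0 : 0 < 2 * pi :> R.
Proof. by rewrite mulr_gt0// pi_gt0. Qed.

Lemma eitheta2pi (t : R) : eitheta (t + 2 * pi) = eitheta t.
Proof. by rewrite /eitheta mulr_natl cosD2pi sinD2pi. Qed.

(** The equality of the mixed coefficients is the Cauchy-Riemann system, in the
    form that [goursat_rectangle] requires of P = im g and Q = re g. *)
Lemma holo_lin_approx (g : C -> C) (x y : R) : holo_at g (x +i* y)%C ->
  exists u v, lin_approx (fun s t => re (g (s +i* t)%C)) x y u (- v) /\
              lin_approx (fun s t => im (g (s +i* t)%C)) x y v u.
Proof.
move/holo_atP => [d H]; exists (re d), (im d).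
suff K : forall e : R, 0 < e -> exists2 de : R, 0 < de & forall x' y' : R,
    `|x' - x| < de -> `|y' - y| < de ->
    normc (g (x' +i* y')%C - g (x +i* y)%C - d * ((x' - x) +i* (y' - y))%C)
      <= e * (`|x' - x| + `|y' - y|).
  split=> e /K[de de0 {}K]; exists de => // x' y' xd yd.
    apply: le_trans (K _ _ xd yd); apply: le_trans (Re_le_normc _).
    by rewrite !(ReB, ReM) /= mulNr.
  apply: le_trans (K _ _ xd yd); apply: le_trans (Im_le_normc _).
  by rewrite !(ImB, ImM) /= (addrC (re d * _)).
move=> e e0; have [de de0 {}H] := H e e0; exists (de / 2); first by rewrite divr_gt0.
move=> x' y' xd yd.
have E : (x' +i* y' = (x +i* y) + ((x' - x) +i* (y' - y)))%C.
  by apply/eqP; rewrite eq_complex /=; apply/andP; split; apply/eqP; ring.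
have n1 : normc ((x' - x) +i* (y' - y))%C <= `|x' - x| + `|y' - y|.
  exact: normc_leD.
have nd : normc ((x' - x) +i* (y' - y))%C < de.
  by apply: le_lt_trans n1 _; rewrite (splitr de) ltrD.
rewrite E; apply: le_trans (H _ nd) _.
by rewrite (@ler_wpM2l R e (ltW e0)).  
Qed.

Lemma cexp_ln (r t : R) : 0 < r -> cexp (ln r +i* t)%C = on_circle r t.
Proof. by move=> r0; rewrite /cexp /= lnK. Qed.

Lemma cont_integrable_circle (g : R -> R) : continuous g ->
  itv_integrable 0 (2 * pi) g.
Proof. by move=> cg; apply: cont_itv_integrable => t _; exact: cg. Qed.

Lemma continuous_on_circle (r : R) : continuous (on_circle r : R -> C).
Proof.
move=> t; apply: (@ccvgM R _ (nbhs t) _ (fun=> r%:C%C) (@eitheta R) r%:C%C (eitheta t)).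
  exact: cvg_cst.
exact: continuous_eitheta.
Qed.

Section circle_mean_value.
Variables (f : C -> C) (a : C) (rho0 : R).
Hypothesis df : forall z : C, normc (z - a) < rho0 -> holo_at f z.

Let circ r t : C := a + on_circle r t.

Let circ_in r t : 0 <= r -> r < rho0 -> normc (circ r t - a) < rho0.
Proof. by move=> r0 rr; rewrite /circ addrC addKr normc_on_circle. Qed.

Let contc r : 0 <= r -> r < rho0 -> continuous (fun t => f (circ r t)).
Proof.
move=> r0 rr t; apply: (@continuous_comp _ _ _ (circ r) f).
  apply: (@ccvgD R _ (nbhs t) _ (fun=> a) (on_circle r) a (on_circle r t)).
    exact: cvg_cst.
  exact: continuous_on_circle.
by apply: holo_continuous; apply: df; exact: circ_in.
Qed.

Let Rec r : 0 <= r -> r < rho0 -> continuous (fun t => re (f (circ r t))).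
Proof. by move=> r0 rr t; apply: cvg_Re; exact: contc. Qed.

(** In the logarithmic coordinate w = s + i t the circle of radius r around a
    becomes a period of the vertical line s = ln r; the horizontal sides of the
    rectangle cancel by periodicity. *)
Lemma circle_mean_indep r1 r2 : 0 < r1 -> r1 < r2 -> r2 < rho0 ->
  mean (fun t => re (f (circ r1 t))) = mean (fun t => re (f (circ r2 t))).
Proof.
move=> r10 r12 r2r; have r20 := lt_trans r10 r12.
pose Q s t := re (f (a + cexp (s +i* t)%C)).
pose P s t := im (f (a + cexp (s +i* t)%C)).
have := @goursat_rectangle _ P Q (ln r1) (ln r2) 0 (2 * pi).
rewrite ltr_ln ?posrE// => /(_ r12 twopi_gt0) H.
have P2pi s : P s 0 = P s (2 * pi).
  rewrite /P /cexp; congr (im (f (a + (_ * _)))).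
  by have := eitheta2pi 0; rewrite add0r => ->.
have Qc r : 0 < r -> Q (ln r) = fun t => re (f (circ r t)).
  by move=> r0; apply/funext => t; rewrite /Q cexp_ln.
move: H; have -> : P ^~ 0 = P ^~ (2 * pi) by apply/funext => s; exact: P2pi.
rewrite subrr add0r !Qc// => H; congr (_ * _); apply/esym/eqP.
rewrite -subr_eq0 H// => s t sb _.
have dg : holo_at (fun w => f (a + cexp w)) (s +i* t)%C.
  apply: (@holo_comp _ (fun w => a + cexp w) f).
    by apply: holoD; [exact: holo_cst|exact: holo_cexp].
  apply: df; rewrite addrC addKr normc_cexp /=.
  apply: le_lt_trans r2r; rewrite -[leRHS]lnK ?posrE// ler_expR.
  by case/andP: sb.
have [u [v [Hu Hv]]] := holo_lin_approx dg.
by exists v, u, (- v).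
Qed.

Lemma mean_cst (k : R) : mean (fun=> k) = k.
Proof.
rewrite /mean itv_int_cst ?(ltW twopi_gt0)// subr0 mulrCA mulVf ?mulr1//.
by rewrite gt_eqF// twopi_gt0.
Qed.

Lemma mean_near (g : R -> R) (k e : R) : itv_integrable 0 (2 * pi) g ->
  (forall t, 0 <= t <= 2 * pi -> `|g t - k| <= e) -> `|mean g - k| <= e.
Proof.
move=> gi ge; have := itv_int_near (ltW twopi_gt0) gi ge.
rewrite subr0 => H; rewrite /mean -[X in _ - X](@mulKf _ (2 * pi)) ?gt_eqF ?twopi_gt0//.
rewrite -mulrBr normrM gtr0_norm ?invr_gt0 ?twopi_gt0//.
by rewrite mulrC ler_pdivrMr ?twopi_gt0// (mulrC _ k).
Qed.

(** The mean over a circle is independent of the radius, and tends to the value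
    at the center as the radius tends to 0. *)
Lemma mean_value_Re r : 0 < r -> r < rho0 ->
  mean (fun t => re (f (circ r t))) = re (f a).
Proof.
move=> r0 rr; apply/eqP; rewrite -subr_eq0 -normr_le0; apply/ler_addgt0Pl => e e0.
rewrite addr0.
have fa : {for a, continuous f}.
  by apply: holo_continuous; apply: df; rewrite subrr normc0 (lt_trans r0).
have /cvg_CP/(_ e e0)/nbhs_C[de de0 H] := fa.
pose s := Num.min (r / 2) (de / 2).
have s0 : 0 < s by rewrite lt_min !divr_gt0.
have sr : s < r by rewrite gt_min ltr_pdivrMr// ltr_pMr// ltr1n.
rewrite -(@circle_mean_indep s r)//; apply: mean_near.
  by apply: cont_integrable_circle; apply: Rec; [exact: ltW|exact: lt_trans rr].
move=> t _; rewrite -ReB; apply: le_trans (Re_le_normc _) _; apply/ltW/H.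
rewrite /circ addrC addKr normc_on_circle ?(ltW s0)//.
by rewrite gt_min [X in _ || X]ltr_pdivrMr// ltr_pMr// ltr1n orbT.
Qed.

End circle_mean_value.

Lemma mean_value_Im (f : C -> C) (a : C) (rho0 : R) :
  (forall z : C, normc (z - a) < rho0 -> holo_at f z) ->
  forall r, 0 < r -> r < rho0 -> mean (fun t => im (f (a + on_circle r t))) = im (f a).
Proof.
move=> df r r0 rr.
have := @mean_value_Re (fun z => - 'i%C * f z) a rho0 _ r r0 rr.
have E z : re (- 'i%C * f z) = im (f z).
  by rewrite ReM /= oppr0 mul0r sub0r mulN1r opprK.
rewrite E => <-; last first.
  by move=> z /df dfz; exact: (@holoM _ (fun=> - 'i%C) f z (@holo_cst _ _ _) dfz).
by congr mean; apply/funext => t; rewrite E.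
Qed.

End mean_value.

(** * Means over the circle *)

Section circle_integrals.
Context {R : realType}.
Local Notation C := R[i].
Local Notation re := (@complex.Re R).
Local Notation im := (@complex.Im R).
Implicit Types (f g k phi psi : R -> R).

Definition aint phi := itv_integrable 0 (2 * pi) phi.

Let mA : measurable (`[0, 2 * pi]%classic : set (measurableTypeR R)).
Proof. by []. Qed.

Lemma aint_measurable phi : aint phi -> measurable_fun (@angles R) phi.
Proof. by move=> /measurable_int/measurable_EFinP. Qed.

Lemma aintD f g : aint f -> aint g -> aint (fun t => f t + g t).
Proof. by move=> fi gi; have := integrableD mA fi gi; apply: eq_integrable. Qed.

Lemma aintB f g : aint f -> aint g -> aint (fun t => f t - g t).
Proof. exact: itv_integrableB. Qed.

Lemma aintZ (c : R) f : aint f -> aint (fun t => c * f t).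
Proof. by move=> fi; have := integrableZl mA c fi; apply: eq_integrable. Qed.

Lemma aint_cst (c : R) : aint (fun=> c).
Proof. exact: itv_integrable_cst. Qed.

Lemma aint_norm f : aint f -> aint (fun t => `|f t|).
Proof. by move=> fi; have := integrable_norm fi; apply: eq_integrable. Qed.

Lemma aint_cont f : continuous f -> aint f.
Proof. exact: cont_integrable_circle. Qed.

Lemma aint_le f g : measurable_fun (@angles R) f ->
  (forall t, angles t -> `|f t| <= g t) -> aint g -> aint f.
Proof.
move=> mf fg; apply: le_integrable => //; first exact/measurable_EFinP.
by move=> t tA /=; rewrite lee_fin (le_trans (fg _ tA))// ler_norm.
Qed.

Lemma aintM k phi (M : R) : continuous k -> (forall t, `|k t| <= M) -> aint phi ->
  aint (fun t => k t * phi t).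
Proof.
move=> ck kM fi; apply: (@aint_le _ (fun t => M * `|phi t|)).
- apply: measurable_funM; last exact: aint_measurable.
  by apply: measurable_funTS; exact: continuous_measurable_fun.
- by move=> t _; rewrite normrM ler_wpM2r.
- by apply: aintZ; exact: aint_norm.
Qed.

Lemma meanD f g : aint f -> aint g -> mean (fun t => f t + g t) = mean f + mean g.
Proof. by move=> fi gi; rewrite /mean /itv_int RintegralD// mulrDr. Qed.

Lemma meanB f g : aint f -> aint g -> mean (fun t => f t - g t) = mean f - mean g.
Proof. by move=> fi gi; rewrite /mean itv_intB// mulrBr. Qed.

Lemma meanZ (c : R) f : aint f -> mean (fun t => c * f t) = c * mean f.
Proof. by move=> fi; rewrite /mean /itv_int RintegralZl// mulrCA. Qed.

Lemma le_mean f g : aint f -> aint g ->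
  (forall t, angles t -> f t <= g t) -> mean f <= mean g.
Proof.
move=> fi gi fg; rewrite ler_wpM2l ?invr_ge0 ?(ltW twopi_gt0)//.
by apply: le_itv_int => // t ?; apply: fg; rewrite /angles /= in_itv.
Qed.

Lemma mean_ge0 f : (forall t, angles t -> 0 <= f t) -> 0 <= mean f.
Proof.
move=> f0; rewrite mulr_ge0 ?invr_ge0 ?(ltW twopi_gt0)//.
exact: Rintegral_ge0.
Qed.

Lemma norm_mean_le f : aint f -> `|mean f| <= mean (fun t => `|f t|).
Proof.
move=> fi; rewrite normrM gtr0_norm ?invr_gt0 ?twopi_gt0//.
by rewrite ler_wpM2l ?invr_ge0 ?(ltW twopi_gt0)//; exact: le_normr_Rintegral.
Qed.

Lemma eq_mean f g : (forall t, angles t -> f t = g t) -> mean f = mean g.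
Proof.
by move=> fg; congr (_ * _); apply: eq_Rintegral => t /[!inE]; exact: fg.
Qed.

Definition cmean (k : R -> C) phi : C :=
  (mean (fun t => re (k t) * phi t) +i* mean (fun t => im (k t) * phi t))%C.

Section cmean_lemmas.
Variable phi : R -> R.
Hypothesis iphi : aint phi.
Implicit Types h : R -> C.

Lemma aint_Re h (M : R) : continuous h -> (forall t, normc (h t) <= M) ->
  aint (fun t => re (h t) * phi t).
Proof.
move=> ch hM; apply: (@aintM _ _ M) => // t; first by apply: cvg_Re; exact: ch.
exact: le_trans (Re_le_normc _) (hM t).
Qed.

Lemma aint_Im h (M : R) : continuous h -> (forall t, normc (h t) <= M) ->
  aint (fun t => im (h t) * phi t).
Proof.
move=> ch hM; apply: (@aintM _ _ M) => // t; first by apply: cvg_Im; exact: ch.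
exact: le_trans (Im_le_normc _) (hM t).
Qed.

Lemma cmeanB (h1 h2 : R -> C) (M1 M2 : R) : continuous h1 -> continuous h2 ->
  (forall t, normc (h1 t) <= M1) -> (forall t, normc (h2 t) <= M2) ->
  cmean (fun t => h1 t - h2 t) phi = cmean h1 phi - cmean h2 phi.
Proof.
move=> c1 c2 b1 b2; rewrite /cmean; set L := RHS.
have -> : L = (re L +i* im L)%C by case: L.
rewrite /L /= -!meanB; try by [exact: aint_Re b1|exact: aint_Re b2|
  exact: aint_Im b1|exact: aint_Im b2].
by congr (_ +i* _)%C; apply: eq_mean => t _; rewrite ?(ReB, ImB) mulrBl.
Qed.

Lemma cmeanZ (c : C) h (M : R) : continuous h ->
  (forall t, normc (h t) <= M) ->
  cmean (fun t => c * h t) phi = c * cmean h phi.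
Proof.
move=> ch hM; have hr := aint_Re ch hM; have hi := aint_Im ch hM.
apply/eqP; rewrite eq_complex /= ReM ImM /=; apply/andP; split; apply/eqP.
  rewrite -!meanZ// -meanB; [|exact: aintZ|exact: aintZ].
  by apply: eq_mean => t _; rewrite ReM; ring.
rewrite -!meanZ// -meanD; [|exact: aintZ|exact: aintZ].
by apply: eq_mean => t _; rewrite ImM; ring.
Qed.

Lemma norm_cmean h (M : R) : continuous h -> (forall t, normc (h t) <= M) ->
  normc (cmean h phi) <= 2 * M * mean (fun t => `|phi t|).
Proof.
move=> ch hM; have hr := aint_Re ch hM; have hi := aint_Im ch hM.
have ip := aintZ M (aint_norm iphi).
apply: le_trans (normc_leD _) _ => /=.
rewrite -mulrA mulr2n mulrDl mul1r -meanZ; last exact: aint_norm.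
apply: lerD; apply: le_trans (norm_mean_le _) _ => //;
  apply: le_mean => //; do ?exact: aint_norm.
- by move=> t _; rewrite normrM ler_wpM2r// (le_trans (Re_le_normc _)).
- by move=> t _; rewrite normrM ler_wpM2r// (le_trans (Im_le_normc _)).
Qed.

End cmean_lemmas.

End circle_integrals.

(** * Herglotz and Poisson integrals *)

Section herglotz.
Context {R : realType}.
Local Notation C := R[i].
Local Notation re := (@complex.Re R).
Implicit Types (phi psi : R -> R) (z : C) (t : R).

Lemma holoB (f g : C -> C) (z : C) : holo_at f z -> holo_at g z ->
  holo_at (fun w => f w - g w) z.
Proof. by move=> df dg; exact: (@derivableB C C C f g z 1 df dg). Qed.

Lemma cayley_re (a b : C) : re ((a + b) / (a - b)) =
  (normc a ^+ 2 - normc b ^+ 2) / normc (a - b) ^+ 2.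
Proof.
rewrite !normc_sqr; case: a b => [a1 a2] [b1 b2] /=.
set n := (a1 - b1) ^+ 2 + (a2 - b2) ^+ 2.
by move: n^-1 => m; ring.
Qed.

(** The real part of this kernel is the Poisson kernel, so that a Poisson
    integral is the real part of the holomorphic function [herglotz phi]. *)
Definition herglotz_kernel z t : C := (eitheta t + z) / (eitheta t - z).

Definition poisson_kernel z t : R := (1 - normc z ^+ 2) / normc (eitheta t - z) ^+ 2.

Lemma herglotz_kernel_re z t : re (herglotz_kernel z t) = poisson_kernel z t.
Proof. by rewrite cayley_re normc_eitheta expr1n. Qed.

Lemma eitheta_dist z t : 1 - normc z <= normc (eitheta t - z).
Proof. by rewrite -(normc_eitheta t) normcBl. Qed.

Lemma eitheta_sub_neq0 z t : normc z < 1 -> eitheta t - z != 0.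
Proof. by move=> z1; rewrite -normc_gt0 (lt_le_trans _ (eitheta_dist z t))// subr_gt0. Qed.

Lemma continuous_subC z : continuous (fun t => eitheta t - z).
Proof.
move=> t; apply: (@ccvgD R _ (nbhs t) _ (@eitheta R) (fun=> - z)); last exact: cvg_cst.
exact: continuous_eitheta.
Qed.

Lemma continuous_invC z : normc z < 1 -> continuous (fun t => (eitheta t - z)^-1).
Proof.
move=> z1 t; apply: (@ccvgV R _ (nbhs t) _ (fun t => eitheta t - z)).
  exact: eitheta_sub_neq0.
exact: continuous_subC.
Qed.

Lemma continuous_mulC (f g : R -> C) : continuous f -> continuous g ->
  continuous (fun t => f t * g t).
Proof.
move=> cf cg t; apply: (@ccvgM R _ (nbhs t) _ f g); [exact: cf|exact: cg].
Qed.

Lemma continuous_cstC (c : C) : continuous (fun _ : R => c).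
Proof. by move=> t; exact: cvg_cst. Qed.

Lemma continuous_oppC (f : R -> C) : continuous f -> continuous (fun t : R => - f t).
Proof. by move=> cf t; exact: (@cvgN C C R (nbhs t) _ f (f t) (cf t)). Qed.

Lemma continuous_herglotz_kernel z : normc z < 1 -> continuous (herglotz_kernel z).
Proof.
move=> z1; apply: continuous_mulC; last exact: continuous_invC.
have := @continuous_subC (- z).
by have -> : (fun t => eitheta t - - z) = (fun t => eitheta t + z)
  by apply/funext => t; rewrite opprK.
Qed.

Lemma norm_invC z t : normc z < 1 -> normc (eitheta t - z)^-1 <= (1 - normc z)^-1.
Proof.
move=> z1; rewrite normcV lef_pV2 ?posrE ?subr_gt0 ?eitheta_dist//.
by rewrite normc_gt0 eitheta_sub_neq0.
Qed.

Lemma norm_herglotz_kernel z t : normc z < 1 ->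
  normc (herglotz_kernel z t) <= 2 / (1 - normc z).
Proof.
move=> z1; rewrite normcM ler_pM ?normc_ge0 ?norm_invC//.
by rewrite (le_trans (normcD _ _))// normc_eitheta lerD2l ltW.
Qed.

Definition herglotz phi z : C := cmean (herglotz_kernel z) phi.

Definition poisson phi z : R := mean (fun t => poisson_kernel z t * phi t).

Lemma herglotz_re phi z : re (herglotz phi z) = poisson phi z.
Proof. by apply: eq_mean => t _; rewrite herglotz_kernel_re. Qed.

(** Differentiation under the integral sign: with w = e^(it), the kernel is
    2 w / (w - z) - 1, and the remainder of its first order expansion at z is
    2 w h^2 / ((w - z)^2 (w - z - h)), bounded by a multiple of |h|^2. *)
Lemma holo_herglotz phi z : aint phi -> normc z < 1 -> holo_at (herglotz phi) z.
Proof.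
move=> iphi z1; set eta := 1 - normc z.
have eta0 : 0 < eta by rewrite subr_gt0.
pose k' (t : R) : C := (2 : C) * eitheta t * ((eitheta t - z)^-1 * (eitheta t - z)^-1).
have c2 : continuous (fun t : R => (2 : C) * eitheta t).
  exact: (@continuous_mulC (fun=> 2) (@eitheta R) (@continuous_cstC 2) (@continuous_eitheta R)).
have ck' : continuous k'.
  exact: (@continuous_mulC _ _ c2 (@continuous_mulC _ _ (continuous_invC z1) (continuous_invC z1))).
have n2 : normc (2 : C) = 2 by rewrite -[2 in LHS]/(2%:R) -(rmorph_nat (real_complex R)) normc_real ger0_norm.
have bk' t : normc (k' t) <= 2 * (eta^-1 * eta^-1).
  rewrite !normcM n2 normc_eitheta mulr1 ler_wpM2l//.
  by rewrite ler_pM ?normc_ge0// norm_invC.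
apply/holo_atP; exists (cmean k' phi) => e e0.
set M := mean (fun t => `|phi t|).
have M0 : 0 <= M by exact: mean_ge0.
pose K := 8 / eta ^+ 3 * M.
have K0 : 0 <= K by rewrite mulr_ge0// divr_ge0// exprn_ge0// ltW.
exists (Num.min (eta / 2) (e / (1 + K))).
  by rewrite lt_min !divr_gt0// ltr_pwDl.
move=> h; rewrite lt_min => /andP[h1 h2].
have zh : normc (z + h) < 1.
  by have := normcD z h; rewrite /eta in h1; lra.
rewrite /herglotz.
have ck : continuous (fun t => h * k' t).
  exact: (@continuous_mulC (fun=> h) k' (@continuous_cstC h) ck').
have ckD : continuous (fun t => herglotz_kernel (z + h) t - herglotz_kernel z t).
  move=> t; apply: (@ccvgD R _ (nbhs t) _ (herglotz_kernel (z + h)) (fun t => - herglotz_kernel z t)).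
    exact: continuous_herglotz_kernel.
  exact: continuous_oppC (continuous_herglotz_kernel z1) t.
have bk t : normc (h * k' t) <= normc h * (2 * (eta^-1 * eta^-1)).
  by rewrite normcM ler_wpM2l ?normc_ge0.
rewrite -(@cmeanB _ _ iphi _ _ _ _ (continuous_herglotz_kernel zh)
  (continuous_herglotz_kernel z1) (fun t => norm_herglotz_kernel t zh)
  (fun t => norm_herglotz_kernel t z1)).
rewrite (mulrC _ h) -(cmeanZ iphi h ck' bk').
have bD t : normc (herglotz_kernel (z + h) t - herglotz_kernel z t) <=
    2 / (1 - normc (z + h)) + 2 / (1 - normc z).
  by rewrite (le_trans (normcB _ _))// lerD// norm_herglotz_kernel.
rewrite -(cmeanB iphi ckD ck bD bk).
have bR t : normc (herglotz_kernel (z + h) t - herglotz_kernel z t - h * k' t) <=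
    4 / eta ^+ 3 * normc h ^+ 2.
  have d1 := eitheta_sub_neq0 t z1; have d2 := eitheta_sub_neq0 t zh.
  have -> : herglotz_kernel (z + h) t - herglotz_kernel z t - h * k' t =
      2 * eitheta t * (h * h) * ((eitheta t - z)^-1 * (eitheta t - z)^-1 * (eitheta t - (z + h))^-1).
    by rewrite /herglotz_kernel /k'; field; rewrite d1 d2.
  rewrite !normcM n2 normc_eitheta mulr1 -expr2.
  have -> : 4 / eta ^+ 3 * normc h ^+ 2 = 2 * normc h ^+ 2 * (eta^-1 * eta^-1 * (eta / 2)^-1).
    by field; rewrite gt_eqF.
  have nh : 0 <= 2 * normc h ^+ 2 by rewrite mulr_ge0// sqr_ge0.
  apply: ler_wpM2l => //.
  have n1 := @norm_invC z t z1.
  have n3 : normc (eitheta t - z)^-1 * normc (eitheta t - z)^-1 <= eta^-1 * eta^-1.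
    by apply: ler_pM; rewrite ?normc_ge0.
  apply: ler_pM => //; [by rewrite mulr_ge0// normc_ge0|exact: normc_ge0|].
  apply: le_trans (norm_invC t zh) _; rewrite lef_pV2 ?posrE ?divr_gt0 ?subr_gt0//.
  by have := normcD z h; rewrite /eta in h1 *; lra.
have cR : continuous (fun t => herglotz_kernel (z + h) t - herglotz_kernel z t - h * k' t).
  move=> t; apply: (@ccvgD R _ (nbhs t) _ (fun t => herglotz_kernel (z + h) t - herglotz_kernel z t) (fun t => - (h * k' t))).
    exact: ckD.
  exact: continuous_oppC ck t.
apply: le_trans (norm_cmean iphi cR bR) _.
have -> : 2 * (4 / eta ^+ 3 * normc h ^+ 2) * M = K * normc h * normc h.
  by rewrite /K; ring.
rewrite ler_wpM2r ?normc_ge0//.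
have h3 : normc h * (1 + K) < e by rewrite -ltr_pdivlMr// ltr_pwDl.
apply: le_trans (ltW h3); rewrite mulrDr mulr1 (mulrC K) lerDr normc_ge0//.
Qed.

Lemma poisson_kernel_ge0 z t : normc z < 1 -> 0 <= poisson_kernel z t.
Proof.
move=> z1; rewrite divr_ge0 ?sqr_ge0// subr_ge0 expr_le1// ?normc_ge0// ltW//.
Qed.

Lemma continuous_poisson_kernel z : normc z < 1 -> continuous (poisson_kernel z).
Proof.
move=> z1; have := continuous_herglotz_kernel z1.
have -> : poisson_kernel z = (fun t => re (herglotz_kernel z t)).
  by apply/funext => t; rewrite herglotz_kernel_re.
by move=> c t; apply: cvg_Re; exact: c.
Qed.

Lemma poisson_kernel_le z t : normc z < 1 -> `|poisson_kernel z t| <= 2 / (1 - normc z).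
Proof.
move=> z1; rewrite -herglotz_kernel_re (le_trans (Re_le_normc _))//.
exact: norm_herglotz_kernel.
Qed.

Lemma aint_poisson phi z : aint phi -> normc z < 1 ->
  aint (fun t => poisson_kernel z t * phi t).
Proof.
move=> iphi z1; apply: aintM => //; first exact: continuous_poisson_kernel.
by move=> t; exact: poisson_kernel_le.
Qed.

Lemma poissonD phi psi z : aint phi -> aint psi -> normc z < 1 ->
  poisson (fun t => phi t + psi t) z = poisson phi z + poisson psi z.
Proof.
move=> ip iq z1; rewrite /poisson -meanD; [|exact: aint_poisson..].
by apply: eq_mean => t _; rewrite mulrDr.
Qed.

Lemma poissonZ (c : R) phi z : aint phi -> normc z < 1 ->
  poisson (fun t => c * phi t) z = c * poisson phi z.
Proof.
move=> ip z1; rewrite /poisson -meanZ; last exact: aint_poisson.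
by apply: eq_mean => t _; rewrite mulrCA.
Qed.

Lemma poissonB phi psi z : aint phi -> aint psi -> normc z < 1 ->
  poisson (fun t => phi t - psi t) z = poisson phi z - poisson psi z.
Proof.
move=> ip iq z1; rewrite /poisson -meanB; [|exact: aint_poisson..].
by apply: eq_mean => t _; rewrite mulrBr.
Qed.

Lemma normc_eithetaB_conj z t : normc (1 - (z^*)%C * eitheta t) = normc (eitheta t - z).
Proof.
have -> : eitheta t - z = eitheta t * (1 - (z^*)%C * eitheta t)^*%C.
  rewrite rmorphB rmorph1 rmorphM /= conjcK mulrBr mulr1 mulrCA.
  have -> : eitheta t * (eitheta t)^*%C = 1.
    apply/eqP; rewrite eq_complex /=; apply/andP; split; apply/eqP; last by ring.
    by rewrite mulrN opprK -!expr2 cos2Dsin2.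
  by rewrite mulr1.
by rewrite normcM normc_eitheta mul1r normc_conj.
Qed.

(** The conjugate of the kernel is the boundary value of the function
    (1 + z^* w) / (1 - z^* w), which is holomorphic beyond the closed disc and
    equal to 1 at 0. *)
Lemma poisson1 z : normc z < 1 -> poisson (fun=> 1) z = 1.
Proof.
move=> z1; pose g (w : C) := (1 + (z^*)%C * w) / (1 - (z^*)%C * w).
pose rho := 2 / (1 + normc z).
have nz1 : 0 < 1 + normc z by rewrite ltr_pwDl// normc_ge0.
have rho1 : 1 < rho by rewrite ltr_pdivlMr// mul1r; lra.
have dg : forall w : C, normc (w - 0) < rho -> holo_at g w.
  move=> w; rewrite subr0 => wr.
  have w0 : 1 - (z^*)%C * w != 0.
    rewrite -normc_gt0; apply: lt_le_trans (normcBl _ _).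
    rewrite normc1 normcM normc_conj subr_gt0.
    have [->|zn0] := eqVneq (normc z) 0; first by rewrite mul0r.
    have zp : 0 < normc z by rewrite lt_neqAle eq_sym zn0 normc_ge0.
    apply: lt_le_trans (_ : normc z * rho <= 1); first by rewrite ltr_pM2l.
    by rewrite mulrA ler_pdivrMr// mul1r; lra.
  have d1 (c : C) : holo_at (fun w => 1 + c * w) w.
    exact: (@holoD R (fun=> 1) (fun v => c * v) w (@holo_cst _ _ _)
      (@holoM R (fun=> c) (fun v => v) w (@holo_cst _ _ _) (@holo_id _ _))).
  have d2 : holo_at (fun w => 1 - (z^*)%C * w) w.
    exact: (@holoB (fun=> 1) (fun v => (z^*)%C * v) w (@holo_cst _ _ _)
      (@holoM R (fun=> (z^*)%C) (fun v => v) w (@holo_cst _ _ _) (@holo_id _ _))).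
  exact: (@holoM R (fun v => 1 + (z^*)%C * v) (fun v => (1 - (z^*)%C * v)^-1) w (d1 _)
    (@holoV R (fun v => 1 - (z^*)%C * v) w w0 d2)).
have := mean_value_Re dg ltr01 rho1.
rewrite /g mulr0 addr0 subr0 divr1 [RHS]/= => E; rewrite -[RHS]E.
apply: eq_mean => t _; rewrite mulr1 add0r /on_circle rmorph1 mul1r.
rewrite cayley_re normc1 normcM normc_conj normc_eitheta mulr1 expr1n.
by rewrite normc_eithetaB_conj.
Qed.

Lemma poisson_cst (c : R) z : normc z < 1 -> poisson (fun=> c) z = c.
Proof.
move=> z1; have := @poissonZ c (fun=> 1) z (aint_cst 1) z1.
by rewrite mulr1 poisson1// mulr1.
Qed.

Lemma poisson_ge0 phi z : normc z < 1 -> (forall t, angles t -> 0 <= phi t) ->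
  0 <= poisson phi z.
Proof.
by move=> z1 p0; apply: mean_ge0 => t tA; rewrite mulr_ge0 ?p0 ?poisson_kernel_ge0.
Qed.

(** Jensen's inequality for the square, P being a probability kernel. *)
Lemma poisson_sqr phi z : aint phi -> aint (fun t => phi t ^+ 2) -> normc z < 1 ->
  poisson phi z ^+ 2 <= poisson (fun t => phi t ^+ 2) z.
Proof.
move=> i1 i2 z1; set c := poisson phi z.
have : 0 <= poisson (fun t => (phi t - c) ^+ 2) z.
  by apply: poisson_ge0 => // t _; exact: sqr_ge0.
have -> : poisson (fun t => (phi t - c) ^+ 2) z =
   poisson (fun t => phi t ^+ 2 - (2 * c) * phi t + c ^+ 2) z.
  by congr (poisson _ z); apply/funext => t; ring.
have i3 := aintZ (2 * c) i1; have i4 := aintB i2 i3.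
rewrite (poissonD i4 (aint_cst _) z1) (poissonB i2 i3 z1) (poissonZ _ i1 z1).
by rewrite (poisson_cst _ z1) -/c; lra.
Qed.

Lemma poisson0 phi : poisson phi 0 = mean phi.
Proof.
apply: eq_mean => t _; rewrite /poisson_kernel normc0 subr0 normc_eitheta.
by rewrite expr0n subr0 expr1n divr1 mul1r.
Qed.

(** The mean value property of [herglotz phi] at the origin. *)
Lemma mean_poisson phi r : aint phi -> 0 < r -> r < 1 ->
  mean (fun t => poisson phi (on_circle r t)) = mean phi.
Proof.
move=> ip r0 r1; rewrite -[RHS]poisson0 -[RHS]herglotz_re.
have dh : forall w : C, normc (w - 0) < 1 -> holo_at (herglotz phi) w.
  by move=> w; rewrite subr0; exact: holo_herglotz.
rewrite -[RHS](mean_value_Re dh r0 r1).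
by apply: eq_mean => t _; rewrite add0r herglotz_re.
Qed.

Lemma continuous_poisson phi z : aint phi -> normc z < 1 ->
  {for z, continuous (poisson phi)}.
Proof.
move=> ip z1; have := holo_continuous (holo_herglotz ip z1).
have -> : poisson phi = fun w => re (herglotz phi w).
  by apply/funext => w; rewrite herglotz_re.
by move=> c; exact: (@cvg_Re R C (nbhs z) _ (herglotz phi) (herglotz phi z) c).
Qed.

End herglotz.

(** * Subharmonic functions and the maximum principle *)

Section subharmonic.
Context {R : realType}.
Local Notation C := R[i].
Local Notation re := (@complex.Re R).
Local Notation im := (@complex.Im R).
Implicit Types (v : C -> R) (a z w : C).

(** An inequality for all small radii only: this local form is easy to check for
    |f|^s, and it is enough for the maximum principle. *)
Definition submean v a := exists2 rho : R, 0 < rho & forall r, 0 < r -> r < rho ->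
  v a <= mean (fun t => v (a + on_circle r t)).

Definition subharmonic v (R0 : R) := forall z, normc z < R0 ->
  {for z, continuous v} /\ submean v z.

Lemma compact_closed_disc (r : R) : compact [set z : C | normc z <= r].
Proof.
have cK : compact (@of_plane R @` (`[- r, r]%classic `*` `[- r, r]%classic)).
  apply: continuous_compact.
    by apply: continuous_subspaceT => p; exact: continuous_of_plane.
  by apply: compact_setX; exact: segment_compact.
apply: subclosed_compact cK _.
  by apply: (@closed_comp _ _ (@normc R : C -> R) [set x | x <= r]) => [z _|];
    [exact: continuous_normc|exact: closed_le].
move=> z /= zr; exists (re z, im z); last by case: z {zr}.
split; rewrite /= in_itv /= -ler_norml.
  exact: le_trans (Re_le_normc _) zr.
exact: le_trans (Im_le_normc _) zr.
Qed.

Lemma continuous_circle v a r : (forall t, {for (a + on_circle r t), continuous v}) ->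
  continuous (fun t : R => v (a + on_circle r t)).
Proof.
move=> cv t; apply: (@continuous_comp _ _ _ (fun t : R => a + on_circle r t) v); last exact: cv.
apply: (@ccvgD R _ (nbhs t) _ (fun=> a) (on_circle r)); first exact: cvg_cst.
exact: continuous_on_circle.
Qed.

(** The mean of |z|^2 exceeds its value at the center by exactly r^2: this makes
    |z|^2 a strictly subharmonic perturbation. *)
Lemma mean_normc_sqr a (r : R) : 0 < r ->
  mean (fun t => normc (a + on_circle r t) ^+ 2) = normc a ^+ 2 + r ^+ 2.
Proof.
move=> r0; pose l (w : C) := (a^*)%C * w.
have dl : forall w : C, normc (w - 0) < r + 1 -> holo_at l w.
  by move=> w _; exact: (@holoM R (fun=> (a^*)%C) (fun u : C => u) w (@holo_cst _ _ _) (@holo_id _ _)).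
have m0 := mean_value_Re dl r0 ltac:(by rewrite ltrDl).
have lc : continuous (fun t : R => l (0 + on_circle r t)).
  have -> : (fun t : R => l (0 + on_circle r t)) = (fun t : R => (a^*)%C * on_circle r t).
    by apply/funext => t; rewrite /l add0r.
  exact: (@continuous_mulC R (fun=> (a^*)%C) (on_circle r) (@continuous_cstC _ _) (@continuous_on_circle R r)).
have rlc : aint (fun t => re (l (0 + on_circle r t))).
  by apply: aint_cont => t; exact: (@cvg_Re R R (nbhs t) _ _ _ (lc t)).
have -> : (fun t => normc (a + on_circle r t) ^+ 2) =
   (fun t => 2 * re (l (0 + on_circle r t)) + (normc a ^+ 2 + r ^+ 2)).
  apply/funext => t; rewrite /l add0r -[X in _ = _ + (_ + X ^+ 2)](normc_on_circle t (ltW r0)).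
  rewrite !normc_sqr ReD ImD ReM; case: a {l dl m0 lc rlc} => a1 a2 /=.
  by ring.
rewrite meanD; [|exact: aintZ|exact: aint_cst].
by rewrite meanZ// m0 mean_cst /l mulr0 /= mulr0 add0r.
Qed.

(** Adding e |z|^2 makes the submean inequality strict, so that a maximum of
    the sum over a closed disc is attained on the boundary circle. *)
Lemma max_principle v (rho R0 c : R) : rho < R0 -> subharmonic v R0 ->
  (forall z, normc z = rho -> v z <= c) -> forall z, normc z <= rho -> v z <= c.
Proof.
move=> rR sv vc z0 z0r; apply/ler_addgt0Pr => e' e'0.
have rho0 : 0 <= rho by exact: le_trans (normc_ge0 _) z0r.
pose e := e' / (1 + rho ^+ 2).
have r1 : 0 < 1 + rho ^+ 2 by rewrite ltr_pwDl// sqr_ge0.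
have e0 : 0 < e by rewrite divr_gt0.
pose w z := v z + e * normc z ^+ 2.
have cw : forall z, normc z < R0 -> {for z, continuous w}.
  move=> z zR; have [cv _] := sv z zR.
  apply: (@cvgD R R C (nbhs z) _ v (fun z => e * normc z ^+ 2)); first exact: cv.
  apply: (@cvgM R C (nbhs z) _ (fun=> e)); first exact: cvg_cst.
  apply: (@cvgM R C (nbhs z) _ (@normc R) (@normc R)); exact: continuous_normc.
have [a /[!inE] /= ar wa] : exists2 a : C, a \in [set z : C | normc z <= rho] &
    forall t, t \in [set z : C | normc z <= rho] -> w t <= w a.
  apply: compact_EVT_max; [by exists z0|exact: compact_closed_disc|].
  apply: continuous_in_subspaceT => z; rewrite inE /= => zr; apply: cw.
  exact: le_lt_trans rR.
have vw z : v z <= w z by rewrite lerDl mulr_ge0 ?sqr_ge0 ?(ltW e0).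
have wz0 : v z0 <= w a by apply: le_trans (vw z0) (wa _ _); rewrite inE.
move: ar; rewrite le_eqVlt => /predU1P[ar|ar].
  apply: le_trans wz0 _; rewrite /w ar lerD ?vc//.
  by rewrite /e mulrAC ler_pdivrMr// ler_wpM2l ?(ltW e'0)// lerDr.
exfalso; have [ca [r0 r00 H]] := sv a (lt_trans ar rR).
pose r := Num.min (r0 / 2) ((rho - normc a) / 2).
have rp : 0 < r by rewrite lt_min !divr_gt0// subr_gt0.
have rr0 : r < r0 by rewrite gt_min ltr_pdivrMr// ltr_pMr// ltr1n.
have rra : r < rho - normc a.
  by rewrite gt_min [X in _ || X]ltr_pdivrMr// ltr_pMr ?subr_gt0// ltr1n orbT.
have inr t : normc (a + on_circle r t) <= rho.
  by have := normcD a (on_circle r t); rewrite normc_on_circle ?(ltW rp)//; lra.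
have := H r rp rr0; apply/negP; rewrite -ltNge.
have cvc : aint (fun t => v (a + on_circle r t)).
  apply: aint_cont; apply: continuous_circle => t.
  by have [] := sv _ (le_lt_trans (inr t) rR).
have cn : aint (fun t => normc (a + on_circle r t) ^+ 2).
  apply: aint_cont; apply: (@continuous_circle (fun z => normc z ^+ 2)) => t.
  apply: (@cvgM R C (nbhs (a + on_circle r t)) _ (@normc R) (@normc R)); exact: continuous_normc.
apply: (@le_lt_trans _ _ (mean (fun t => w a - e * normc (a + on_circle r t) ^+ 2))).
  apply: le_mean => //; first by apply: aintB; [exact: aint_cst|exact: aintZ].
  by move=> t _; rewrite lerBrDr; apply: (wa (a + on_circle r t)); rewrite inE; exact: inr.
rewrite meanB; [|exact: aint_cst|exact: aintZ].
rewrite mean_cst meanZ// mean_normc_sqr// /w mulrDr.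
by rewrite ltrBlDr ltrD2l ltrDl mulr_gt0// exprn_gt0.
Qed.

Lemma uniform_continuity v (K : set C) : compact K ->
  (forall z, K z -> {for z, continuous v}) ->
  forall e : R, 0 < e -> exists2 de : R, 0 < de & forall w z, K w ->
    normc (z - w) < de -> `|v w - v z| <= e.
Proof.
move=> /compact_near_coveringP cK cv e e0.
have : \forall d \near 0^'+, K `<=` (fun w => forall z, normc (z - w) < d -> `|v w - v z| <= e).
  apply: cK => w Kw; have e20 : 0 < e / 2 by rewrite divr_gt0.
  have /cvgrPdist_lt/(_ _ e20)/nbhs_C[de de0 H] := cv w Kw.
  have de20 : 0 < de / 2 by rewrite divr_gt0.
  exists ([set w' | normc (w' - w) < de / 2], [set d : R | d < de / 2]) => /=.
    split; first by apply/nbhs_C; exists (de / 2).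
    by apply: nbhs_right_lt.
  move=> [w' d] /= [ww' dd] z zw'.
  have H1 : `|v w - v w'| < e / 2 by apply: H; apply: lt_trans ww' _; rewrite ltr_pdivrMr// ltr_pMr// ltr1n.
  have H2 : `|v w - v z| < e / 2.
    apply: H; rewrite -(subrK w' z) -addrA (le_lt_trans (normcD _ _))//.
    by rewrite (splitr de) ltrD// (lt_trans zw').
  rewrite -(subrK (v w) (v w')) -addrA (le_trans (ler_normD _ _))// distrC.
  by rewrite (splitr e) lerD// ltW.
move=> [de /= de0 H]; exists (de / 2); first by rewrite divr_gt0.
move=> w z Kw zw; apply: (H (de / 2)) => //=; last by rewrite divr_gt0.
rewrite sub0r normrN ger0_norm ?divr_ge0 ?(ltW de0)//.
by rewrite ltr_pdivrMr// ltr_pMr// ltr1n.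
Qed.

(** Every point z of the disc close to the circle is within 2 B (1 - |z|^2) / d^2
    of an average of boundary values taken at distance less than d from z. *)
Lemma poisson_boundary v (R0 : R) : 1 < R0 ->
  (forall z, normc z < R0 -> {for z, continuous v}) ->
  forall e : R, 0 < e -> exists2 rho : R, rho < 1 & forall z,
    rho <= normc z -> normc z < 1 -> `|poisson (fun t => v (eitheta t)) z - v z| <= e.
Proof.
move=> R1 cv e e0; have e20 : 0 < e / 2 by rewrite divr_gt0.
have cvD z : normc z <= 1 -> {for z, continuous v}.
  by move=> z1; apply: cv; exact: le_lt_trans R1.
have cD := @compact_closed_disc 1.
have [d d0 H] := uniform_continuity cD cvD e20.
have n01 : normc (0 : C) <= 1 by rewrite normc0.
have [a /[!inE] /= a1 va] : exists2 a : C, a \in [set z : C | normc z <= 1] &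
    forall t, t \in [set z : C | normc z <= 1] -> `|v t| <= `|v a|.
  apply: (@compact_EVT_max _ _ (fun z => `|v z|)); [by exists 0; exact: n01|by []|].
  apply: continuous_in_subspaceT => z; rewrite inE /= => zr.
  by apply: (@cvg_norm _ _ _ (nbhs z)); exact: cvD.
set B := `|v a| in va; have B0 : 0 <= B by exact: normr_ge0.
have vB z : normc z <= 1 -> `|v z| <= B by move=> z1; apply: va; rewrite inE.
have ci : aint (fun t => v (eitheta t)).
  apply: aint_cont => t; apply: (@continuous_comp _ _ _ (@eitheta R) v).
    exact: continuous_eitheta.
  by apply: cvD; rewrite normc_eitheta.
have K0 : 0 < 2 * B / d ^+ 2 * 2 + 1.
  by rewrite ltr_pwDr// mulr_ge0// divr_ge0 ?sqr_ge0// mulr_ge0.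
exists (1 - e / 2 / (2 * B / d ^+ 2 * 2 + 1)).
  by rewrite ltrBlDr ltrDl divr_gt0.
move=> z rz z1.
rewrite -[X in _ - X](poisson_cst (v z) z1) -poissonB//; last exact: aint_cst.
pose k := 2 * B / d ^+ 2 * (1 - normc z ^+ 2).
have dom t : `|poisson_kernel z t * (v (eitheta t) - v z)| <=
    poisson_kernel z t * (e / 2) + k.
  have p0 := poisson_kernel_ge0 t z1.
  have n1 : 0 <= 1 - normc z ^+ 2 by rewrite subr_ge0 expr_le1 ?normc_ge0// ltW.
  have k0 : 0 <= k by rewrite mulr_ge0// divr_ge0 ?sqr_ge0// mulr_ge0.
  rewrite normrM (ger0_norm p0).
  have [dz|dz] := ltP (normc (eitheta t - z)) d.
    rewrite ler_wpDr// ler_wpM2l// distrC; apply: H => //=; exact: ltW.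
  apply: ler_wpDl; first by apply: mulr_ge0 => //; exact: ltW.
  have -> : k = (1 - normc z ^+ 2) / d ^+ 2 * (2 * B).
    by rewrite /k; move: (d ^+ 2)^-1 => m; ring.
  apply: ler_pM => //; last first.
    apply: le_trans (ler_normB _ _) _; rewrite mulr2n mulrDl mul1r.
    by rewrite lerD// vB ?normc_eitheta// ltW.
  rewrite /poisson_kernel ler_wpM2l// lef_pV2 ?posrE ?exprn_gt0//.
    by rewrite lerXn2r// nnegrE ?normc_ge0// ltW.
  by rewrite (lt_le_trans d0).
have aP : aint (fun t => poisson_kernel z t * (e / 2)) by apply: aint_poisson => //; exact: aint_cst.
apply: le_trans (norm_mean_le _) _.
  by apply: aint_poisson => //; apply: aintB => //; exact: aint_cst.
apply: (@le_trans _ _ (mean (fun t => poisson_kernel z t * (e / 2) + k))).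
  apply: le_mean => //.
    by apply: aint_norm; apply: aint_poisson => //; apply: aintB => //; exact: aint_cst.
  by apply: aintD => //; exact: aint_cst.
rewrite meanD//; last exact: aint_cst.
rewrite -[X in X + _]/(poisson (fun=> e / 2) z) poisson_cst// mean_cst.
rewrite [leRHS]splitr lerD2l /k.
have nz := normc_ge0 z.
move: rz; rewrite lerBlDr -lerBlDl => rz.
have {}rz : (1 - normc z) * (2 * B / d ^+ 2 * 2 + 1) <= e / 2.
  by rewrite -ler_pdivlMr// lerBlDr addrC -lerBlDr.
apply: le_trans rz; set K := 2 * B / d ^+ 2.
have K1 : 0 <= K by rewrite divr_ge0 ?sqr_ge0// mulr_ge0.
rewrite -subr_ge0; set x := normc z.
have -> : (1 - x) * (K * 2 + 1) - K * (1 - x ^+ 2) = (1 - x) * (K * (1 - x) + 1) by ring.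
have x1 : 0 <= 1 - x by rewrite subr_ge0 ltW.
by rewrite mulr_ge0// addr_ge0// mulr_ge0.
Qed.

Lemma poisson_submean_eq phi z r : aint phi -> 0 < r -> r < 1 - normc z ->
  mean (fun t => poisson phi (z + on_circle r t)) = poisson phi z.
Proof.
move=> ip r0 rz; rewrite -[RHS]herglotz_re.
have dh : forall w : C, normc (w - z) < 1 - normc z -> holo_at (herglotz phi) w.
  move=> w wz; apply: holo_herglotz => //.
  by have := normcD (w - z) z; rewrite subrK; lra.
rewrite -[RHS](mean_value_Re dh r0 rz).
by apply: eq_mean => t _; rewrite herglotz_re.
Qed.

(** The difference of v and of the Poisson integral of its boundary values is
    subharmonic and tends to 0 at the circle, so the maximum principle applies. *)
Theorem subharmonic_le_poisson v (R0 : R) : 1 < R0 -> subharmonic v R0 ->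
  forall z, normc z < 1 -> v z <= poisson (fun t => v (eitheta t)) z.
Proof.
move=> R1 sv z z1; rewrite -subr_le0; apply/ler_addgt0Pl => e e0; rewrite addr0.
have cv w : normc w < R0 -> {for w, continuous v} by move=> /sv[].
have ci : aint (fun t => v (eitheta t)).
  apply: aint_cont => t; apply: (@continuous_comp _ _ _ (@eitheta R) v).
    exact: continuous_eitheta.
  by apply: cv; rewrite normc_eitheta.
have [rho rho1 H] := poisson_boundary R1 cv e0.
pose u w := v w - poisson (fun t => v (eitheta t)) w.
have su : subharmonic u 1.
  move=> w w1; have [cvw [r0 r00 Hr]] := sv w (lt_trans w1 R1).
  split; first by apply: (@cvgB R R C (nbhs w) _ v _ _ _ cvw); exact: continuous_poisson.
  exists (Num.min r0 (1 - normc w)); first by rewrite lt_min r00 subr_gt0.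
  move=> r rp; rewrite lt_min => /andP[rr0 rw].
  rewrite /u meanB.
  - by rewrite poisson_submean_eq// lerD2r Hr.
  - apply: aint_cont; apply: continuous_circle => t; apply: cv; apply: lt_trans R1.
    by have := normcD w (on_circle r t); rewrite normc_on_circle ?(ltW rp)//; lra.
  - apply: aint_cont; apply: continuous_circle => t; apply: continuous_poisson => //.
    by have := normcD w (on_circle r t); rewrite normc_on_circle ?(ltW rp)//; lra.
apply: (@max_principle u (Num.max rho (normc z)) 1) => //.
- by rewrite gt_max rho1.
- move=> w wm; apply: le_trans (ler_norm _) _; rewrite distrC; apply: H.
    by rewrite wm le_max lexx.
  by rewrite wm gt_max rho1.
- by rewrite le_max lexx orbT.
Qed.

Lemma on_circleM (r s t : R) : (r%:C)%C * on_circle s t = on_circle (r * s) t.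
Proof. by rewrite /on_circle mulrA -rmorphM. Qed.

(** Dilations reduce functions on the open disc to functions that are
    subharmonic beyond the closed disc. *)
Lemma subharmonic_dilate v r : 0 < r -> subharmonic v 1 ->
  subharmonic (fun z => v ((r%:C)%C * z)) r^-1.
Proof.
move=> r0 sv z zr; have rz : normc ((r%:C)%C * z) < 1.
  by rewrite normcM normc_real gtr0_norm// mulrC -ltr_pdivlMr// mul1r.
have [cv [rho rho0 H]] := sv _ rz; split.
  apply: (@continuous_comp _ _ _ (fun z : C => (r%:C)%C * z) v) => //.
  apply: (@ccvgM R _ (nbhs z) _ (fun=> (r%:C)%C) (fun z => z)); [exact: cvg_cst|exact: cvg_id].
exists (rho / r); first by rewrite divr_gt0.
move=> s s0 sr; have -> : (fun t => v ((r%:C)%C * (z + on_circle s t))) =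
    (fun t => v ((r%:C)%C * z + on_circle (r * s) t)).
  by apply/funext => t; rewrite mulrDr on_circleM.
by apply: H; [rewrite mulr_gt0|rewrite mulrC -ltr_pdivlMr].
Qed.

Lemma subharmonic_le_poisson_dilate v r z : subharmonic v 1 -> 0 < r -> r < 1 ->
  normc z < 1 -> v ((r%:C)%C * z) <= poisson (fun t => v (on_circle r t)) z.
Proof.
move=> sv r0 r1 z1.
have := subharmonic_le_poisson _ (subharmonic_dilate r0 sv) z1.
by rewrite invf_gt1// => /(_ r1).
Qed.

End subharmonic.

(** * Subharmonicity of powers of the modulus *)

Section subharmonic_holomorphic.
Context {R : realType}.
Local Notation C := R[i].
Local Notation re := (@complex.Re R).
Local Notation im := (@complex.Im R).
Variable f : C -> C.
Hypothesis hf : forall z : C, normc z < 1 -> holo_at f z.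

Let hfa (a : C) : normc a < 1 -> forall z : C, normc (z - a) < 1 - normc a -> holo_at f z.
Proof.
move=> a1 z za; apply: hf.
by have := normcD (z - a) a; rewrite subrK; lra.
Qed.

(** For c = 1 and c = -1 this says that the real part is harmonic. *)
Lemma subharmonic_Re (c : R) : subharmonic (fun z => c * re (f z)) 1.
Proof.
move=> a a1; have fa := holo_continuous (hf a1); split.
  apply: (@cvgM R C (nbhs a) _ (fun=> c) (fun z => re (f z))); first exact: cvg_cst.
  exact: (@cvg_Re R C (nbhs a) _ f (f a) fa).
exists (1 - normc a); first by rewrite subr_gt0.
move=> r r0 rr; rewrite meanZ; first by rewrite (mean_value_Re (hfa a1) r0 rr).
apply: aint_cont => t.
apply: (@cvg_Re R R (nbhs t) _ (fun t => f (a + on_circle r t)) (f (a + on_circle r t))).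
apply: (@continuous_comp _ _ _ (fun t : R => a + on_circle r t) f).
  apply: (@ccvgD R _ (nbhs t) _ (fun=> a) (on_circle r)); first exact: cvg_cst.
  exact: continuous_on_circle.
apply: holo_continuous; apply: (hfa a1).
by rewrite addrC addKr normc_on_circle// ltW.
Qed.

Lemma subharmonic_Im (c : R) : subharmonic (fun z => c * im (f z)) 1.
Proof.
move=> a a1; have fa := holo_continuous (hf a1); split.
  apply: (@cvgM R C (nbhs a) _ (fun=> c) (fun z => im (f z))); first exact: cvg_cst.
  exact: (@cvg_Im R C (nbhs a) _ f (f a) fa).
exists (1 - normc a); first by rewrite subr_gt0.
move=> r r0 rr; rewrite meanZ; first by rewrite (mean_value_Im (hfa a1) r0 rr).
apply: aint_cont => t.
apply: (@cvg_Im R R (nbhs t) _ (fun t => f (a + on_circle r t)) (f (a + on_circle r t))).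
apply: (@continuous_comp _ _ _ (fun t : R => a + on_circle r t) f).
  apply: (@ccvgD R _ (nbhs t) _ (fun=> a) (on_circle r)); first exact: cvg_cst.
  exact: continuous_on_circle.
apply: holo_continuous; apply: (hfa a1).
by rewrite addrC addKr normc_on_circle// ltW.
Qed.

Lemma continuous_norm_powR (s : R) : 0 < s -> continuous (fun y : R => `|y| `^ s).
Proof.
move=> s0 x; have [->|x0] := eqVneq x 0.
  apply/cvgrPdist_le => e e0; rewrite normr0 powR0 ?gt_eqF//.
  have d0 : 0 < e `^ s^-1 by rewrite powR_gt0.
  near=> y; rewrite sub0r normrN ger0_norm ?powR_ge0//.
  have -> : e = (e `^ s^-1) `^ s by rewrite -powRrM mulVf ?gt_eqF// powRr1// ltW.
  have yd : `|0 - y| < e `^ s^-1.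
    by near: y; exact: (@cvgr_dist_lt _ _ _ (nbhs (0 : R)) _ id 0 (@cvg_id _ _)).
  apply: (@ge0_ler_powR R s (ltW s0)); rewrite ?nnegrE ?(ltW d0) ?normr_ge0//.
have lx : expR (s * ln `|y|) @[y --> x] --> expR (s * ln `|x|).
  apply: (@continuous_comp _ _ _ (fun y : R => s * ln `|y|) (@expR R)); last exact: continuous_expR.
  apply: (@cvgM R R (nbhs x) _ (fun=> s)); first exact: cvg_cst.
  apply: (@continuous_comp _ _ _ (fun y : R => `|y|) (@ln R)); first exact: norm_continuous.
  by apply: continuous_ln; rewrite normr_gt0.
have E (y : R) : y != 0 -> `|y| `^ s = expR (s * ln `|y|).
  by rewrite -normr_eq0 => y0; rewrite /powR (negbTE y0).
rewrite /continuous_at E//; apply: cvg_trans lx; apply: near_eq_cvg; near=> y.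
apply/esym/E; near: y.
exact: (@cvgr_neq0 R R R (nbhs x) _ id x (@cvg_id _ _) x0).
Unshelve. all: by end_near. Qed.

(** At a zero of f there is nothing to prove.  Elsewhere f / f a has a logarithm
    L near a, |f / f a|^s = e^(s Re L) >= 1 + s Re L, and Re L has mean 0. *)
Lemma subharmonic_norm_powR (s : R) : 0 < s ->
  subharmonic (fun z => normc (f z) `^ s) 1.
Proof.
move=> s0 a a1.
have cont z : normc z < 1 -> {for z, continuous (fun z => normc (f z) `^ s)}.
  move=> z1; have -> : (fun z => normc (f z) `^ s) = (fun z => `|normc (f z)| `^ s).
    by apply/funext => w; rewrite ger0_norm ?normc_ge0.
  apply: (@continuous_comp _ _ _ (fun z => normc (f z)) (fun y : R => `|y| `^ s)); last exact: continuous_norm_powR.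
  exact: (@cvg_normc R C (nbhs z) _ f (f z) (holo_continuous (hf z1))).
split; first exact: cont.
have [fa0|fa0] := eqVneq (f a) 0.
  exists 1 => // r _ _; rewrite fa0 normc0 powR0 ?gt_eqF//.
  by apply: mean_ge0 => t _; exact: powR_ge0.
pose g (z : C) := (f a)^-1 * f z.
have hg z : normc z < 1 -> holo_at g z.
  by move=> z1; exact: (@holoM R (fun=> (f a)^-1) f z (@holo_cst _ _ _) (hf z1)).
have ga : g a = 1 by rewrite /g mulVf.
have /cvg_CP/(_ 1 ltr01)/nbhs_C[d d0 H] := holo_continuous (hg _ a1).
pose rho := Num.min d (1 - normc a).
have rho0 : 0 < rho by rewrite lt_min d0 subr_gt0.
have in1 z : normc (z - a) < rho -> normc z < 1.
  rewrite lt_min => /andP[_ za].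
  by have := normcD (z - a) a; rewrite subrK; lra.
have Reg z : normc (z - a) < rho -> 0 < re (g z).
  rewrite lt_min => /andP[/H + _]; rewrite ga => gz.
  have := le_lt_trans (Re_le_normc _) gz; rewrite ReB /= ltr_norml; lra.
have hL z : normc (z - a) < rho -> holo_at (clog \o g) z.
  move=> za; apply: holo_comp; first by apply: hg; exact: in1.
  by apply: holo_clog; exact: Reg.
exists rho => // r r0 rr.
have ina t : normc (a + on_circle r t - a) < rho.
  by rewrite addrC addKr normc_on_circle// ltW.
have circ (h : C -> C) : (forall z, normc (z - a) < rho -> holo_at h z) ->
    aint (fun t => re (h (a + on_circle r t))).
  move=> hh; apply: aint_cont; apply: (@continuous_circle _ (fun z => re (h z))) => t.
  exact: (@cvg_Re R C (nbhs (a + on_circle r t)) _ h _ (holo_continuous (hh _ (ina t)))).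
have ml := mean_value_Re hL r0 rr.
have E z : normc (f z) = normc (f a) * normc (g z).
  by rewrite -normcM /g mulVKf.
have iL := circ _ hL.
have : mean (fun t => normc (f a) `^ s + (normc (f a) `^ s * s) * re ((clog \o g) (a + on_circle r t))) =
    normc (f a) `^ s.
  rewrite meanD; [|exact: aint_cst|exact: aintZ].
  rewrite mean_cst meanZ// ml /= -/(normc _) ga.
  by rewrite -[X in ln X]/(normc (1 : C)) normc1 ln1 mulr0 addr0.
move=> <-; apply: le_mean.
- by apply: aintD; [exact: aint_cst|exact: aintZ].
- apply: aint_cont; apply: (@continuous_circle _ (fun z => normc (f z) `^ s)) => t.
  by apply: cont; exact: in1.
move=> t _; rewrite (E (a + on_circle r t)) powRM ?normc_ge0// -mulrA -[X in X + _ <= _]mulr1 -mulrDr.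
rewrite ler_wpM2l ?powR_ge0//.
have gt0 : normc (g (a + on_circle r t)) != 0.
  rewrite normc_eq0; apply: contraTneq (Reg _ (ina t)) => ->.
  by rewrite ltxx.
rewrite -[re _]/(ln (normc (g (a + on_circle r t)))) /powR (negbTE gt0).
exact: expR_ge1Dx.
Qed.

End subharmonic_holomorphic.

(** * Almost everywhere convergence on the circle *)

Section convergence_on_circle.
Context {R : realType}.
Local Notation mu := (@lebesgue_measure R).
Implicit Types (f g h phi : R -> R).

Let mA : measurable (@angles R : set (measurableTypeR R)).
Proof. by rewrite /angles. Qed.

Lemma integral_aint f : aint f ->
  (\int[mu]_(t in @angles R) (f t)%:E)%E = (2 * pi * mean f)%:E.
Proof.
move=> fi; rewrite /mean mulVKf ?gt_eqF ?twopi_gt0// /itv_int /Rintegral fineK//.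
exact: integrable_fin_num.
Qed.

Lemma aint_ge0_lty f : measurable_fun (@angles R) f -> (forall t, angles t -> 0 <= f t) ->
  (\int[mu]_(t in @angles R) (f t)%:E < +oo)%E -> aint f.
Proof.
move=> mf f0 foo; apply/integrableP; split; first exact/measurable_EFinP.
by under eq_integral => t /[!inE] tA do rewrite /= ger0_norm ?f0//.
Qed.

Lemma limn_einf_le (u : nat -> \bar R) (M : \bar R) : (forall n, (u n <= M)%E) ->
  (limn_einf u <= M)%E.
Proof.
move=> uM; rewrite limn_einf_lim; apply: lime_le; first exact: is_cvg_einfs.
apply: nearW => n; apply: le_trans (uM n); apply: ereal_inf_lbound.
by exists n => //=.
Qed.

(** Fatou's lemma on the complement of the exceptional null set. *)
Lemma fatou_bound (h : nat -> R -> R) g (M : \bar R) :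
  (forall n, measurable_fun (@angles R) (h n)) -> (forall n t, angles t -> 0 <= h n t) ->
  measurable_fun (@angles R) g -> (forall t, angles t -> 0 <= g t) ->
  {ae mu, forall t, angles t -> h n t @[n --> \oo] --> g t} ->
  (forall n, (\int[mu]_(t in @angles R) (h n t)%:E <= M)%E) ->
  (\int[mu]_(t in @angles R) (g t)%:E <= M)%E.
Proof.
move=> mh h0 mg g0 hg hM.
case: hg => N [mN N0 hN].
have mD : measurable (@angles R `\` N : set (measurableTypeR R)) by exact: measurableD.
have sub : @angles R `\` N `<=` @angles R by move=> t [].
have mgE : measurable_fun (@angles R : set (measurableTypeR R)) (fun t => (g t)%:E).
  exact/measurable_EFinP.
have mhE n : measurable_fun (@angles R : set (measurableTypeR R)) (fun t => (h n t)%:E).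
  by apply/measurable_EFinP; exact: mh.
have g0E t : angles t -> (0 <= (g t)%:E)%E by move=> tA; rewrite lee_fin g0.
have h0E n t : (@angles R `\` N) t -> (0 <= (h n t)%:E)%E.
  by move=> [tA _]; rewrite lee_fin h0.
rewrite (@ge0_negligible_integral _ _ _ mu _ N)//.
have F := @fatou _ _ _ mu _ mD (fun n t => (h n t)%:E)
  (fun n => measurable_funS mA sub (mhE n)) h0E.
have hM' n : (\int[mu]_(t in @angles R `\` N) (h n t)%:E <= M)%E.
  apply: le_trans (hM n); apply: ge0_subset_integral => //.
  by move=> t tA; rewrite lee_fin h0.
apply: le_trans (limn_einf_le hM').
apply: le_trans F; rewrite le_eqVlt; apply/orP; left; apply/eqP.
apply: eq_integral => t; rewrite inE => -[tA tN].
have ht : h n t @[n --> \oo] --> g t.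
  by apply: contrapT => nht; apply: tN; apply: hN => /(_ tA).
have : (h n t)%:E @[n --> \oo] --> (g t)%:E.
  by apply: cvg_EFin => //; exact: nearW.
by move=> /cvg_limn_einf_sup[-> _].
Qed.

(** A sequence that is Cauchy in L^1 at a geometric rate converges almost
    everywhere, dominated by the integrable sum of its increments. *)
Lemma fast_L1_limit (f : nat -> R -> R) (c : R) : (forall n, aint (f n)) ->
  (forall n, mean (fun t => `|f n.+1 t - f n t|) <= c / 2 ^+ n) ->
  exists phi (G : R -> \bar R), [/\ measurable_fun (@angles R) phi,
    mu.-integrable (@angles R) G,
    (forall n t, angles t -> (`|f n t|%:E <= G t)%E) &
    {ae mu, forall t, angles t -> f n t @[n --> \oo] --> phi t}].
Proof.
move=> fi fc.
pose D n t := `|f n.+1 t - f n t|.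
have Di n : aint (D n) by apply: aint_norm; exact: aintB.
have D0 n t : 0 <= D n t by exact: normr_ge0.
have mDE n : measurable_fun (@angles R : set (measurableTypeR R)) (fun t => (D n t)%:E).
  by apply/measurable_EFinP; exact: aint_measurable.
pose S t := (\sum_(0 <= n <oo) (D n t)%:E)%E.
have S0 t : (0 <= S t)%E by apply: nneseries_ge0 => n _ _; rewrite lee_fin.
have mS : measurable_fun (@angles R : set (measurableTypeR R)) S.
  by apply: (@ge0_emeasurable_sum _ _ _ (@angles R) (fun n t => (D n t)%:E) xpredT); [move=> n t _ _; rewrite lee_fin|move=> n _; exact: mDE].
have IS : (\int[mu]_(t in @angles R) S t < +oo)%E.
  rewrite integral_nneseries//; last by move=> n t _; rewrite lee_fin.
  apply: (@le_lt_trans _ _ (2 * pi * (2 * `|c|))%:E); last by rewrite ltry.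
  apply: lime_le.
    by apply: is_cvg_nneseries => n _ _; apply: integral_ge0 => t _; rewrite lee_fin.
  apply: nearW => n; rewrite big_mkord.
  under eq_bigr do rewrite integral_aint//.
  rewrite sumEFin lee_fin -mulr_sumr ler_wpM2l ?(ltW twopi_gt0)//.
  apply: (@le_trans _ _ (2 * `|c| * (1 - (2 ^+ n)^-1))); last first.
    by rewrite ler_piMr ?mulr_ge0// gerBl invr_ge0 exprn_ge0.
  elim: n => [|n IH]; first by rewrite big_ord0 expr0 invr1 subrr mulr0.
  rewrite big_ord_recr /=; apply: le_trans (lerD IH (fc n)) _.
  have c2 : c / 2 ^+ n <= `|c| / 2 ^+ n.
    by rewrite ler_wpM2r ?invr_ge0 ?exprn_ge0// ler_norm.
  apply: le_trans (lerD (lexx _) c2) _; rewrite exprS invfM.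
  by move: (2 ^+ n)^-1 => x; lra.
pose G t := (`|f 0%N t|%:E + S t)%E.
have Gi : mu.-integrable (@angles R) G.
  apply: integrableD => //; first exact: (aint_norm (fi 0%N)).
  apply/integrableP; split => //.
  by under eq_integral do rewrite gee0_abs//.
have le n t : `|f n t| <= `|f 0%N t| + \sum_(0 <= i < n) D i t.
  elim: n => [|n IH]; first by rewrite big_nil addr0.
  rewrite big_nat_recr//= addrA -(subrK (f n t) (f n.+1 t)) addrC.
  by rewrite (le_trans (ler_normD _ _))// lerD.
have leG n t : (`|f n t|%:E <= G t)%E.
  apply: (@le_trans _ _ (`|f 0%N t| + \sum_(0 <= i < n) D i t)%:E); first by rewrite lee_fin.
  rewrite EFinD leeD2l// -sumEFin; apply: nneseries_lim_ge => i _ _.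
  by rewrite lee_fin.
exists (fun t => fine (limn_esup (fun n => (f n t)%:E))), G; split => //.
- apply: (@measurableT_comp _ _ _ _ _ _ fine) => //.
  apply: measurable_fun_limn_esup => n; apply/measurable_EFinP.
  exact: aint_measurable.
- have := integrable_ae mA Gi; apply: filterS => t Gt tA.
  have {Gt}Gfin := Gt tA.
  have Sfin : S t \is a fin_num.
    rewrite ge0_fin_numE//; apply: le_lt_trans (_ : (G t < +oo)%E).
      by rewrite leeDr// lee_fin.
    by rewrite -ge0_fin_numE// adde_ge0// lee_fin.
  have cs : cvgn [normed series (telescope (f ^~ t))].
    apply: nondecreasing_is_cvgn.
      by apply: nondecreasing_series => i _ _; exact: normr_ge0.
    exists (fine (S t)) => _ [n _ <-]; rewrite -lee_fin fineK// /series /= -sumEFin.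
    by apply: nneseries_lim_ge => i _ _; rewrite lee_fin.
  have /cvg_ex[l fl] : cvgn (f ^~ t).
    have /cvg_ex[l sl] := normed_cvg cs.
    apply/cvg_ex; exists (f 0%N t + l).
    have -> : f ^~ t = (fun n => f 0%N t + series (telescope (f ^~ t)) n).
      by apply/funext => n; rewrite -(eq_sum_telescope (f ^~ t)).
    by apply: cvgD => //; exact: cvg_cst.
  have : (f n t)%:E @[n --> \oo] --> l%:E.
    by apply: cvg_EFin => //; exact: nearW.
  by move=> /cvg_limn_einf_sup[_ ->].
Qed.

End convergence_on_circle.

(** * Weak limits in the space of square integrable functions *)

Section almost_everywhere.
Context {R : realType}.
Local Notation mu := (@lebesgue_measure R).

Lemma ae_imp (P Q : R -> Prop) : (forall t, P t -> Q t) ->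
  {ae mu, forall t, P t} -> {ae mu, forall t, Q t}.
Proof.
move=> PQ [N [mN N0 sub]]; exists N; split=> // t nQ.
by apply: sub => Pt; apply: nQ; exact: PQ.
Qed.

Lemma ae_and (P Q : R -> Prop) : {ae mu, forall t, P t} -> {ae mu, forall t, Q t} ->
  {ae mu, forall t, P t /\ Q t}.
Proof.
move=> [N [mN N0 sub]] [N' [mN' N0' sub']]; exists (N `|` N'); split.
- exact: measurableU.
- exact: null_set_setU.
- move=> t nPQ; have [Pt|nP] := pselect (P t); last by left; exact: sub.
  by right; apply: sub' => Qt; apply: nPQ.
Qed.

End almost_everywhere.

Section weak_limit.
Context {R : realType}.
Local Notation mu := (@lebesgue_measure R).

Let mA : measurable (@angles R : set (measurableTypeR R)).
Proof. by rewrite /angles. Qed.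

Implicit Types f h : R -> R.
Variables (g : nat -> R -> R) (M : R).
Hypothesis gi : forall k, aint (g k).
Hypothesis g2 : forall k, aint (fun t => g k t ^+ 2).
Hypothesis gM : forall k, mean (fun t => g k t ^+ 2) <= M.

(** Midpoints alone generate enough convex combinations: the parallelogram
    identity compares two elements with their midpoint. *)
Inductive hull (k : nat) : (R -> R) -> Prop :=
| hull_base j : (k <= j)%N -> hull k (g j)
| hull_mid f h : hull k f -> hull k h -> hull k (fun t => (f t + h t) / 2).

Let N (f : R -> R) := mean (fun t => f t ^+ 2).

Lemma hullS k l f : (k <= l)%N -> hull l f -> hull k f.
Proof.
by move=> kl; elim=> [j lj|f1 f2 _ h1 _ h2]; [apply: hull_base; exact: leq_trans lj|exact: hull_mid].
Qed.

Let mid_sqr (x y : R) : ((x + y) / 2) ^+ 2 = 2^-1 * (x ^+ 2 + y ^+ 2) - 4^-1 * (x - y) ^+ 2.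
Proof. by field. Qed.

Let aint_sqr_half f h : aint (fun t => f t ^+ 2) -> aint (fun t => h t ^+ 2) ->
  aint (fun t => 2^-1 * (f t ^+ 2 + h t ^+ 2)).
Proof. by move=> f2 h2; apply: aintZ; exact: aintD. Qed.

Let aint_mid_sqr f h : aint f -> aint h -> aint (fun t => f t ^+ 2) -> aint (fun t => h t ^+ 2) ->
  aint (fun t => ((f t + h t) / 2) ^+ 2).
Proof.
move=> fi hi f2 h2; apply: (aint_le _ _ (aint_sqr_half f2 h2)).
  apply: measurable_funX; apply: measurable_funM => //.
  by apply: measurable_funD; exact: aint_measurable.
move=> t _; rewrite ger0_norm ?sqr_ge0// mid_sqr gerBl.
by rewrite mulr_ge0// sqr_ge0.
Qed.

Lemma hull_L2 k f : hull k f -> [/\ aint f, aint (fun t => f t ^+ 2) & N f <= M].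
Proof.
elim=> [j _|f1 f2 _ [i1 s1 m1] _ [i2 s2 m2]].
  by split; [exact: gi|exact: g2|exact: gM].
have s := aint_mid_sqr i1 i2 s1 s2.
split => //.
  have := aintZ 2^-1 (aintD i1 i2); congr aint.
  by apply/funext => t; rewrite mulrC.
apply: (@le_trans _ _ (2^-1 * (N f1 + N f2))); last by rewrite /N in m1 m2 *; lra.
rewrite /N -meanD// -meanZ; last exact: aintD.
apply: le_mean => //; first exact: aint_sqr_half.
by move=> t _; rewrite mid_sqr gerBl mulr_ge0// sqr_ge0.
Qed.

Let aintB_sqr f h : aint f -> aint h -> aint (fun t => f t ^+ 2) -> aint (fun t => h t ^+ 2) ->
  aint (fun t => (f t - h t) ^+ 2).
Proof.
move=> fi hi f2 h2; have m := aint_mid_sqr fi hi f2 h2.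
have := aintB (aintZ 2 (aintD f2 h2)) (aintZ 4 m).
by congr aint; apply/funext => t; field.
Qed.

Let parallelogram f h : aint f -> aint h -> aint (fun t => f t ^+ 2) -> aint (fun t => h t ^+ 2) ->
  N (fun t => f t - h t) = 2 * (N f + N h) - 4 * N (fun t => (f t + h t) / 2).
Proof.
move=> fi hi f2 h2; have m := aint_mid_sqr fi hi f2 h2.
rewrite /N -meanD// -!meanZ//; last exact: aintD.
rewrite -meanB; [|by apply: aintZ; exact: aintD|exact: aintZ].
by apply: eq_mean => t _; field.
Qed.

Let d k := inf [set N f | f in hull k].

Let hull_has_inf k : has_inf [set N f | f in hull k].
Proof.
split; first by exists (N (g k)); exists (g k) => //; exact: hull_base.
by exists 0 => _ [f _ <-]; apply: mean_ge0 => t _; exact: sqr_ge0.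
Qed.

Let d_le k f : hull k f -> d k <= N f.
Proof. by move=> kf; apply: ge_inf; [exact: (hull_has_inf k).2|exists f]. Qed.

Let d_mono k l : (k <= l)%N -> d k <= d l.
Proof.
move=> kl; apply: lb_le_inf; first exact: (hull_has_inf l).1.
by move=> _ [f lf <-]; apply: d_le; exact: hullS lf.
Qed.

Let dM k : d k <= M.
Proof. by apply: le_trans (gM k); apply: d_le; exact: hull_base. Qed.

Let S := sup (range d).

Let d_has_sup : has_sup (range d).
Proof. by split; [exists (d 0%N), 0%N|exists M => _ [k _ <-]; exact: dM]. Qed.

Let dS k : d k <= S.
Proof. by apply: ub_le_sup; [exact: d_has_sup.2|exists k]. Qed.

(* The rate 4^-n in the square mean yields the summable rate 2^-n in the mean. *)
Let eps n : R := 4^-1 / 4 ^+ n.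

Let eps_gt0 n : 0 < eps n.
Proof. by rewrite divr_gt0// exprn_gt0. Qed.

Let eps_dec n m : (n <= m)%N -> eps m <= eps n.
Proof.
move=> nm; rewrite ler_wpM2l// lef_pV2 ?posrE ?exprn_gt0//.
by rewrite ler_eXn2l// ltr1n.
Qed.

Let near_min n : exists kf : nat * (R -> R), [/\ (n <= kf.1)%N, hull kf.1 kf.2,
  S - eps n < d kf.1 & N kf.2 < S + eps n].
Proof.
have [_ [k0 _ <-] k0S] := sup_adherent (eps_gt0 n) d_has_sup.
pose k := maxn n k0.
have [_ [f kf <-] fd] := inf_adherent (eps_gt0 n) (hull_has_inf k).
exists (k, f); split => //=; first exact: leq_maxl.
  by apply: lt_le_trans k0S _; apply: d_mono; exact: leq_maxr.
by apply: lt_le_trans fd _; rewrite lerD2r; exact: dS.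
Qed.

(** Mazur's argument in L^2: almost minimal elements of the hulls of the tails
    form a Cauchy sequence by the parallelogram identity, and their limit
    inherits the one-sided bounds of the tails. *)
Lemma L2_weak_limit : exists phi : R -> R,
  [/\ aint phi, aint (fun t => phi t ^+ 2), mean (fun t => phi t ^+ 2) <= M &
   forall (kappa : R -> R) (B c : R) (K : nat), continuous kappa ->
    (forall t, `|kappa t| <= B) ->
    (forall k, (K <= k)%N -> c <= mean (fun t => kappa t * g k t)) ->
    c <= mean (fun t => kappa t * phi t)].
Proof.
have [F FP] := choice near_min.
pose f n := (F n).2.
have fL n : [/\ aint (f n), aint (fun t => f n t ^+ 2) & N (f n) <= M].
  by case: (FP n) => _ /hull_L2.
have fi n : aint (f n) by case: (fL n).
have f2 n : aint (fun t => f n t ^+ 2) by case: (fL n).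
have mono n : N (fun t => f n.+1 t - f n t) <= 8 * eps n.
  have [k1 h1 d1 n1] := FP n; have [k2 h2 d2 n2] := FP n.+1.
  have e12 : eps n.+1 <= eps n by exact: eps_dec.
  rewrite parallelogram//.
  pose k := minn (F n).1 (F n.+1).1.
  have hk : hull k (fun t => (f n.+1 t + f n t) / 2).
    by apply: hull_mid; [apply: hullS h2; exact: geq_minr|apply: hullS h1; exact: geq_minl].
  have dk : S - eps n < d k.
    rewrite /k /minn; case: ifPn => _ //; apply: le_lt_trans d2.
    by rewrite lerD2l lerN2.
  have := d_le hk; rewrite /f in n1 n2 *; lra.
(* From the square mean to the mean by |x| <= l + x^2 / l with l = 2^-n. *)
have inc n : mean (fun t => `|f n.+1 t - f n t|) <= 3 / 2 ^+ n.
  pose l : R := (2 ^+ n)^-1; have l0 : 0 < l by rewrite invr_gt0 exprn_gt0.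
  have i1 := aintB (fi n.+1) (fi n); have i2 := aintB_sqr (fi n.+1) (fi n) (f2 n.+1) (f2 n).
  apply: (@le_trans _ _ (mean (fun t => l + l^-1 * (f n.+1 t - f n t) ^+ 2))).
    apply: le_mean; first exact: aint_norm.
      by apply: aintD; [exact: aint_cst|exact: aintZ].
    move=> t _; set x := f n.+1 t - f n t; rewrite -[x ^+ 2]real_normK ?num_real//.
    set y := `|x|; have y0 : 0 <= y by exact: normr_ge0.
    rewrite -(ler_pM2l l0) mulrDr mulVKf ?gt_eqF//.
    by have := sqr_ge0 (l - y); have := mulr_ge0 (ltW l0) y0; rewrite !expr2; lra.
  rewrite meanD; [|exact: aint_cst|exact: aintZ].
  rewrite mean_cst meanZ//.
  have : l^-1 * N (fun t => f n.+1 t - f n t) <= l^-1 * (8 * eps n).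
    by rewrite ler_pM2l ?invr_gt0.
  rewrite /N => /(lerD (lexx l)) /le_trans; apply.
  rewrite /eps /l invrK; have -> : (4 : R) ^+ n = 2 ^+ n * 2 ^+ n.
    by rewrite -exprMn; congr (_ ^+ n); rewrite -natrM.
  rewrite le_eqVlt; apply/orP; left; apply/eqP; field; by rewrite expf_neq0.
have [phi [G [mphi Gi fG fphi]]] := fast_L1_limit fi inc.
have phi2 : (\int[mu]_(t in @angles R) (phi t ^+ 2)%:E <= (2 * pi * M)%:E)%E.
  apply: (@fatou_bound _ (fun n t => f n t ^+ 2)).
  - by move=> n; exact: aint_measurable.
  - by move=> n t _; exact: sqr_ge0.
  - exact: measurable_funX.
  - by move=> t _; exact: sqr_ge0.
  - by move: fphi; apply: ae_imp => t ht tA; apply: cvgM; exact: ht.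
  - move=> n; rewrite integral_aint// lee_fin ler_wpM2l ?(ltW twopi_gt0)//.
    by case: (fL n).
have iphi2 : aint (fun t => phi t ^+ 2).
  apply: aint_ge0_lty; first exact: measurable_funX.
    by move=> t _; exact: sqr_ge0.
  exact: le_lt_trans phi2 (ltry _).
have DC (kappa : R -> R) (B : R) : continuous kappa -> (forall t, `|kappa t| <= B) ->
    aint (fun t => kappa t * phi t) /\
    mean (fun t => kappa t * f n t) @[n --> \oo] --> mean (fun t => kappa t * phi t).
  move=> ck kB.
  have B0 : 0 <= B by exact: le_trans (normr_ge0 _) (kB 0).
  have mk : measurable_fun (@angles R) kappa.
    by apply: measurable_funTS; exact: continuous_measurable_fun.
  have ki n := aintM ck kB (fi n).
  have := @dominated_convergence _ _ _ mu _ mA (fun n t => (kappa t * f n t)%:E)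
    (fun t => (kappa t * phi t)%:E) (fun t => (B%:E * G t)%E).
  case.
  - by move=> n; apply/measurable_EFinP; exact: aint_measurable.
  - by apply/measurable_EFinP; exact: measurable_funM.
  - move: fphi; apply: ae_imp => t ht tA; apply: cvg_EFin; first exact: nearW.
    by apply: cvgM; [exact: cvg_cst|exact: ht].
  - exact: integrableZl.
  - apply: aeW => t n tA; rewrite abse_EFin normrM EFinM.
    by apply: lee_pmul => //; [rewrite lee_fin|exact: fG].
  move=> i1 _ i2; split => //.
  rewrite /mean; apply: cvgM; first exact: cvg_cst.
  rewrite /itv_int /Rintegral; apply: fine_cvg.
  by rewrite fineK//; exact: integrable_fin_num.
have iphi : aint phi.
  have [] := DC (fun=> 1) 1 (fun t => cvg_cst _) (fun t => ltac:(by rewrite normr1)).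
  by move=> + _; congr aint; apply/funext => t; rewrite mul1r.
exists phi; split => //.
  rewrite -(ler_pM2l twopi_gt0) -lee_fin -integral_aint//.
move=> kappa B c K ck kB cK.
have hc k h : (K <= k)%N -> hull k h -> c <= mean (fun t => kappa t * h t).
  move=> Kk; elim=> [j kj|f1 h1 hf1 c1 hh1 c2]; first by apply: cK; exact: leq_trans kj.
  have [a1 _ _] := hull_L2 hf1; have [a2 _ _] := hull_L2 hh1.
  have -> : (fun t => kappa t * ((f1 t + h1 t) / 2)) =
     (fun t => 2^-1 * (kappa t * f1 t + kappa t * h1 t)).
    by apply/funext => t; field.
  have b1 := aintM ck kB a1; have b2 := aintM ck kB a2.
  by rewrite meanZ ?meanD//; [lra|exact: aintD].
have [_ cv] := DC kappa B ck kB.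
rewrite -(cvg_lim _ cv)//; apply: limr_ge; first by apply/cvg_ex; eexists; exact: cv.
exists K => // n /= Kn; have [kn hn _ _] := FP n.
by apply: (hc _ _ _ hn); exact: leq_trans kn.
Qed.

End weak_limit.

(** * Poisson majorants *)

Section poisson_majorant.
Context {R : realType}.
Local Notation C := R[i].

(** The denominator k + 2 keeps every radius strictly between 0 and 1. *)
Definition radius (k : nat) : R := 1 - (k.+2)%:R^-1.

Lemma radius_gt0 k : 0 < radius k.
Proof. by rewrite subr_gt0 invf_lt1 ?ltr0n// ltr1n. Qed.

Lemma radius_lt1 k : radius k < 1.
Proof. by rewrite ltrBlDr ltrDl invr_gt0 ltr0n. Qed.

Lemma cvg_radius : radius k @[k --> \oo] --> (1 : R).
Proof.
rewrite -[X in _ --> X]subr0; apply: cvgB; first exact: cvg_cst.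
have := @cvg_harmonic R; rewrite -(cvg_shiftS (@harmonic R)).
by apply: cvg_trans; apply: near_eq_cvg; apply: nearW => k.
Qed.

Lemma cvg_ge_sub (u : nat -> R) (l e : R) : u @ \oo --> l -> 0 < e ->
  exists K, forall k, (K <= k)%N -> l - e <= u k.
Proof.
move=> /cvgrPdist_le/(_ e) H /H [K _ HK]; exists K => k /HK /=.
by rewrite ler_norml; lra.
Qed.

Lemma cvg_radial (r : nat -> R) (z : C) : r @ \oo --> (1 : R) -> ((r k)%:C)%C * z @[k --> \oo] --> z.
Proof.
move=> r1; have rk : ((r k)%:C)%C @[k --> \oo] --> (1 : C).
  by apply: (@cvg_complex R nat \oo _ r (fun=> 0) 1 0 r1); exact: cvg_cst.
have E : (1 : C) * z = z by exact: mul1r.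
have h : ((r k)%:C)%C * z @[k --> \oo] --> (1 : C) * z.
  apply: (@ccvgM R nat \oo _ (fun k => ((r k)%:C)%C) (fun=> z) 1 z rk).
  exact: cvg_cst.
by move: h; rewrite E; exact.
Qed.

Lemma continuous_radial (v : C -> R) (z : C) : {for z, continuous v} ->
  v (((radius k)%:C)%C * z) @[k --> \oo] --> v z.
Proof.
move=> cv; apply: (@cvg_comp _ _ _ (fun k => ((radius k)%:C)%C * z) v _ (nbhs z)) => //.
exact/cvg_radial/cvg_radius.
Qed.

Lemma continuous_sub_circle (v : C -> R) (r : R) : subharmonic v 1 -> 0 < r -> r < 1 ->
  continuous (fun t => v (on_circle r t)).
Proof.
move=> sv r0 r1; have -> : (fun t => v (on_circle r t)) = (fun t => v (0 + on_circle r t)).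
  by apply/funext => t; rewrite add0r.
apply: continuous_circle => t.
rewrite add0r; have n1 : normc (on_circle r t) < 1 by rewrite normc_on_circle// ltW.
by have [] := sv _ n1.
Qed.

(** On each smaller circle v is dominated by a Poisson integral of its own
    values; phi is a weak limit of these values as the radius tends to 1.  When
    - v is subharmonic as well, both inequalities hold. *)
Lemma L2_poisson_majorant (v : C -> R) (M : R) : subharmonic v 1 ->
  (forall r, 0 < r -> r < 1 -> mean (fun t => v (on_circle r t) ^+ 2) <= M) ->
  exists phi : R -> R, [/\ aint phi, aint (fun t => phi t ^+ 2),
   (forall z, normc z < 1 -> v z <= poisson phi z) &
   (subharmonic (fun z => - v z) 1 -> forall z, normc z < 1 -> v z = poisson phi z)].
Proof.
move=> sv vM; pose g k t := v (on_circle (radius k) t).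
have cg k : continuous (g k).
  by apply: continuous_sub_circle => //; [exact: radius_gt0|exact: radius_lt1].
have gi k : aint (g k) by exact: aint_cont.
have g2 k : aint (fun t => g k t ^+ 2).
  by apply: aint_cont => t; apply: cvgM; exact: cg.
have [phi [ip ip2 _ H]] := @L2_weak_limit R g M gi g2
  (fun k => vM _ (radius_gt0 k) (radius_lt1 k)).
have le z : normc z < 1 -> v z <= poisson phi z.
  move=> z1; apply/ler_addgt0Pr => e e0; rewrite -lerBlDr.
  have [cv _] := sv z z1.
  have [K HK] := cvg_ge_sub (continuous_radial cv) e0.
  apply: (H _ _ _ K (continuous_poisson_kernel z1) (fun t => poisson_kernel_le t z1)).
  move=> k Kk; apply: le_trans (HK k Kk) _.
  exact: (subharmonic_le_poisson_dilate sv (radius_gt0 k) (radius_lt1 k) z1).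
exists phi; split => // sNv z z1; apply/eqP; rewrite eq_le le//=.
have [cv _] := sNv z z1.
rewrite -lerN2; apply/ler_addgt0Pr => e e0; rewrite -lerBlDr.
have [K HK] := cvg_ge_sub (continuous_radial cv) e0.
have -> : - poisson phi z = mean (fun t => - poisson_kernel z t * phi t).
  rewrite /poisson -mulN1r -meanZ; last exact: aint_poisson.
  by apply: eq_mean => t _; rewrite mulN1r mulNr.
apply: (H _ (2 / (1 - normc z)) _ K).
- by move=> t; apply: cvgN; exact: continuous_poisson_kernel.
- by move=> t; rewrite normrN poisson_kernel_le.
move=> k Kk; apply: le_trans (HK k Kk) _.
have := subharmonic_le_poisson_dilate sNv (radius_gt0 k) (radius_lt1 k) z1.
move/le_trans; apply; rewrite le_eqVlt; apply/orP; left; apply/eqP.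
by apply: eq_mean => t _; rewrite mulNr mulrN.
Qed.

End poisson_majorant.

Section nontangential.
Context {R : realType}.
Local Notation C := R[i].
Local Notation mu := (@lebesgue_measure R).

Lemma chord_sqr (t s : R) : normc (eitheta t - eitheta s : C) ^+ 2 = 2 - 2 * cos (t - s).
Proof.
rewrite normc_sqr !(ReB, ImB) /= cosB.
have h1 := cos2Dsin2 t; have h2 := cos2Dsin2 s.
have -> : 2 - 2 * (cos t * cos s + sin t * sin s) =
  (cos t ^+ 2 + sin t ^+ 2) + (cos s ^+ 2 + sin s ^+ 2) - 2 * (cos t * cos s + sin t * sin s).
  by rewrite h1 h2; ring.
ring.
Qed.

(** By the mean value theorem, the derivative of the sine being at least cos 1
    on [0, 1]. *)
Lemma sin_ge_cos1 (y : R) : 0 <= y <= 1 -> cos 1 * y <= sin y.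
Proof.
move=> /andP[y0 y1]; move: y0; rewrite le_eqVlt => /predU1P[<-|y0].
  by rewrite mulr0 sin0.
have cs : {within `[0, y], continuous (@sin R)}.
  by apply: continuous_subspaceT; exact: continuous_sin.
have [x /[!in_itv] /= /andP[x0 xy]] := MVT y0 (fun x _ => is_derive_sin x) cs.
rewrite sin0 !subr0 => ->; rewrite ler_wpM2r ?(ltW y0)// ltW//.
have pi1 : 1 < pi :> R by have := @pi_ge2 R; lra.
by rewrite ltr_cos ?in_itv//=; lra.
Qed.

Lemma chord_ge (t s : R) : `|t - s| <= 1 ->
  cos 1 * `|t - s| <= normc (eitheta t - eitheta s : C).
Proof.
move=> ts; have c1 : 0 < cos 1 :> R by exact: cos1_gt0.
rewrite -(@ler_pXn2r _ 2) ?nnegrE ?normc_ge0 ?mulr_ge0 ?(ltW c1)//.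
rewrite chord_sqr; set x := t - s in ts *.
have -> : cos x = cos `|x| by case: (ler0P x); rewrite ?cosN.
have -> : `|x| = `|x| / 2 + `|x| / 2 by rewrite -splitr.
set y := `|x| / 2; have y01 : 0 <= y <= 1 by have := normr_ge0 x; rewrite /y; lra.
have h1 := sin_ge_cos1 y01; have h2 := cos2Dsin2 y.
rewrite cosD; have -> : 2 - 2 * (cos y * cos y - sin y * sin y) = 4 * sin y ^+ 2.
  have -> : cos y * cos y = 1 - sin y ^+ 2 by rewrite -h2; ring.
  by ring.
have -> : (cos 1 * (y + y)) ^+ 2 = 4 * (cos 1 * y) ^+ 2 by ring.
rewrite ler_pM2l// lerXn2r ?nnegrE//; have /andP[y0 _] := y01.
  by rewrite mulr_ge0// ltW.
by apply: le_trans h1; rewrite mulr_ge0// ltW.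
Qed.

(** The bounds on s keep the arc from t to s, taken either way around the
    circle, at least rho long. *)
Lemma chord_far (t s rho : R) : 0 < rho -> rho <= 1 -> rho <= s -> rho <= 2 * pi - s ->
  0 <= t <= 2 * pi -> rho <= `|t - s| ->
  2 - 2 * cos rho <= normc (eitheta t - eitheta s : C) ^+ 2.
Proof.
move=> r0 r1 rs rs2 /andP[t0 t2] rts; rewrite chord_sqr lerD2l lerN2 ler_wpM2l//.
have pi1 : 1 < pi :> R by have := @pi_ge2 R; lra.
set x := t - s in rts *.
have -> : cos x = cos `|x| by case: (ler0P x); rewrite ?cosN.
have xle : `|x| <= 2 * pi - rho by rewrite /x ler_norml; lra.
have dec u : rho <= u <= pi -> cos u <= cos rho.
  move=> /andP[ru up]; move: ru; rewrite le_eqVlt => /predU1P[->//|ru].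
  by rewrite ltW// ltr_cos ?in_itv//=; lra.
have [xpi|xpi] := leP `|x| pi; first by apply: dec; rewrite rts.
have -> : cos `|x| = cos (2 * pi - `|x|).
  by rewrite -[RHS]cosN opprB -[RHS]cosD2pi mulr_natl subrK.
by apply: dec; lra.
Qed.

Lemma lebesgue_pt_ball (f : R -> R) (x eta : R) : lebesgue_pt f x -> 0 < eta ->
  exists2 rho : R, 0 < rho & forall r, 0 < r -> r < rho ->
   (\int[mu]_(y in ball x r) `|f y - f x|%:E <= (eta * (2 * r))%:E)%E.
Proof.
move=> /fine_cvgP[fin /cvgrPdist_lt/(_ _) H] eta0.
have : \forall r \near 0^'+, davg f x r \is a fin_num /\ `|0 - fine (davg f x r)| < eta.
  by near=> r; split; near: r => //; exact: H.
case=> rho /= rho0 {}H; exists rho => // r r0 rr.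
have [fr] := H r ltac:(by rewrite /= sub0r normrN gtr0_norm) r0.
rewrite sub0r normrN ger0_norm; last by rewrite fine_ge0// davg_ge0.
rewrite -lte_fin fineK// /davg /iavg lebesgue_measure_ball ?(ltW r0)//.
move=> /ltW; rewrite inver mulrn_eq0/= gt_eqF//.
rewrite muleC lee_pdivrMr ?mulrn_wgt0// -EFinM mulr_natl.
exact.
Unshelve. all: by end_near. Qed.

End nontangential.

(** * Nontangential limits of Poisson integrals *)

Section fatou.
Context {R : realType}.
Local Notation C := R[i].
Local Notation mu := (@lebesgue_measure R).

Let mA : measurable (@angles R : set (measurableTypeR R)).
Proof. by rewrite /angles. Qed.

(** Lebesgue points live on the line and means on an interval of angles; the
    extension of phi by 0 relates the two. *)
Lemma mean_ball_le (phi : R -> R) (t0 r c : R) : aint phi -> angles t0 ->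
  (\int[mu]_(y in ball t0 r) `|(phi \_ angles) y - (phi \_ angles) t0|%:E <= c%:E)%E ->
  aint (fun t => `|phi t - phi t0| * \1_(ball t0 r) t) /\
  2 * pi * mean (fun t => `|phi t - phi t0| * \1_(ball t0 r) t) <= c.
Proof.
move=> ip t0A Hc; set J := fun t => _.
have mB : measurable (ball t0 r : set (measurableTypeR R)) by exact: measurable_ball.
have iq : aint (fun t => `|phi t - phi t0|).
  by apply: aint_norm; apply: aintB => //; exact: aint_cst.
have J0 t : 0 <= J t by rewrite mulr_ge0.
have iJ : aint J.
  apply: (aint_le _ _ iq).
    by apply: measurable_funM; [exact: aint_measurable|exact: measurable_funTS].
  by move=> t _; rewrite ger0_norm// ler_piMr// indicE; case: (_ \in _).
split => //; rewrite -lee_fin -integral_aint//; apply: le_trans Hc.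
rewrite [leLHS]integral_mkcond [leRHS]integral_mkcond.
have mphi : measurable_fun [set: R] (phi \_ angles).
  exact: ((measurable_restrictT phi mA).1 (aint_measurable ip)).
apply: ge0_le_integral => //.
- by move=> t _; rewrite patchE; case: ifPn => // _; rewrite lee_fin.
- apply: (measurable_restrictT (EFin \o J) mA).1; apply/measurable_EFinP; exact: (aint_measurable iJ).
- apply: (measurable_restrictT _ mB).1; apply/measurable_EFinP.
  apply: measurableT_comp => //; apply: measurable_funB => //.
  exact: measurable_funTS.
move=> t _; rewrite !patchE; case: ifPn => tA; last by case: ifPn; rewrite ?lee_fin.
rewrite /J indicE; case: ifPn => tB; last by rewrite mulr0.
by rewrite lee_fin (mem_set t0A) mulr1.
Qed.

Lemma poisson_kernel_bound (z : C) (t s d : R) : s = 1 - normc z -> 0 < s -> 0 < d ->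
  d <= normc (eitheta t - z) -> poisson_kernel z t <= 2 * s / d ^+ 2.
Proof.
move=> -> s0 d0 dz; have n0 := normc_ge0 z.
apply: ler_pM.
- by rewrite subr_ge0 expr_le1// ltW// -subr_gt0.
- by rewrite invr_ge0 sqr_ge0.
- rewrite -subr_ge0; have -> : 2 * (1 - normc z) - (1 - normc z ^+ 2) = (1 - normc z) ^+ 2 by ring.
  exact: sqr_ge0.
- rewrite lef_pV2 ?posrE ?exprn_gt0//; last exact: lt_le_trans dz.
  by rewrite lerXn2r// nnegrE ?normc_ge0// ltW.
Qed.

Section kernel_decomposition.
Variables (z : C) (t0 a s : R) (q : R -> R).
Hypothesis a0 : 0 < a.
Hypothesis sE : s = 1 - normc z.
Hypothesis s0 : 0 < s.
Hypothesis za : normc (z - eitheta t0) < a * s.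
Hypothesis q0 : forall t, 0 <= q t.

Let b : R := 32 * (1 + a) ^+ 2 / cos 1 ^+ 2.

Let c1 : 0 < cos 1 :> R. Proof. exact: cos1_gt0. Qed.

(** In a Stolz angle, the distance from z to any point of the circle dominates
    the distance from that point to the vertex. *)
Lemma stolz_dist t : normc (eitheta t - eitheta t0 : C) / (1 + a) <= normc (eitheta t - z).
Proof.
rewrite ler_pdivrMr ?addr_gt0//.
have h1 := eitheta_dist z t; rewrite -sE in h1.
have := normcD (eitheta t - z) (z - eitheta t0); rewrite addrA subrK.
set A := normc (eitheta t - z) in h1 *; move=> h2.
have h3 := ler_wpM2l (ltW a0) h1; apply: le_trans h2 _.
by rewrite mulrDr mulr1 lerD2l (le_trans (ltW za))// (mulrC A).
Qed.

(** Dyadic decomposition of the Poisson kernel: it is O(1 / (4^k s)) on the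
    annulus 2^(k-1) s <= |t - t0| < 2^k s. *)
Lemma kernel_le_dyadic n t : 2 ^+ n * s <= 1 -> `|t - t0| < 2 ^+ n * s ->
  poisson_kernel z t * q t <=
  \sum_(k < n.+1) b / s / 4 ^+ k * (q t * \1_(ball t0 (2 ^+ k * s)) t).
Proof.
have b0 : 0 < b by rewrite /b divr_gt0 ?mulr_gt0 ?exprn_gt0// addr_gt0.
have coef k : 0 <= b / s / 4 ^+ k.
  by apply: divr_ge0; [apply: divr_ge0; exact: ltW|exact: exprn_ge0].
have term k : 0 <= b / s / 4 ^+ k * (q t * \1_(ball t0 (2 ^+ k * s)) t).
  by apply: mulr_ge0 => //; apply: mulr_ge0.
have inball k : `|t - t0| < 2 ^+ k * s -> \1_(ball t0 (2 ^+ k * s)) t = 1 :> R.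
  by move=> h; rewrite indicE mem_set// /ball /= distrC.
have c1le : cos 1 ^+ 2 <= 1 :> R by rewrite expr_le1 ?cos_le1// ltW.
have b2 : 2 <= b.
  rewrite /b ler_pdivlMr ?exprn_gt0//; apply: (@le_trans _ _ 2); first by rewrite ler_piMr.
  have : 1 <= (1 + a) ^+ 2 by rewrite exprn_ege1// lerDl ltW.
  lra.
elim: n => [_|n IH n1].
  rewrite expr0 mul1r => ts; rewrite big_ord_recr big_ord0 /= add0r inball ?expr0 ?mul1r//.
  rewrite divr1 mulr1 ler_wpM2r//.
  apply: le_trans (poisson_kernel_bound sE s0 s0 _) _; first by rewrite sE eitheta_dist.
  have -> : 2 * s / s ^+ 2 = 2 / s by field; rewrite gt_eqF.
  by rewrite ler_wpM2r// invr_ge0 ltW.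
move=> ts; rewrite big_ord_recr /=.
have n1' : 2 ^+ n * s <= 1.
  apply: le_trans n1; rewrite ler_wpM2r ?(ltW s0)// exprS ler_peMl ?exprn_ge0// ler1n//.
have [tn|tn] := ltP `|t - t0| (2 ^+ n * s).
  by apply: le_trans (IH n1' tn) _; rewrite lerDl.
rewrite ler_wpDl//; first by rewrite sumr_ge0.
rewrite inball// mulr1 ler_wpM2r//.
have d0 : 0 < cos 1 * (2 ^+ n * s) / (1 + a).
  by rewrite divr_gt0 ?addr_gt0// mulr_gt0// mulr_gt0// exprn_gt0.
apply: le_trans (poisson_kernel_bound sE s0 d0 _) _.
  apply: le_trans (stolz_dist t); rewrite ler_wpM2r ?invr_ge0 ?addr_ge0 ?(ltW a0)//.
  apply: le_trans (chord_ge _); last by apply: le_trans n1; exact: ltW.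
  by rewrite ler_wpM2l// ltW.
have -> : 2 * s / (cos 1 * (2 ^+ n * s) / (1 + a)) ^+ 2 = b / s / 4 ^+ n.+1 / 4.
  rewrite /b; have -> : (4 : R) ^+ n.+1 = 4 * (2 ^+ n * 2 ^+ n).
    by rewrite exprS -exprMn; congr (_ * _ ^+ n); rewrite -natrM.
  field; rewrite !gt_eqF ?addr_gt0 ?exprn_gt0//.
rewrite ler_pdivrMr// ler_peMr//; lra.
Qed.

End kernel_decomposition.

(** The deviation of the Poisson integral from phi t0 is at most the mean of the
    kernel times q = |phi - phi t0|.  On |t - t0| < rho, the dyadic bound on the
    kernel and the Lebesgue point property leave a convergent geometric sum of
    size eta; on the rest of the circle the kernel is O(1 - |z|). *)
Lemma nontangential_poisson (phi : R -> R) (t0 : R) : aint phi -> 0 < t0 -> t0 < 2 * pi ->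
  lebesgue_pt (phi \_ angles) t0 ->
  forall a e : R, 0 < a -> 0 < e -> exists2 de : R, 0 < de & forall z : C,
    normc z < 1 -> normc (z - eitheta t0) < a * (1 - normc z) ->
    normc (z - eitheta t0) < de -> `|poisson phi z - phi t0| <= e.
Proof.
move=> ip t0p t02 lp a e a0 e0.
have t0A : angles t0 by rewrite /angles /= in_itv /= !ltW.
pose q t := `|phi t - phi t0|.
have iq : aint q by apply: aint_norm; apply: aintB => //; exact: aint_cst.
have q0 t : 0 <= q t by exact: normr_ge0.
pose b : R := 32 * (1 + a) ^+ 2 / cos 1 ^+ 2.
have b0 : 0 < b by rewrite /b divr_gt0 ?mulr_gt0 ?exprn_gt0 ?cos1_gt0// addr_gt0.
pose eta := e / (4 * b).
have eta0 : 0 < eta by rewrite divr_gt0// mulr_gt0.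
have [rho1 rho10 Hball] := lebesgue_pt_ball lp eta0.
pose rho := Num.min (Num.min (1 / 2) (rho1 / 2)) (Num.min t0 (2 * pi - t0)).
have rho0 : 0 < rho by rewrite !lt_min !divr_gt0//= t0p subr_gt0.
have [r1 r2 r3 r4] : [/\ 2 * rho <= 1, 2 * rho <= rho1, rho <= t0 & rho <= 2 * pi - t0].
  have h1 : rho <= 1 / 2 by rewrite !ge_min lexx.
  have h2 : rho <= rho1 / 2 by rewrite !ge_min lexx !orbT.
  have h3 : rho <= t0 by rewrite !ge_min lexx !orbT.
  have h4 : rho <= 2 * pi - t0 by rewrite !ge_min lexx !orbT.
  by split => //; lra.
have pi1 : 1 < pi :> R by have := @pi_ge2 R; lra.
pose ka := 2 * (1 + a) ^+ 2 / (2 - 2 * cos rho).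
have cr : 0 < 2 - 2 * cos rho.
  have : cos rho < cos 0 by rewrite ltr_cos ?in_itv//=; lra.
  by rewrite cos0; lra.
have ka0 : 0 <= ka by rewrite divr_ge0 ?(ltW cr)// mulr_ge0// sqr_ge0.
have mq0 : 0 <= mean q by exact: mean_ge0.
have kq : 0 < 2 * (ka * mean q + 1) by rewrite mulr_gt0// ltr_wpDl// mulr_ge0.
exists (Num.min rho (e / (2 * (ka * mean q + 1)))); first by rewrite lt_min rho0 divr_gt0.
move=> z z1 za; rewrite lt_min => /andP[zr ze].
set s := 1 - normc z in za.
have s0 : 0 < s by rewrite subr_gt0.
have sle : s <= normc (z - eitheta t0) by rewrite normcBC eitheta_dist.
(* The number of dyadic shells needed to cover |t - t0| < rho. *)
have [n [n1 n2]] : exists n, rho <= 2 ^+ n * s /\ 2 ^+ n * s < 2 * rho.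
  have ex : exists n, rho <= 2 ^+ n * s.
    have [n nP] : exists n : nat, rho / s < n%:R.
      have := archi_boundP (ltW (divr_gt0 rho0 s0)).
      by exists (Num.bound (rho / s)).
    exists n; rewrite -ler_pdivrMr// ltW// (lt_trans nP)//.
    by rewrite -natrX ltr_nat ltn_expl.
  case: (ex_minnP ex) => n nr min; exists n; split => //.
  case: n nr min => [|n] _ min; first by rewrite expr0 mul1r; lra.
  rewrite exprS -mulrA ltr_pM2l// ltNge; apply/negP => /min.
  by rewrite ltnn.
pose J k t := q t * \1_(ball t0 (2 ^+ k * s)) t.
have Jk k : (k <= n)%N -> aint (J k) /\ mean (J k) <= eta * (2 ^+ k * s).
  move=> kn; set r := 2 ^+ k * s.
  have rp : 0 < r by rewrite mulr_gt0// exprn_gt0.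
  have rr : r < rho1.
    apply: le_lt_trans (lt_le_trans n2 r2); rewrite ler_wpM2r ?(ltW s0)//.
    by rewrite ler_eXn2l// ltr1n.
  have [iJ mJ] := mean_ball_le ip t0A (Hball r rp rr); split => //.
  have er : 0 <= eta * r by rewrite mulr_ge0 ?ltW.
  rewrite -(ler_pM2l (@twopi_gt0 R)); apply: le_trans mJ _.
  have -> : eta * (2 * r) = 2 * (eta * r) by ring.
  rewrite ler_wpM2r//; lra.
have coef k : 0 <= b / s / 4 ^+ k.
  by apply: divr_ge0; [apply: divr_ge0; exact: ltW|exact: exprn_ge0].
pose T m t := \sum_(k < m) b / s / 4 ^+ k * J k t.
have Tm m : (m <= n.+1)%N -> aint (T m) /\ mean (T m) <= 2 * b * eta * (1 - (2 ^+ m)^-1).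
  elim: m => [_|m IH mn].
    have -> : T 0%N = fun=> 0 by apply/funext => t; rewrite /T big_ord0.
    by split; [exact: aint_cst|rewrite mean_cst expr0 invr1 subrr mulr0].
  have [iT mT] := IH (ltnW mn); have [iJ mJ] := Jk m mn.
  have -> : T m.+1 = fun t => T m t + b / s / 4 ^+ m * J m t.
    by apply/funext => t; rewrite /T big_ord_recr.
  have iZ := aintZ (b / s / 4 ^+ m) iJ.
  split; first exact: aintD.
  rewrite meanD// meanZ//.
  have c0 := coef m.
  apply: le_trans (lerD mT (ler_wpM2l c0 mJ)) _.
  have -> : (4 : R) ^+ m = 2 ^+ m * 2 ^+ m.
    by rewrite -exprMn; congr (_ ^+ m); rewrite -natrM.
  rewrite le_eqVlt; apply/orP; left; apply/eqP; rewrite exprS; field.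
  by rewrite expf_neq0//= gt_eqF.
have [iT mT] := Tm n.+1 (leqnn _).
have dom t : angles t -> poisson_kernel z t * q t <= T n.+1 t + ka * s * q t.
  move=> tA; have kq0 : 0 <= ka * s * q t by apply: mulr_ge0 => //; apply: mulr_ge0 => //; exact: ltW.
  have T0 : 0 <= T n.+1 t.
    by apply: sumr_ge0 => k _; apply: mulr_ge0 => //; apply: mulr_ge0.
  have [tr|tr] := ltP `|t - t0| rho.
    rewrite ler_wpDr//; apply: kernel_le_dyadic => //; first by apply: le_trans (ltW n2) r1.
    exact: lt_le_trans tr n1.
  rewrite ler_wpDl// ler_wpM2r//.
  have ch := chord_far rho0 _ r3 r4 _ tr.
  have {}ch : 2 - 2 * cos rho <= normc (eitheta t - eitheta t0 : C) ^+ 2.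
    by apply: ch; [lra|move: tA; rewrite /angles /= in_itv].
  have chp : 0 < normc (eitheta t - eitheta t0 : C).
    rewrite lt_neqAle normc_ge0 andbT; apply: contraTneq ch => <-.
    by rewrite expr0n /= -ltNge.
  have d0 : 0 < normc (eitheta t - eitheta t0 : C) / (1 + a) by rewrite divr_gt0// addr_gt0.
  apply: le_trans (poisson_kernel_bound erefl s0 d0 (stolz_dist a0 erefl za t)) _.
  have -> : 2 * s / (normc (eitheta t - eitheta t0 : C) / (1 + a)) ^+ 2 =
    2 * (1 + a) ^+ 2 * s / normc (eitheta t - eitheta t0 : C) ^+ 2.
    by field; rewrite !gt_eqF// addr_gt0.
  have -> : ka * s = 2 * (1 + a) ^+ 2 * s / (2 - 2 * cos rho) by rewrite /ka mulrAC.
  have c0 : 0 <= 2 * (1 + a) ^+ 2 * s.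
    by apply: mulr_ge0; [apply: mulr_ge0 => //; exact: sqr_ge0|exact: ltW].
  by apply: ler_wpM2l => //; rewrite lef_pV2 ?posrE ?exprn_gt0.
rewrite -[X in _ - X](poisson_cst (phi t0) z1) -poissonB//; last exact: aint_cst.
have iB : aint (fun t => phi t - phi t0) by apply: aintB => //; exact: aint_cst.
have iPB := aint_poisson iB z1.
apply: le_trans (norm_mean_le iPB) _.
have iR : aint (fun t => T n.+1 t + ka * s * q t) by apply: aintD => //; exact: aintZ.
apply: (@le_trans _ _ (mean (fun t => T n.+1 t + ka * s * q t))).
  apply: le_mean => //; first exact: aint_norm.
  by move=> t tA; rewrite normrM ger0_norm ?poisson_kernel_ge0//; exact: dom.
rewrite meanD//; last exact: aintZ.
rewrite meanZ//.
have h1 : mean (T n.+1) <= e / 2.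
  apply: le_trans mT _; have -> : e / 2 = 2 * b * eta * 1 by rewrite /eta; field; rewrite gt_eqF.
  have c0 : 0 <= 2 * b * eta by apply: mulr_ge0; [apply: mulr_ge0 => //; exact: ltW|exact: ltW].
  by apply: ler_wpM2l => //; rewrite gerBl invr_ge0 exprn_ge0.
have h2 : s * (ka * mean q + 1) <= e / 2.
  have : s < e / (2 * (ka * mean q + 1)) by exact: le_lt_trans sle ze.
  rewrite ltr_pdivlMr// => h; have -> : s * (ka * mean q + 1) = s * (2 * (ka * mean q + 1)) / 2 by field.
  by rewrite ler_pM2r ?invr_gt0// ltW.
have : ka * s * mean q = s * (ka * mean q + 1) - s by ring.
lra.
Qed.

(** Almost every angle is a Lebesgue point of the extension of phi by 0; the two
    end points of the interval of angles are left out, because there this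
    extension sees only one side of the circle. *)
Lemma ae_nontangential_poisson (phi : R -> R) : aint phi ->
  {ae mu, forall t0, angles t0 -> forall a e : R, 0 < a -> 0 < e ->
    exists2 de : R, 0 < de & forall z : C,
    normc z < 1 -> normc (z - eitheta t0) < a * (1 - normc z) ->
    normc (z - eitheta t0) < de -> `|poisson phi z - phi t0| <= e}.
Proof.
move=> ip.
have lp : {ae mu, forall t, lebesgue_pt (phi \_ angles) t}.
  by apply: lebesgue_differentiation; exact: integrable_locally_restrict.
have ends : {ae mu, forall t, t != 0 /\ t != 2 * pi}.
  exists ([set 0] `|` [set 2 * pi]); split.
  - exact: measurableU.
  - apply: null_set_setU => //; exact: lebesgue_measure_set1.
  - move=> t /= nt; have [->|t1] := eqVneq t 0; first by left.
    by have [->|t2] := eqVneq t (2 * pi); [right|case: nt].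
apply: ae_imp (ae_and lp ends) => t0 [lt0 [t1 t2]].
rewrite /angles /= in_itv /= => /andP[h1 h2].
by apply: nontangential_poisson => //; rewrite lt_neqAle ?h1 ?h2 ?(eq_sym 0) ?t1 ?t2.
Qed.

End fatou.

(** * Nontangential limits of bounded holomorphic functions *)

Section nontangential.
Context {R : realType}.
Local Notation C := R[i].
Local Notation mu := (@lebesgue_measure R).

Definition approach (a t : R) : set_system C := within (stolz a (eitheta t)) (nbhs (eitheta t : C)).

Global Instance approach_filter a t : Filter (approach a t).
Proof. exact: within_filter. Qed.

Definition has_nt_limit (G : C -> C) (t : R) (l : C) :=
  forall a : R, 1 < a -> G z @[z --> approach a t] --> l.

Lemma approach_disc a t : \forall z \near approach a t, normc z < 1.
Proof. by rewrite /approach near_withinE; apply: nearW => z []. Qed.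

Lemma ae_cvg_poisson (phi : R -> R) : aint phi ->
  {ae mu, forall t, angles t -> forall a, 1 < a -> poisson phi z @[z --> approach a t] --> phi t}.
Proof.
move=> ip; apply: ae_imp (ae_nontangential_poisson ip) => t H tA a a1.
apply/cvgrPdist_le => e e0.
have [de de0 {}H] := H tA a e (lt_trans ltr01 a1) e0.
rewrite /approach near_withinE; apply/nbhs_C; exists de => // z zd [z1 za].
by rewrite distrC; exact: H.
Qed.

(** Radii lie in every Stolz angle, so nontangential limits are radial limits;
    this is how they are identified. *)
Lemma radial_approach (r : nat -> R) a t : (forall k, 0 < r k < 1) -> r @ \oo --> (1 : R) ->
  1 < a -> on_circle (r k) t @[k --> \oo] --> approach a t.
Proof.
move=> r01 r1 a1; have c1 := @cvg_radial R r (eitheta t) r1.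
move=> A; rewrite /approach /within /= => /c1; rewrite /= !nbhs_simpl /=.
apply: filterS => k /= kA; apply: kA.
have /andP[r0 rk] := r01 k.
have nk : normc (((r k)%:C)%C * eitheta t) = r k.
  by rewrite normcM normc_eitheta mulr1 normc_real gtr0_norm.
split; first by rewrite /unit_disc /mkset nk.
have -> : ((r k)%:C)%C * eitheta t - eitheta t = (((r k - 1)%:C)%C : C) * eitheta t.
  have -> : (((r k - 1)%:C)%C : C) = ((r k)%:C)%C - 1.
    by rewrite (rmorphB (real_complex R)) rmorph1.
  by rewrite mulrBl mul1r.
rewrite nk normcM normc_eitheta mulr1 normc_real ltr0_norm ?subr_lt0// opprB.
by rewrite ltr_pMl// subr_gt0.
Qed.

Lemma approach_radial (T : topologicalType) (G : C -> T) (r : nat -> R) (t : R) (l : T) (a : R) :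
  (forall k, 0 < r k < 1) -> r @ \oo --> (1 : R) -> 1 < a ->
  G z @[z --> approach a t] --> l -> G (on_circle (r k) t) @[k --> \oo] --> l.
Proof.
move=> r01 r1 a1 Gl; apply: (@cvg_comp _ _ _ (fun k => on_circle (r k) t) G _ (approach a t)) => //.
exact: radial_approach.
Qed.

(** The real and imaginary parts are harmonic with bounded square means, hence
    Poisson integrals. *)
Lemma ae_nt_limit_bounded (b : C -> C) (K : R) :
  (forall z, normc z < 1 -> holo_at b z) -> (forall z, normc z < 1 -> normc (b z) <= K) ->
  {ae mu, forall t, angles t -> exists l, has_nt_limit b t l}.
Proof.
move=> hb bK.
have K0 : 0 <= K.
  by apply: le_trans (normc_ge0 _) (bK 0 _); rewrite normc0.
have rep (v : C -> R) : subharmonic v 1 -> subharmonic (fun z => - v z) 1 ->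
    (forall z, `|v z| <= normc (b z)) ->
    exists2 phi, aint phi & forall z, normc z < 1 -> v z = poisson phi z.
  move=> sv sv' vb.
  have vM r : 0 < r -> r < 1 -> mean (fun t => v (on_circle r t) ^+ 2) <= K ^+ 2.
    move=> r0 r1; rewrite -[leRHS]mean_cst; apply: le_mean; last 1 first.
    - move=> t _; rewrite -(ger0_norm (sqr_ge0 (v _))) normrX lerXn2r ?nnegrE//.
      by apply: le_trans (vb _) (bK _ _); rewrite normc_on_circle// ltW.
    - apply: aint_cont => t; apply: cvgM; exact: continuous_sub_circle.
    - exact: aint_cst.
  have [phi [ip _ _ eq]] := L2_poisson_majorant sv vM.
  by exists phi => //; exact: eq.
have sN (v : C -> R) : subharmonic (fun z => -1 * v z) 1 -> subharmonic (fun z => - v z) 1.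
  by congr subharmonic; apply/funext => z; rewrite mulN1r.
have s1 (v : C -> R) : subharmonic (fun z => 1 * v z) 1 -> subharmonic v 1.
  by congr subharmonic; apply/funext => z; rewrite mul1r.
have [f1 i1 e1] := rep _ (s1 _ (subharmonic_Re hb 1)) (sN _ (subharmonic_Re hb (-1)))
  (fun z => Re_le_normc (b z)).
have [f2 i2 e2] := rep _ (s1 _ (subharmonic_Im hb 1)) (sN _ (subharmonic_Im hb (-1)))
  (fun z => Im_le_normc (b z)).
apply: ae_imp (ae_and (ae_cvg_poisson i1) (ae_cvg_poisson i2)) => t [H1 H2] tA.
exists (f1 t +i* f2 t)%C => a a1.
have h := @cvg_complex R C (approach a t) (approach_filter a t) _ _ _ _ (H1 tA a a1) (H2 tA a a1).
apply: (cvg_trans _ h).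
apply: (@near_eq_cvg _ _ (approach a t) (approach_filter a t)).
have := approach_disc a t; apply: filterS => z z1.
by rewrite -e1// -e2// -complexE.
Qed.

End nontangential.

(** * Boundary values in Hardy spaces *)

Section hardy_space.
Context {R : realType}.
Local Notation C := R[i].
Local Notation re := (@complex.Re R).
Local Notation im := (@complex.Im R).
Local Notation mu := (@lebesgue_measure R).

Let mA : measurable (@angles R : set (measurableTypeR R)).
Proof. by rewrite /angles. Qed.

Lemma radius01 k : 0 < @radius R k < 1.
Proof. by rewrite radius_gt0 radius_lt1. Qed.

(** A limit superior is measurable in zeta without any exceptional set, and it is
    the radial limit wherever the latter exists. *)
Definition radial_limsup (v : C -> R) (zeta : C) : R :=
  fine (limn_esup (fun k => (v (((radius k)%:C)%C * zeta))%:E)).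

Definition boundary_value (F : C -> C) (zeta : C) : C :=
  (radial_limsup (re \o F) zeta +i* radial_limsup (im \o F) zeta)%C.

Lemma radial_limsupE (v : C -> R) zeta l :
  v (((radius k)%:C)%C * zeta) @[k --> \oo] --> l -> radial_limsup v zeta = l.
Proof.
move=> vl; rewrite /radial_limsup.
have h : (v (((radius k)%:C)%C * zeta))%:E @[k --> \oo] --> l%:E by apply: cvg_EFin => //; exact: nearW.
by rewrite (cvg_limn_einf_sup h).2.
Qed.

Lemma boundary_valueE (F : C -> C) t l : has_nt_limit F t l -> boundary_value F (eitheta t) = l.
Proof.
move=> Fl; have a1 : (1 : R) < 2 by rewrite ltr1n.
have h : F (on_circle (radius k) t) @[k --> \oo] --> l.
  exact: approach_radial radius01 cvg_radius a1 (Fl 2 a1).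
rewrite /boundary_value (radial_limsupE (l := re l)) ?(radial_limsupE (l := im l)); last 2 first.
- exact: (@cvg_Im R nat \oo _ _ l h).
- exact: (@cvg_Re R nat \oo _ _ l h).
by rewrite -complexE.
Qed.

Lemma measurable_radial_limsup (v : C -> R) : (forall z, normc z < 1 -> {for z, continuous v}) ->
  measurable_fun (@angles R) (fun t => radial_limsup v (eitheta t)).
Proof.
move=> cv; apply: (@measurableT_comp _ _ _ _ _ _ fine); first exact: fine_measurable.
apply: measurable_fun_limn_esup => k; apply/measurable_EFinP; apply: measurable_funTS.
apply: continuous_measurable_fun => t.
apply: (@continuous_comp _ _ _ (on_circle (radius k)) v); first exact: continuous_on_circle.
by apply: cv; rewrite normc_on_circle ?radius_lt1// ltW ?radius_gt0.
Qed.

Lemma measurable_boundary_value (F : C -> C) : (forall z, normc z < 1 -> holo_at F z) ->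
  cmeasurable (@angles R) (boundary_value F \o @eitheta R).
Proof.
move=> hF; split; apply: measurable_radial_limsup => z z1.
- exact: (@cvg_Re R C (nbhs z) _ F (F z) (holo_continuous (hF z z1))).
- exact: (@cvg_Im R C (nbhs z) _ F (F z) (holo_continuous (hF z z1))).
Qed.

Lemma powR_half_sqr (x p : R) : (x `^ (p / 2)) ^+ 2 = x `^ p.
Proof. by rewrite -powR_mulrn ?powR_ge0// -powRrM -mulrA mulVf// mulr1. Qed.

(** This bounds F exp (- u) when |F|^(p/2) <= u: apply e^y >= y at y = u / s and
    raise to the power s. *)
Lemma powR_expN_le (x u s : R) : 0 < s -> 0 <= x -> x `^ s^-1 <= u -> x * expR (- u) <= s `^ s.
Proof.
move=> s0 x0 xu; have u0 : 0 <= u by exact: le_trans (powR_ge0 _ _) xu.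
have -> : x = (x `^ s^-1) `^ s by rewrite -powRrM mulVf ?gt_eqF// powRr1.
have -> : expR (- u) = expR (- (u / s)) `^ s.
  by rewrite -expRM mulNr -mulrA mulVf ?gt_eqF// mulr1.
rewrite -powRM ?powR_ge0 ?expR_ge0//.
apply: ge0_ler_powR; rewrite ?nnegrE ?(ltW s0)//.
  by apply: mulr_ge0; [exact: powR_ge0|exact: expR_ge0].
rewrite expRN ler_pdivrMr ?expR_gt0//; apply: le_trans xu _.
have := expR_ge1Dx (u / s); rewrite -(ler_pM2l s0) mulrDr mulr1 mulrCA divff ?gt_eqF// mulr1.
by move=> h; apply: le_trans h; rewrite lerDr ltW.
Qed.

Section fixed_function.
Variables (F : C -> C) (p M : R).
Hypothesis hF : forall z, normc z < 1 -> holo_at F z.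
Hypothesis p0 : 0 < p.
Hypothesis FM : forall r, 0 < r -> r < 1 -> mean (fun t => normc (F (on_circle r t)) `^ p) <= M.

Lemma hardy_majorant : exists phi, [/\ aint phi, aint (fun t => phi t ^+ 2) &
  forall z, normc z < 1 -> normc (F z) `^ (p / 2) <= poisson phi z].
Proof.
have p2 : 0 < p / 2 by rewrite divr_gt0.
have vM r : 0 < r -> r < 1 -> mean (fun t => (normc (F (on_circle r t)) `^ (p / 2)) ^+ 2) <= M.
  by move=> r0 r1; under eq_fun do rewrite powR_half_sqr; exact: FM.
have [phi [i1 i2 le _]] := L2_poisson_majorant (subharmonic_norm_powR hF p2) vM.
by exists phi.
Qed.

(** F is the quotient of the bounded holomorphic functions F G and G, where
    |G| = e^(-u) for a Poisson integral u that dominates |F|^(p/2). *)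
Lemma ae_nt_limit_hardy : {ae mu, forall t, angles t -> exists l, has_nt_limit F t l}.
Proof.
have [phi [ip _ Fphi]] := hardy_majorant.
pose G (z : C) := cexp (- herglotz phi z).
have nG z : normc (G z) = expR (- poisson phi z).
  by rewrite normc_cexp -herglotz_re; case: (herglotz phi z).
have hG z : normc z < 1 -> holo_at G z.
  move=> z1; apply: (@holo_comp R (fun z => - herglotz phi z) cexp); last exact: holo_cexp.
  have := @holoB R (fun=> 0) (herglotz phi) z (@holo_cst R 0 z) (holo_herglotz ip z1).
  by congr (holo_at _ z); apply/funext => w; rewrite sub0r.
have pz z : normc z < 1 -> 0 <= poisson phi z.
  by move=> z1; exact: le_trans (powR_ge0 _ _) (Fphi z z1).
have bG z : normc z < 1 -> normc (G z) <= 1.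
  by move=> z1; rewrite nG -expR0 ler_expR oppr_le0 pz.
pose s := (p / 2)^-1.
have s0 : 0 < s by rewrite invr_gt0 divr_gt0.
have bFG z : normc z < 1 -> normc (F z * G z) <= s `^ s.
  move=> z1; rewrite normcM nG; apply: powR_expN_le => //; first exact: normc_ge0.
  by rewrite /s invrK; exact: Fphi.
have hFG z : normc z < 1 -> holo_at (fun z => F z * G z) z.
  by move=> z1; exact: (@holoM R F G z (hF z1) (hG z z1)).
have aeG := ae_nt_limit_bounded hG bG.
have aeFG := ae_nt_limit_bounded hFG bFG.
apply: ae_imp (ae_and (ae_cvg_poisson ip) (ae_and aeG aeFG)) => t [Ht [HG HFG]] tA.
have [g Gg] := HG tA; have [b FGb] := HFG tA.
exists (b / g) => a a1.
have FA := approach_filter a t.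
(* The modulus of the limit of G is e^(- phi t). *)
have g0 : g != 0.
  have a2 : (1 : R) < 2 by rewrite ltr1n.
  have h1 := @cvg_normc R nat \oo eventually_filter _ g (approach_radial radius01 cvg_radius a2 (Gg 2 a2)).
  have h2 : normc (G (on_circle (radius k) t)) @[k --> \oo] --> expR (- phi t).
    under eq_fun do rewrite nG.
    apply: (@continuous_cvg _ _ _ _ _ _ expR); first exact: continuous_expR.
    by apply: cvgN; exact: approach_radial radius01 cvg_radius a2 (Ht tA 2 a2).
  by rewrite -normc_gt0 (cvg_unique _ h1 h2)// expR_gt0.
have := @ccvgM R C (approach a t) FA _ _ _ _ (FGb a a1) (@ccvgV R C (approach a t) FA _ _ g0 (Gg a a1)).
have -> // : (fun z => F z * G z / G z) = F.
by apply/funext => z; rewrite mulfK// cexp_neq0.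
Qed.

Lemma ae_boundary_value : {ae mu, forall t, angles t ->
  has_nt_limit F t (boundary_value F (eitheta t))}.
Proof.
apply: ae_imp ae_nt_limit_hardy => t H /H[l Fl].
by rewrite (boundary_valueE Fl).
Qed.

End fixed_function.

Lemma powRD_le (x y p : R) : 0 < p -> 0 <= x -> 0 <= y ->
  (x + y) `^ p <= 2 `^ p * (x `^ p + y `^ p).
Proof.
move=> p0 x0 y0; have mono (u v : R) : 0 <= u -> u <= v -> u `^ p <= v `^ p.
  by move=> u0 uv; apply: ge0_ler_powR => //; rewrite ?nnegrE ?(ltW p0)// (le_trans u0).
have xy0 : 0 <= x + y by exact: addr_ge0.
rewrite mulrDr -!powRM//; have [xy|xy] := leP x y.
  apply: (@le_trans _ _ ((2 * y) `^ p)); first by apply: mono => //; lra.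
  by rewrite lerDr powR_ge0.
apply: (@le_trans _ _ ((2 * x) `^ p)); first by apply: mono => //; lra.
by rewrite lerDl powR_ge0.
Qed.

Lemma aint_ae_eq (f g : R -> R) : aint f -> measurable_fun (@angles R) g ->
  {ae mu, forall t, angles t -> f t = g t} -> aint g /\ mean g = mean f.
Proof.
move=> fi mg fg; have mf := aint_measurable fi.
have ae : ae_eq mu (@angles R) (EFin \o f) (EFin \o g).
  by apply: ae_imp fg => t H tA /=; rewrite H.
have gi : aint g.
  apply/integrableP; split; first exact/measurable_EFinP.
  have /integrableP[_] := fi; congr (_ < _)%E; apply: ge0_ae_eq_integral => //.
  - by apply: measurableT_comp => //; exact/measurable_EFinP.
  - by apply: measurableT_comp => //; exact/measurable_EFinP.
  - by apply: ae_imp fg => t H tA /=; rewrite H.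
split => //; have /(congr1 fine) : (\int[mu]_(t in @angles R) (f t)%:E = \int[mu]_(t in @angles R) (g t)%:E)%E.
  by apply: ae_eq_integral => //; exact/measurable_EFinP.
by rewrite !integral_aint//= => /(mulfI (lt0r_neq0 twopi_gt0)).
Qed.

(** Pratt's form of dominated convergence: Fatou's lemma for g n + psi - h n,
    with dominating functions that vary with n.  A single index is enough for
    its use on a sequence of means bounded below. *)
Lemma mean_cvg_pratt (h g : nat -> R -> R) (psi : R -> R) :
  (forall n, aint (g n)) -> (forall n, measurable_fun (@angles R) (h n)) ->
  (forall n t, angles t -> 0 <= h n t <= g n t + psi t) -> aint psi ->
  (forall t, angles t -> 0 <= psi t) -> (forall n, mean (g n) <= mean psi) ->
  {ae mu, forall t, angles t -> h n t @[n --> \oo] --> 0 /\ g n t @[n --> \oo] --> psi t} ->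
  forall e, 0 < e -> exists n, mean (h n) < e.
Proof.
move=> gi mh hg ip psi0 gp ae e e0; apply/not_existsP => H.
have hi n : aint (h n).
  apply: (@aint_le _ _ (fun t => g n t + psi t)) => //; last exact: aintD.
  by move=> t tA; have /andP[h0 h1] := hg n t tA; rewrite ger0_norm.
have he n : e <= mean (h n) by rewrite leNgt; apply/negP; exact: H.
pose k n t := g n t + psi t - h n t.
have iD n : aint (fun t => g n t + psi t) by exact: aintD.
have ki n : aint (k n) by exact: aintB.
have i2 : aint (fun t => psi t + psi t) by exact: aintD.
have : (\int[mu]_(t in @angles R) (psi t + psi t)%:E <= (2 * pi * (mean psi + mean psi - e))%:E)%E.
  apply: (@fatou_bound R k) => //.
  - by move=> n; exact: aint_measurable.
  - by move=> n t tA; have /andP[_ h1] := hg n t tA; rewrite subr_ge0.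
  - exact: aint_measurable.
  - by move=> t tA; rewrite addr_ge0 ?psi0.
  - apply: ae_imp ae => t Ht /Ht[h1 h2]; rewrite -[X in _ --> X]subr0.
    by apply: cvgB => //; apply: cvgD => //; exact: cvg_cst.
  - move=> n; rewrite integral_aint// lee_fin ler_pM2l ?twopi_gt0// meanB// meanD//.
    by have := gp n; have := he n; lra.
by rewrite integral_aint// lee_fin ler_pM2l ?twopi_gt0// meanD//; lra.
Qed.

Lemma measurable_normc (g : R -> C) : cmeasurable (@angles R) g ->
  measurable_fun (@angles R) (fun t => normc (g t)).
Proof.
move=> [m1 m2]; have -> : (fun t => normc (g t)) = (fun t => Num.sqrt (re (g t) ^+ 2 + im (g t) ^+ 2)).
  by apply/funext => t; rewrite -normc_sqr sqrtr_sqr ger0_norm ?normc_ge0.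
apply: (@measurableT_comp _ _ _ _ _ _ (@Num.sqrt R)); first exact: continuous_measurable_fun (@sqrt_continuous R).
by apply: measurable_funD; exact: measurable_funX.
Qed.

Lemma measurable_normc_powR (g : R -> C) (p : R) : cmeasurable (@angles R) g ->
  measurable_fun (@angles R) (fun t => normc (g t) `^ p).
Proof.
move=> mg; apply: (@measurableT_comp _ _ _ _ _ _ (fun x : R => x `^ p)); first exact: measurable_powR.
exact: measurable_normc.
Qed.

Lemma cvg_powR_ge0 (u : nat -> R) (l s : R) : 0 < s -> (forall k, 0 <= u k) -> 0 <= l ->
  u @ \oo --> l -> u k `^ s @[k --> \oo] --> l `^ s.
Proof.
move=> s0 u0 l0 ul.
have := @continuous_cvg _ _ _ _ eventually_filter _ (fun y : R => `|y| `^ s) _ (@continuous_norm_powR R _ s0 l) ul.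
rewrite ger0_norm// (_ : (fun y => _) \o u = (fun k => u k `^ s))//.
by apply/funext => k /=; rewrite ger0_norm.
Qed.

Section mean_convergence.
Variables (F : C -> C) (p M : R).
Hypothesis hF : forall z, normc z < 1 -> holo_at F z.
Hypothesis p0 : 0 < p.
Hypothesis FM : forall r, 0 < r -> r < 1 -> mean (fun t => normc (F (on_circle r t)) `^ p) <= M.
Local Notation bv t := (boundary_value F (eitheta t)).

Let p2 : 0 < p / 2. Proof. by rewrite divr_gt0. Qed.

Let mbv := measurable_boundary_value hF.

Let cF (r : R) : 0 < r -> r < 1 -> continuous (fun t : R => F (on_circle r t)).
Proof.
move=> r0 r1 t; apply: (@continuous_comp _ _ _ (on_circle r) F); first exact: continuous_on_circle.
by apply: holo_continuous; apply: hF; rewrite normc_on_circle// ltW.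
Qed.

Lemma measurable_sub_boundary r : 0 < r -> r < 1 ->
  cmeasurable (@angles R) (fun t => bv t - F (on_circle r t)).
Proof.
move=> r0 r1; split.
- have -> : re \o (fun t => bv t - F (on_circle r t)) = fun t => re (bv t) - re (F (on_circle r t)).
    by apply/funext => t /=; rewrite ReB.
  apply: measurable_funB; first exact: mbv.1.
  apply: measurable_funTS; apply: continuous_measurable_fun => t.
  exact: (@cvg_Re R R (nbhs t) _ _ _ (@cF r r0 r1 t)).
- have -> : im \o (fun t => bv t - F (on_circle r t)) = fun t => im (bv t) - im (F (on_circle r t)).
    by apply/funext => t /=; rewrite ImB.
  apply: measurable_funB; first exact: mbv.2.
  apply: measurable_funTS; apply: continuous_measurable_fun => t.
  exact: (@cvg_Im R R (nbhs t) _ _ _ (@cF r r0 r1 t)).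
Qed.

(** The maximum in psi makes the domination of the boundary value valid at every
    angle; it changes phi^2 on a null set only, since the inequality
    |F|^(p/2) <= u passes to the limit almost everywhere. *)
Lemma boundary_value_majorant : exists phi psi : R -> R, [/\ aint phi, aint (fun t => phi t ^+ 2),
  (forall z, normc z < 1 -> normc (F z) `^ (p / 2) <= poisson phi z) &
  [/\ aint psi, mean psi = mean (fun t => phi t ^+ 2), (forall t, normc (bv t) `^ p <= psi t) &
  {ae mu, forall t, angles t -> phi t ^+ 2 = psi t}]].
Proof.
have [phi [i1 i2 Fphi]] := hardy_majorant hF p0 FM.
pose psi t := Num.max (phi t ^+ 2) (normc (bv t) `^ p).
have mpsi : measurable_fun (@angles R) psi.
  apply: measurable_maxr; first exact: aint_measurable.
  exact: measurable_normc_powR.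
have ae : {ae mu, forall t, angles t -> phi t ^+ 2 = psi t}.
  apply: ae_imp (ae_and (ae_cvg_poisson i1) (ae_boundary_value hF p0 FM)) => t [h1 h2] tA.
  have a2 : (1 : R) < 2 by rewrite ltr1n.
  have c1 := approach_radial radius01 cvg_radius a2 (h1 tA 2 a2).
  have c2 : normc (F (on_circle (radius k) t)) `^ (p / 2) @[k --> \oo] --> normc (bv t) `^ (p / 2).
    have c2 := @cvg_normc R nat \oo eventually_filter _ _ (approach_radial radius01 cvg_radius a2 (h2 tA 2 a2)).
    by apply: cvg_powR_ge0 p2 _ (normc_ge0 _) c2 => k; exact: normc_ge0.
  have le : normc (bv t) `^ (p / 2) <= phi t.
    apply: ler_cvg_to c2 c1 _; apply: nearW => k; apply: Fphi.
    by rewrite normc_on_circle ?radius_lt1// ltW ?radius_gt0.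
  rewrite /psi max_l// -powR_half_sqr lerXn2r ?nnegrE ?powR_ge0//.
  by apply: le_trans le; exact: powR_ge0.
have [ipsi mp] := aint_ae_eq i2 mpsi ae.
exists phi, psi; split => //; split => // t.
by rewrite le_max lexx orbT.
Qed.

Lemma aint_boundary_value : aint (fun t => normc (bv t) `^ p).
Proof.
have [phi [psi [_ _ _ [ip _ le _]]]] := boundary_value_majorant.
apply: aint_le ip; first exact: measurable_normc_powR.
by move=> t _; rewrite ger0_norm ?powR_ge0.
Qed.

Lemma aint_sub_boundary r : 0 < r -> r < 1 ->
  aint (fun t => normc (bv t - F (on_circle r t)) `^ p).
Proof.
move=> r0 r1; pose q t := normc (F (on_circle r t)) `^ p.
have iq : aint q.
  apply: aint_cont => t.
  have -> : q = fun t => `|normc (F (on_circle r t))| `^ p.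
    by apply/funext => s; rewrite ger0_norm ?normc_ge0.
  apply: (@continuous_comp _ _ _ (fun t => normc (F (on_circle r t))) (fun y : R => `|y| `^ p)); last exact: continuous_norm_powR.
  exact: (@cvg_normc R R (nbhs t) _ _ _ (@cF r r0 r1 t)).
apply: (@aint_le _ _ (fun t => 2 `^ p * (normc (bv t) `^ p + q t))).
- by apply: measurable_normc_powR; exact: measurable_sub_boundary.
- move=> t _; rewrite ger0_norm ?powR_ge0//.
  apply: le_trans (powRD_le p0 (normc_ge0 _) (normc_ge0 _)).
  apply: ge0_ler_powR; rewrite ?nnegrE ?(ltW p0) ?normc_ge0 ?addr_ge0 ?normc_ge0//; exact: normcB.
- by apply: aintZ; apply: aintD => //; exact: aint_boundary_value.
Qed.

(** Along a sequence of radii contradicting the claim, [mean_cvg_pratt] applies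
    with u^2 on the circles as varying dominating functions: their means do not
    exceed that of phi^2 by Jensen's inequality. *)
Lemma mean_boundary_value_cvg (e : R) : 0 < e -> exists2 r0 : R, r0 < 1 &
  forall r, 0 < r -> r0 < r -> r < 1 -> mean (fun t => normc (bv t - F (on_circle r t)) `^ p) < e.
Proof.
move=> e0; apply: contrapT => H.
have ex k : exists r : R, [/\ 0 < r, radius k < r, r < 1 &
    e <= mean (fun t => normc (bv t - F (on_circle r t)) `^ p)].
  apply: contrapT => Hk; apply: H; exists (radius k); first exact: radius_lt1.
  move=> r r0 rk r1; rewrite ltNge; apply/negP => le; apply: Hk.
  by exists r.
have [r rP] := choice ex.
have r01 k : 0 < r k < 1 by have [-> _ ->] := rP k.
have r1 : r @ \oo --> (1 : R).
  apply: (@squeeze_cvgr _ _ _ _ radius (fun=> 1)); last exact: cvg_cst.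
    by apply: nearW => k; have [_ h1 h2 _] := rP k; rewrite !ltW.
  exact: cvg_radius.
have [phi [psi [i1 i2 Fphi [ip mp le eq]]]] := boundary_value_majorant.
pose c : R := 2 `^ p.
have c0 : 0 <= c by exact: powR_ge0.
pose u k t := poisson phi (on_circle (r k) t).
have cu k : continuous (u k).
  move=> t; apply: (@continuous_comp _ _ _ (on_circle (r k)) (poisson phi)); first exact: continuous_on_circle.
  by have /andP[h1 h2] := r01 k; apply: continuous_poisson => //; rewrite normc_on_circle// ltW.
have iu k : aint (fun t => u k t ^+ 2).
  by apply: aint_cont => t; apply: cvgM; exact: cu.
have disc k t : normc (on_circle (r k) t) < 1.
  by have /andP[h1 h2] := r01 k; rewrite normc_on_circle// ltW.
suff [k] : exists k, mean (fun t => normc (bv t - F (on_circle (r k) t)) `^ p) < e.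
  by have [_ _ _] := rP k; rewrite leNgt => /negP.
apply: (@mean_cvg_pratt _ (fun k t => c * u k t ^+ 2) (fun t => c * psi t)) => //
  [k|k|k t tA||t tA|k|].
- exact: aintZ.
- by have /andP[h1 h2] := r01 k; apply: measurable_normc_powR; exact: measurable_sub_boundary.
- rewrite powR_ge0 -mulrDr (addrC (_ ^+ 2)) /=.
  have h : normc (bv t - F (on_circle (r k) t)) `^ p <= (normc (bv t) + normc (F (on_circle (r k) t))) `^ p.
    apply: ge0_ler_powR; rewrite ?nnegrE ?(ltW p0) ?normc_ge0 ?addr_ge0 ?normc_ge0//; exact: normcB.
  apply: le_trans h _; apply: le_trans (powRD_le p0 (normc_ge0 _) (normc_ge0 _)) _.
  apply: ler_wpM2l => //; apply: lerD => //.
  have hh := Fphi _ (disc k t).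
  rewrite -powR_half_sqr lerXn2r ?nnegrE ?powR_ge0//; exact: le_trans (powR_ge0 _ _) hh.
- exact: aintZ.
- by apply: mulr_ge0 => //; apply: le_trans (le t); exact: powR_ge0.
- rewrite !meanZ// mp ler_wpM2l//; have /andP[h1 h2] := r01 k.
  rewrite -[leRHS](mean_poisson i2 h1 h2); apply: le_mean => //.
    apply: aint_cont => t; apply: (@continuous_comp _ _ _ (on_circle (r k)) (poisson _)); first exact: continuous_on_circle.
    exact: continuous_poisson.
  by move=> t _; exact: poisson_sqr.
- apply: ae_imp (ae_and eq (ae_and (ae_cvg_poisson i1) (ae_boundary_value hF p0 FM))) => t [h0 [h1 h2]] tA.
  have a2 : (1 : R) < 2 by rewrite ltr1n.
  have c1 := approach_radial r01 r1 a2 (h1 tA 2 a2).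
  have c2 := approach_radial r01 r1 a2 (h2 tA 2 a2).
  split; last first.
    rewrite -h0//; apply: cvgM; first exact: cvg_cst.
    by apply: cvgM.
  have c3 : normc (bv t - F (on_circle (r k) t)) @[k --> \oo] --> (0 : R).
    apply/cvgrPdist_lt => d d0; have /cvg_CP/(_ d d0) := c2; apply: filterS => k.
    by rewrite sub0r normrN ger0_norm ?normc_ge0// normcBC.
  have := cvg_powR_ge0 p0 (fun k => normc_ge0 _) (lexx 0) c3.
  by rewrite powR0 ?gt_eqF.
Qed.

End mean_convergence.
End hardy_space.

(** * Bicomplex Hardy spaces *)

Section bicomplex_hardy.
Context {R : realType}.
Local Notation C := R[i].
Local Notation B := (bicomplex R).
Local Notation re := (@complex.Re R).
Local Notation im := (@complex.Im R).
Local Notation mu := (@lebesgue_measure R).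

Lemma is_diff_partials (u : R * R -> R) (a : R * R) : differentiable u a ->
  is_diff a u (fun h => h.1 * 'D_(1, 0) u a + h.2 * 'D_(0, 1) u a).
Proof.
move=> du; rewrite !deriveE//; apply: DiffDef => //; apply/funext => h.
have eh : h = h.1 *: ((1, 0) : R * R) + h.2 *: ((0, 1) : R * R).
  case: h => x y; apply: injective_projections => /=.
    by rewrite -[x *: 1]/(x * 1) -[y *: 0]/(y * 0) mulr1 mulr0 addr0.
  by rewrite -[x *: 0]/(x * 0) -[y *: 1]/(y * 1) mulr1 mulr0 add0r.
by rewrite {1}eh linearD !linearZ.
Qed.

(** The two real equations contained in [d_zbar g z = 0] are the Cauchy-Riemann
    system. *)
Lemma holo_of_d_zbar (g : C -> C) z : real_differentiable g z -> d_zbar g z = 0 -> holo_at g z.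
Proof.
move=> [g1 g2] /eqP; rewrite /d_zbar mulf_eq0 invr_eq0 pnatr_eq0 /= eq_complex => /andP[].
rewrite /dx /dy /dir_derive !ReD !ImD !ReM !ImM /= => /eqP h1 /eqP h2.
have := is_diff_partials g1; have := is_diff_partials g2.
set a := 'D_(1, 0) (re \o g \o of_plane) (to_plane z) in h1 h2 *.
set b := 'D_(1, 0) (im \o g \o of_plane) (to_plane z) in h1 h2 *.
set c := 'D_(0, 1) (re \o g \o of_plane) (to_plane z) in h1 h2 *.
set d := 'D_(0, 1) (im \o g \o of_plane) (to_plane z) in h1 h2 *.
have -> : c = - b by lra.
have -> : d = a by lra.
move=> i2 i1; apply: (@cauchy_riemann_holo R g z a b) => //.
by apply: is_diff_eq i1 _; apply/funext => h; rewrite mulrN.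
Qed.

(** Conjugation changes the sign of the imaginary part, which turns the equation
    [d_z g z = 0] into the Cauchy-Riemann system. *)
Lemma holo_conj_of_d_z (g : C -> C) z : real_differentiable g z -> d_z g z = 0 ->
  holo_at (fun z => (g z)^*)%C z.
Proof.
move=> [g1 g2] /eqP; rewrite /d_z mulf_eq0 invr_eq0 pnatr_eq0 /= eq_complex => /andP[].
rewrite /dx /dy /dir_derive !ReB !ImB !ReM !ImM /= => /eqP h1 /eqP h2.
have := is_diff_partials g1; have := is_diff_partials g2.
set a := 'D_(1, 0) (re \o g \o of_plane) (to_plane z) in h1 h2 *.
set b := 'D_(1, 0) (im \o g \o of_plane) (to_plane z) in h1 h2 *.
set c := 'D_(0, 1) (re \o g \o of_plane) (to_plane z) in h1 h2 *.
set d := 'D_(0, 1) (im \o g \o of_plane) (to_plane z) in h1 h2 *.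
have -> : c = b by lra.
have -> : d = - a by lra.
move=> i2 i1; apply: (@cauchy_riemann_holo R _ z a (- b)).
  have -> : re \o (fun z => (g z)^*)%C \o of_plane = re \o g \o of_plane.
    by apply/funext => x /=; case: (g _).
  by apply: is_diff_eq i1 _; apply/funext => h; rewrite mulrN opprK.
have -> : im \o (fun z => (g z)^*)%C \o of_plane = - (im \o g \o of_plane).
  by apply/funext => x /=; rewrite /GRing.opp /=; case: (g _).
by apply: is_diff_eq (is_diffN i2) _; apply/funext => h; change (- (h.1 * b + h.2 * - a) = h.1 * - b + h.2 * a); ring.
Qed.

Lemma real_differentiable_plus (f : C -> B) z : real_differentiable (@bc1 R \o f) z ->
  real_differentiable (@bc2 R \o f) z -> real_differentiable (@bc_plus R \o f) z.
Proof.
move=> [a1 a2] [b1 b2]; split.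
  have -> : re \o (@bc_plus R \o f) \o of_plane =
      (re \o (@bc1 R \o f) \o of_plane) + (im \o (@bc2 R \o f) \o of_plane).
    by apply/funext => x; rewrite /GRing.add /= /bc_plus ReB ReM /=; ring.
  exact: differentiableD.
have -> : im \o (@bc_plus R \o f) \o of_plane =
    (im \o (@bc1 R \o f) \o of_plane) - (re \o (@bc2 R \o f) \o of_plane).
  by apply/funext => x; rewrite /GRing.add /GRing.opp /= /bc_plus ImB ImM /=; ring.
exact: differentiableB.
Qed.

Lemma real_differentiable_minus (f : C -> B) z : real_differentiable (@bc1 R \o f) z ->
  real_differentiable (@bc2 R \o f) z -> real_differentiable (@bc_minus R \o f) z.
Proof.
move=> [a1 a2] [b1 b2]; split.
  have -> : re \o (@bc_minus R \o f) \o of_plane =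
      (re \o (@bc1 R \o f) \o of_plane) - (im \o (@bc2 R \o f) \o of_plane).
    by apply/funext => x; rewrite /GRing.add /GRing.opp /= /bc_minus ReD ReM /=; ring.
  exact: differentiableB.
have -> : im \o (@bc_minus R \o f) \o of_plane =
    (im \o (@bc1 R \o f) \o of_plane) + (re \o (@bc2 R \o f) \o of_plane).
  by apply/funext => x; rewrite /GRing.add /= /bc_minus ImD ImM /=; ring.
exact: differentiableD.
Qed.

(** In the idempotent basis dbar acts as d/dz on the first component and as
    d/dz^* on the second one. *)
Lemma bc_holomorphic_components (f : C -> B) z : bc_holomorphic f -> normc z < 1 ->
  holo_at (fun z => (bc_plus (f z))^*)%C z /\ holo_at (fun z => bc_minus (f z)) z.
Proof.
move=> hf /hf[f1 f2]; rewrite bc_dbarE// => e.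
have [ep em] := @bc_decomp_unique R (d_z (@bc_plus R \o f) z) (d_zbar (@bc_minus R \o f) z).
have p0 : @bc_plus R 0 = 0 by rewrite /bc_plus /= mulr0 subr0.
have m0 : @bc_minus R 0 = 0 by rewrite /bc_minus /= mulr0 addr0.
split.
  apply: (@holo_conj_of_d_z (@bc_plus R \o f)); first exact: real_differentiable_plus.
  by rewrite -[LHS]ep e p0.
apply: (@holo_of_d_zbar (@bc_minus R \o f)); first exact: real_differentiable_minus.
by rewrite -[LHS]em e m0.
Qed.

Lemma bc_norm_ge0 (w : B) : 0 <= bc_norm w.
Proof. exact: sqrtr_ge0. Qed.

Lemma bc_norm_le (w : B) : bc_norm w <= normc (bc_plus w) + normc (bc_minus w).
Proof.
have h1 := normc_ge0 (bc_plus w); have h2 := normc_ge0 (bc_minus w).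
rewrite -[leRHS]ger0_norm ?addr_ge0// -sqrtr_sqr ler_wsqrtr//; nra.
Qed.

Lemma bc_norm_ge (w : B) : normc (bc_plus w) <= 2 * bc_norm w /\ normc (bc_minus w) <= 2 * bc_norm w.
Proof.
have h1 := normc_ge0 (bc_plus w); have h2 := normc_ge0 (bc_minus w).
have sq : (2 * bc_norm w) ^+ 2 = 2 * (normc (bc_plus w) ^+ 2 + normc (bc_minus w) ^+ 2).
  rewrite exprMn sqr_sqrtr; first by field.
  by rewrite divr_ge0// addr_ge0// sqr_ge0.
have b0 : 0 <= 2 * bc_norm w by rewrite mulr_ge0// bc_norm_ge0.
by split; rewrite -(@ler_pXn2r _ 2) ?nnegrE// sq; nra.
Qed.

Lemma bc_plusB (v w : B) : bc_plus (v - w) = bc_plus v - bc_plus w.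
Proof. by rewrite /bc_plus /=; ring. Qed.

Lemma bc_minusB (v w : B) : bc_minus (v - w) = bc_minus v - bc_minus w.
Proof. by rewrite /bc_minus /=; ring. Qed.

Lemma bc_norm_powR_le (p : R) (w : B) : 0 < p ->
  bc_norm w `^ p <= 2 `^ p * (normc (bc_plus w) `^ p + normc (bc_minus w) `^ p).
Proof.
move=> p0; apply: le_trans (powRD_le p0 (normc_ge0 _) (normc_ge0 _)).
apply: ge0_ler_powR; rewrite ?nnegrE ?(ltW p0) ?bc_norm_ge0 ?addr_ge0 ?normc_ge0//.
exact: bc_norm_le.
Qed.


Lemma real_bound (p : R) (N : C -> R) : bounded_means p N ->
  exists M : R, forall r, 0 < r -> r < 1 -> (circle_mean p N r <= M%:E)%E.
Proof.
rewrite /bounded_means; set S := ereal_sup _ => Soo.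
have le r : 0 < r -> r < 1 -> (circle_mean p N r <= S)%E.
  by move=> r0 r1; apply: ereal_sup_ubound; exists r => //=; rewrite in_itv /= r0 r1.
exists (fine S) => r r0 r1; apply: le_trans (le r r0 r1) _.
move: Soo; case: S {le} => [x||] //= _; exact: leNye.
Qed.

Lemma normc_conjB (a b : C) : normc (a - (b^*)%C) = normc ((a^*)%C - b).
Proof. by case: a b => [a1 a2] [b1 b2] /=; congr Num.sqrt; ring. Qed.

Section bicomplex_function.
Variables (f : C -> B) (p : R).
Hypothesis p0 : 0 < p.
Hypothesis hf : Hp_bicomplex p f.

Let F1 (z : C) : C := (bc_plus (f z))^*%C.
Let F2 (z : C) : C := bc_minus (f z).

Let h1 z : normc z < 1 -> holo_at F1 z.
Proof. move=> z1; exact: (bc_holomorphic_components hf.1 z1).1. Qed.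

Let h2 z : normc z < 1 -> holo_at F2 z.
Proof. move=> z1; exact: (bc_holomorphic_components hf.1 z1).2. Qed.

(** Each component is bounded by twice the bicomplex norm. *)
Lemma hardy_components : exists M : R, forall r, 0 < r -> r < 1 ->
  mean (fun t => normc (F1 (on_circle r t)) `^ p) <= M /\
  mean (fun t => normc (F2 (on_circle r t)) `^ p) <= M.
Proof.
have [M HM] := real_bound hf.2.
exists (2 `^ p * ((2 * pi)^-1 * M)) => r r0 r1.
have nf F : (forall z, normc z < 1 -> holo_at F z) ->
    continuous (fun t : R => normc (F (on_circle r t))).
  move=> hF t; apply: (@cvg_normc R R (nbhs t) _ (fun t : R => F (on_circle r t))).
  apply: (@continuous_comp _ _ _ (on_circle r) F); first exact: continuous_on_circle.
  by apply: holo_continuous; apply: hF; rewrite normc_on_circle// ltW.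
have pw (u : R -> R) : continuous u -> (forall t, 0 <= u t) -> aint (fun t => u t `^ p).
  move=> cu u0; have -> : (fun t => u t `^ p) = (fun t => `|u t| `^ p).
    by apply/funext => t; rewrite ger0_norm.
  apply: aint_cont => t; apply: (@continuous_comp _ _ _ u (fun y : R => `|y| `^ p)); first exact: cu.
  exact: continuous_norm_powR.
have iN : aint (fun t => bc_norm (f (on_circle r t)) `^ p).
  apply: pw => [|t]; last exact: bc_norm_ge0.
  pose u t := (normc (F1 (on_circle r t)) ^+ 2 + normc (F2 (on_circle r t)) ^+ 2) / 2.
  have -> : (fun t => bc_norm (f (on_circle r t))) = (fun t => Num.sqrt (u t)).
    by apply/funext => t; rewrite /bc_norm /u normc_conj.
  move=> t; apply: (@continuous_comp _ _ _ u Num.sqrt); last exact: sqrt_continuous.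
  apply: cvgM; last exact: cvg_cst.
  apply: cvgD; apply: cvgM; do ?[exact: (nf F1 h1)|exact: (nf F2 h2)].
have mN : mean (fun t => bc_norm (f (on_circle r t)) `^ p) <= (2 * pi)^-1 * M.
  rewrite -(ler_pM2l (@twopi_gt0 R)) [leRHS]mulrA divff ?lt0r_neq0 ?twopi_gt0// mul1r.
  by rewrite -lee_fin -integral_aint//; exact: HM.
have c0 : 0 <= 2 `^ p :> R by exact: powR_ge0.
have key (u : R -> R) : aint (fun t => u t `^ p) -> (forall t, 0 <= u t) ->
    (forall t, u t <= 2 * bc_norm (f (on_circle r t))) ->
    mean (fun t => u t `^ p) <= 2 `^ p * ((2 * pi)^-1 * M).
  move=> iu u0 ule; apply: le_trans (ler_wpM2l c0 mN); rewrite -meanZ//.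
  apply: le_mean => //; first exact: aintZ.
  move=> t _; rewrite -powRM ?bc_norm_ge0//.
  by apply: ge0_ler_powR; rewrite ?nnegrE ?(ltW p0) ?mulr_ge0 ?bc_norm_ge0.
split; apply: key => [|t|t]; try exact: normc_ge0; do ?[apply: pw => //].
- exact: nf.
- by move=> t; exact: normc_ge0.
- by rewrite normc_conj; have [] := bc_norm_ge (f (on_circle r t)).
- exact: nf.
- by move=> t; exact: normc_ge0.
- by have [] := bc_norm_ge (f (on_circle r t)).
Qed.

Let G1 := boundary_value F1.
Let G2 := boundary_value F2.

(** The boundary values are those of the two holomorphic components, the first
    one being conjugated back. *)
Let fnt (z : C) : B := ((G1 z)^*)%C *: bc_pplus + G2 z *: bc_pminus.

Let fnt_plus z : bc_plus (fnt z) = ((G1 z)^*)%C.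
Proof. exact: (bc_decomp_unique _ _).1. Qed.

Let fnt_minus z : bc_minus (fnt z) = G2 z.
Proof. exact: (bc_decomp_unique _ _).2. Qed.

Let m1 := measurable_boundary_value h1.
Let m2 := measurable_boundary_value h2.

Lemma measurable_bc_norm_powR (u v : R -> C) (w : R -> B) : cmeasurable (@angles R) u ->
  cmeasurable (@angles R) v -> (forall t, normc (bc_plus (w t)) = normc (u t)) ->
  (forall t, normc (bc_minus (w t)) = normc (v t)) ->
  measurable_fun (@angles R) (fun t => bc_norm (w t) `^ p).
Proof.
move=> mu' mv eu ev; apply: (@measurableT_comp _ _ _ _ _ _ (fun x : R => x `^ p)); first exact: measurable_powR.
rewrite (_ : (fun t => bc_norm (w t)) =
  (fun t => Num.sqrt ((normc (u t) ^+ 2 + normc (v t) ^+ 2) / 2))); last first.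
  by apply/funext => t; rewrite /bc_norm eu ev.
apply: (@measurableT_comp _ _ _ _ _ _ (@Num.sqrt R)); first exact: continuous_measurable_fun (@sqrt_continuous R).
apply: measurable_funM; last exact: measurable_cst.
by apply: measurable_funD; apply: measurable_funX; exact: measurable_normc.
Qed.

Lemma aint_bc_norm_powR (u v : R -> C) (w : R -> B) : cmeasurable (@angles R) u ->
  cmeasurable (@angles R) v -> (forall t, normc (bc_plus (w t)) = normc (u t)) ->
  (forall t, normc (bc_minus (w t)) = normc (v t)) ->
  aint (fun t => normc (u t) `^ p) -> aint (fun t => normc (v t) `^ p) ->
  aint (fun t => bc_norm (w t) `^ p) /\
  mean (fun t => bc_norm (w t) `^ p) <=
    2 `^ p * (mean (fun t => normc (u t) `^ p) + mean (fun t => normc (v t) `^ p)).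
Proof.
move=> mu' mv eu ev iu iv; have iS := aintZ (2 `^ p) (aintD iu iv).
have le t : bc_norm (w t) `^ p <= 2 `^ p * (normc (u t) `^ p + normc (v t) `^ p).
  by rewrite -eu -ev; exact: bc_norm_powR_le.
have iw : aint (fun t => bc_norm (w t) `^ p).
  apply: aint_le iS; first exact: (measurable_bc_norm_powR mu' mv eu ev).
  by move=> t _; rewrite ger0_norm ?powR_ge0.
by split => //; rewrite -meanD// -meanZ; [exact: le_mean|exact: aintD].
Qed.

Let half : (2^-1 : C) = ((2^-1 : R)%:C)%C.
Proof. by rewrite (fmorphV (real_complex R)) rmorph_nat. Qed.

Let fnt_bc1 z : bc1 (fnt z) = ((2^-1 : R)%:C)%C * ((G1 z)^*%C + G2 z).
Proof. by rewrite -half /fnt /=; ring. Qed.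

Let fnt_bc2 z : bc2 (fnt z) = ((2^-1 : R)%:C)%C * ('i%C * ((G1 z)^*%C - G2 z)).
Proof. by rewrite -half /fnt /=; ring. Qed.

Lemma Lp_boundary : Lp_circle p fnt.
Proof.
have [M HM] := hardy_components.
have i1 := aint_boundary_value h1 p0 (fun r r0 r1 => (HM r r0 r1).1).
have i2 := aint_boundary_value h2 p0 (fun r r0 r1 => (HM r r0 r1).2).
have e1 t : bc1 (fnt (eitheta t)) = ((2^-1 * (re (G1 (eitheta t)) + re (G2 (eitheta t)))) +i*
    (2^-1 * (im (G2 (eitheta t)) - im (G1 (eitheta t)))))%C.
  rewrite fnt_bc1; case: (G1 _) (G2 _) => [a b] [c d].
  by apply/eqP; rewrite eq_complex /=; apply/andP; split; apply/eqP; ring.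
have e2 t : bc2 (fnt (eitheta t)) = ((2^-1 * (im (G1 (eitheta t)) + im (G2 (eitheta t)))) +i*
    (2^-1 * (re (G1 (eitheta t)) - re (G2 (eitheta t)))))%C.
  rewrite fnt_bc2; case: (G1 _) (G2 _) => [a b] [c d].
  by apply/eqP; rewrite eq_complex /=; apply/andP; split; apply/eqP; ring.
have half_measurable (u : R -> R) : measurable_fun (@angles R) u ->
    measurable_fun (@angles R) (fun t => 2^-1 * u t).
  by move=> um; apply: measurable_funM => //; exact: measurable_cst.
split.
- split.
  + rewrite (_ : re \o _ = fun t => 2^-1 * (re (G1 (eitheta t)) + re (G2 (eitheta t)))); last first.
      by apply/funext => t; exact: (congr1 re (e1 t)).
    by apply: half_measurable; apply: measurable_funD; [exact: m1.1|exact: m2.1].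
  + rewrite (_ : im \o _ = fun t => 2^-1 * (im (G2 (eitheta t)) - im (G1 (eitheta t)))); last first.
      by apply/funext => t; exact: (congr1 im (e1 t)).
    by apply: half_measurable; apply: measurable_funB; [exact: m2.2|exact: m1.2].
- split.
  + rewrite (_ : re \o _ = fun t => 2^-1 * (im (G1 (eitheta t)) + im (G2 (eitheta t)))); last first.
      by apply/funext => t; exact: (congr1 re (e2 t)).
    by apply: half_measurable; apply: measurable_funD; [exact: m1.2|exact: m2.2].
  + rewrite (_ : im \o _ = fun t => 2^-1 * (re (G1 (eitheta t)) - re (G2 (eitheta t)))); last first.
      by apply/funext => t; exact: (congr1 im (e2 t)).
    by apply: half_measurable; apply: measurable_funB; [exact: m1.1|exact: m2.1].
have eq1 t : normc (bc_plus (fnt (eitheta t))) = normc (G1 (eitheta t)).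
  by rewrite fnt_plus normc_conj.
have eq2 t : normc (bc_minus (fnt (eitheta t))) = normc (G2 (eitheta t)) by rewrite fnt_minus.
have [i _] := aint_bc_norm_powR m1 m2 eq1 eq2 i1 i2.
by rewrite (integral_aint i) ltry.
Qed.

Lemma nontangential_boundary : nontangential_limit f fnt.
Proof.
have [M HM] := hardy_components.
have a1 := ae_boundary_value h1 p0 (fun r r0 r1 => (HM r r0 r1).1).
have a2 := ae_boundary_value h2 p0 (fun r r0 r1 => (HM r r0 r1).2).
apply: ae_imp (ae_and a1 a2) => t [c1 c2] tA a a0.
apply/cvgrPdist_lt => e e0; have e2 : 0 < e / 2 by rewrite divr_gt0.
have /(cvg_CP)/(_ _ e2) := c1 tA a a0; have /(cvg_CP)/(_ _ e2) := c2 tA a a0.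
rewrite /approach !near_withinE => n2 n1.
apply/nbhs_to_plane; apply: filterS2 n2 n1 => z n2 n1 /=.
rewrite to_planeK => zs; rewrite sub0r normrN ger0_norm ?bc_norm_ge0//.
apply: le_lt_trans (bc_norm_le _) _; rewrite bc_plusB bc_minusB fnt_plus fnt_minus.
by rewrite normc_conjB (splitr e) ltrD//; [exact: n1|exact: n2].
Qed.

Lemma mean_cvg_boundary :
  (\int[mu]_(t in @angles R) (bc_norm (fnt (eitheta t) - f (on_circle r t)) `^ p)%:E
     @[r --> 1^'-] --> 0)%E.
Proof.
have [M HM] := hardy_components.
pose d1 r t := G1 (eitheta t) - F1 (on_circle r t).
pose d2 r t := G2 (eitheta t) - F2 (on_circle r t).
have FM1 r r0 r1 := (HM r r0 r1).1; have FM2 r r0 r1 := (HM r r0 r1).2.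
have key r : 0 < r -> r < 1 ->
    aint (fun t => bc_norm (fnt (eitheta t) - f (on_circle r t)) `^ p) /\
    mean (fun t => bc_norm (fnt (eitheta t) - f (on_circle r t)) `^ p) <=
    2 `^ p * (mean (fun t => normc (d1 r t) `^ p) + mean (fun t => normc (d2 r t) `^ p)).
  move=> r0 r1; apply: aint_bc_norm_powR.
  - exact: measurable_sub_boundary.
  - exact: measurable_sub_boundary.
  - by move=> t; rewrite bc_plusB fnt_plus normcBC normc_conjB normcBC.
  - by move=> t; rewrite bc_minusB fnt_minus.
  - exact: (aint_sub_boundary h1 p0 FM1).
  - exact: (aint_sub_boundary h2 p0 FM2).
have c0 : 0 < 2 * pi * 2 `^ p * 2 :> R.
  by rewrite !mulr_gt0 ?pi_gt0// powR_gt0.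
have nr1 : \forall r \near (1 : R)^'-, r < 1 by exact: nbhs_left_lt.
have nr0 : \forall r \near (1 : R)^'-, 0 < r by exact: nbhs_left_gt.
apply/fine_cvgP; split.
  by near=> r; rewrite (integral_aint (key r _ _).1)//; near: r.
apply/cvgrPdist_lt => e e0; set c := 2 * pi * 2 `^ p * 2 in c0.
have ec : 0 < e / c by rewrite divr_gt0.
have [s1 s11 H1] := mean_boundary_value_cvg h1 p0 FM1 ec.
have [s2 s21 H2] := mean_boundary_value_cvg h2 p0 FM2 ec.
have n1 : \forall r \near (1 : R)^'-, s1 < r by exact: nbhs_left_gt.
have n2 : \forall r \near (1 : R)^'-, s2 < r by exact: nbhs_left_gt.
near=> r.
have r1 : r < 1 by near: r.
have r0 : 0 < r by near: r.
have s1r : s1 < r by near: r.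
have s2r : s2 < r by near: r.
have {}H1 := H1 r r0 s1r r1; have {}H2 := H2 r r0 s2r r1.
have [ir le] := key r r0 r1.
rewrite [X in `|_ - X|](congr1 fine (integral_aint ir)) sub0r normrN ger0_norm; last first.
  by apply: mulr_ge0; [exact: ltW twopi_gt0|apply: mean_ge0 => t _; exact: powR_ge0].
apply: le_lt_trans (ler_wpM2l (ltW twopi_gt0) le) _.
have -> : e = 2 * pi * (2 `^ p * (e / c + e / c)).
  rewrite -{1}(divfK (lt0r_neq0 c0) e); move: (e / c) => x; rewrite /c; ring.
by rewrite ltr_pM2l ?twopi_gt0// ltr_pM2l ?powR_gt0// ltrD.
Unshelve. all: by end_near. Qed.

Lemma hardy_bicomplex_limit : exists fnt : C -> B,
  [/\ Lp_circle p fnt, nontangential_limit f fnt &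
   (\int[mu]_(t in @angles R) (bc_norm (fnt (eitheta t) - f (on_circle r t)) `^ p)%:E
     @[r --> 1^'-] --> 0)%E].
Proof.
by exists fnt; split; [exact: Lp_boundary|exact: nontangential_boundary|exact: mean_cvg_boundary].
Qed.

End bicomplex_function.
End bicomplex_hardy.

Theorem theorem4p2 (R : realType) (p q : R) (f : R[i] -> bicomplex R)
    (w : R[i] -> R[i]) :
  0 < p ->
  2 < q \/ [/\ 1 < q, q <= 2 & (p%:E < crit_exponent q)%E] ->
  Hp_bicomplex p f ->
  Lq_disc q w ->
  Hp_w p w (fun z => bc_plus (f z)) ->
  exists fnt : R[i] -> bicomplex R,
    [/\ Lp_circle p fnt,
        nontangential_limit f fnt &
        (\int[lebesgue_measure]_(t in angles)
           (bc_norm (fnt (eitheta t) - f (on_circle r t)) `^ p)%:E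
           @[r --> 1^'-] --> 0)%E].
Proof.
by move=> p0 _ hf _ _; exact: hardy_bicomplex_limit.
Qed.
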